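(* Let $k\ge1$ be an integer, $\lambda_1,\lambda_2>0$, $\delta>0$ and $\gamma>0$. Let $\{Y(t)\}_{t\ge0}$ be the inverse Gaussian subordinator with parameters $\delta,\gamma$ and let $H(t)=\inf\{s\ge0:Y(s)>t\}$, $t\ge0$, be its first hitting time process, independent of the Skellam process of order $k$, $\{S^{k}(t)\}_{t\ge0}$, with parameters $\lambda_1,\lambda_2$. Let $p^k(n,t)=\mathrm{Pr}\{S^k(t)=n\}$. For $n\in\mathbb{Z}$, the probability mass function $\bar{p}^{f_3}(n,t)=\mathrm{Pr}\{S^{k}(H(t))=n\}$ solves the following differential equation: $$\begin{aligned}\delta\left(\gamma^{2}+2\frac{\mathrm{d}}{\mathrm{d} t}\right)^{1/2}\bar{p}^{f_{3}}(n,t)&=\left(\delta\gamma-k(\lambda_{1}+\lambda_{2})\right)\bar{p}^{f_{3}}(n,t)+\lambda_{1}\sum_{j=1}^{k}\bar{p}^{f_{3}}(n-j,t)\\ &\quad+\lambda_{2}\sum_{j=1}^{k}\bar{p}^{f_{3}}(n+j,t) -\delta\gamma\, \mathrm{Erf}\left(\frac{\gamma\sqrt{t}}{\sqrt{2}}\right)p^{k}(n,0),\end{aligned}$$ where $\mathrm{Erf}(\cdot)$ is the error function.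
   Context: Poisson process of order $k$ (PPoK) with intensity $\lambda>0$: $N^k(t)=\sum_{i=1}^{N(t)}X_i$, where $\{N(t)\}_{t\ge0}$ is a Poisson process with intensity $k\lambda$, and $\{X_i\}_{i\ge1}$ are iid, uniform on $\{1,2,\dots,k\}$, and independent of $\{N(t)\}_{t\ge0}$. Skellam process of order $k$ (SPoK): $S^k(t)=N_1^k(t)-N_2^k(t)$, where $\{N_1^k(t)\}_{t\ge0}$ and $\{N_2^k(t)\}_{t\ge0}$ are independent PPoK with intensities $\lambda_1>0$ and $\lambda_2>0$, respectively. Inverse Gaussian (IG) subordinator: the subordinator $\{Y(t)\}_{t\ge0}$ with Bernstein function $f_{3}(s)=\delta\left(\sqrt{2s+\gamma^2}-\gamma\right)$, $s>0$, i.e. $\mathbb{E}(e^{-sY(t)})=e^{-tf_3(s)}$. Operator: $\left(\gamma^{2}+2\frac{\mathrm{d}}{\mathrm{d}t}\right)^{1/2}u(t)=\sqrt{2}\,e^{-\gamma^2t/2}\,\partial_t^{1/2}\left[e^{\gamma^2t/2}u(t)\right]$, where $\partial_t^{1/2}v(t)=\frac{1}{\Gamma(1/2)}\int_0^t(t-s)^{-1/2}v'(s)\,\mathrm{d}s$ is the Caputo derivative of order $1/2$; equivalently, its Laplace transform in $t$ is $(\gamma^2+2z)^{1/2}\tilde u(z)-2(\gamma^2+2z)^{-1/2}u(0)$, with $\tilde u$ the Laplace transform of $u$.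
   Formalization: Erf in the last term is replaced by the complementary error function 1 - Erf, since the printed equation fails at n=0 (summing it over all n would force Erf = 1/2 for all t); the equation is asserted for t>0. *)

(* Defs.v *)
From HB Require Import structures.
From mathcomp Require Import all_boot all_order all_algebra.
From mathcomp Require Import all_classical all_reals all_analysis.

Set Implicit Arguments.
Unset Strict Implicit.
Unset Printing Implicit Defensive.
Import Order.TTheory GRing.Theory Num.Theory.
Import numFieldNormedType.Exports.

Local Open Scope classical_set_scope.
Local Open Scope ring_scope.

HB.instance Definition _ := isPointed.Build int 0.
HB.instance Definition _ := @isMeasurable.Build default_measure_display
  int discrete_measurable discrete_measurable0
  discrete_measurableC discrete_measurableU.

(* Real-time processes are functions of t : R; only t >= 0 is ever
   constrained or used. *)
Definition nonneg_times {R : realType} : set R := [set t | 0 <= t].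

Section independence.
Context {d : measure_display} {T : measurableType d} {R : realType}.
Variable P : probability T R.

Definition mutually_independent {d' : measure_display} {E : measurableType d'}
    (X : nat -> T -> E) : Prop :=
  forall (s : seq nat) (B : nat -> set E),
    uniq s -> (forall i, measurable (B i)) ->
    P (\bigcap_(i in [set` s]) (X i @^-1` B i)) =
    (\prod_(i <- s) P (X i @^-1` B i))%E.

Definition process_sigma_algebra {d' : measure_display}
    {E : measurableType d'} {I : Type} (D : set I) (X : I -> T -> E)
    : set (set T) :=
  <<s \bigcup_(i in D) preimage_set_system setT (X i) measurable >>.

Definition independent_processes {d1 d2 : measure_display}
    {E1 : measurableType d1} {E2 : measurableType d2} {I1 I2 : Type}
    (D1 : set I1) (X1 : I1 -> T -> E1) (D2 : set I2) (X2 : I2 -> T -> E2)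
    : Prop :=
  forall A B, process_sigma_algebra D1 X1 A -> process_sigma_algebra D2 X2 B ->
    P (A `&` B) = (P A * P B)%E.

End independence.

Section processes.
Context {d : measure_display} {T : measurableType d} {R : realType}.
Variable P : probability T R.

Record is_Poisson_process (mu : R) (N : R -> T -> nat) : Prop := {
  Poisson_measurable : forall t, 0 <= t -> measurable_fun setT (N t) ;
  Poisson_start : {ae P, forall w, N 0 w = 0%N} ;
  Poisson_nondecreasing :
    forall w s t, 0 <= s -> s <= t -> (N s w <= N t w)%N ;
  (* limit in the discrete space nat: right-continuous step paths *)
  Poisson_right_continuous :
    forall w t, 0 <= t -> N s w @[s --> t^'+] --> N t w ;
  Poisson_independent_increments :
    forall t : nat -> R, 0 <= t 0%N -> nondecreasing_seq t ->
      mutually_independent P (fun i w => (N (t i.+1) w - N (t i) w)%N) ;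
  Poisson_increment_law :
    forall s t n, 0 <= s -> s <= t ->
      P [set w | (N t w - N s w)%N = n] =
      (expR (- (mu * (t - s))) * (mu * (t - s)) ^+ n / n`!%:R)%:E }.

Definition is_PPoK (k : nat) (lambda : R) (Nk : R -> T -> nat) : Prop :=
  exists (N : R -> T -> nat) (X : nat -> T -> nat),
    [/\ is_Poisson_process (k%:R * lambda) N,
        forall i, measurable_fun setT (X i) /\
          (forall j, (1 <= j <= k)%N ->
             P [set w | X i w = j] = (k%:R^-1)%:E),
        mutually_independent P X,
        independent_processes P nonneg_times N setT X &
        forall t w, 0 <= t -> Nk t w = (\sum_(i < N t w) X i w)%N].

Definition is_SPoK (k : nat) (lambda1 lambda2 : R) (S : R -> T -> int) : Prop :=
  exists (N1 N2 : R -> T -> nat),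
    [/\ is_PPoK k lambda1 N1, is_PPoK k lambda2 N2,
        independent_processes P nonneg_times N1 nonneg_times N2 &
        forall t w, 0 <= t -> S t w = (N1 t w)%:Z - (N2 t w)%:Z].

(* A Levy process with nondecreasing right-continuous paths. *)
Record is_subordinator (Y : R -> T -> R) : Prop := {
  subordinator_measurable : forall t, 0 <= t -> measurable_fun setT (Y t) ;
  subordinator_start : {ae P, forall w, Y 0 w = 0} ;
  subordinator_nondecreasing :
    forall w s t, 0 <= s -> s <= t -> Y s w <= Y t w ;
  subordinator_right_continuous :
    forall w t, 0 <= t -> Y s w @[s --> t^'+] --> Y t w ;
  subordinator_independent_increments :
    forall t : nat -> R, 0 <= t 0%N -> nondecreasing_seq t ->
      mutually_independent P (fun i w => Y (t i.+1) w - Y (t i) w) ;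
  subordinator_stationary_increments :
    forall s t B, 0 <= s -> s <= t -> measurable B ->
      P [set w | B (Y t w - Y s w)] = P [set w | B (Y (t - s) w)] }.

Definition IG_Bernstein (delta gamma s : R) : R :=
  delta * (Num.sqrt (2 * s + gamma ^+ 2) - gamma).

Record is_IG_subordinator (delta gamma : R) (Y : R -> T -> R) : Prop := {
  IG_subordinator : is_subordinator Y ;
  IG_Laplace : forall s t, 0 < s -> 0 <= t ->
    ('E_P[(fun w => expR (- s * Y t w))] =
      (expR (- t * IG_Bernstein delta gamma s))%:E)%E }.

(* [inf] is the real infimum: it is 0 on the set of [w] whose path never
   exceeds [t], which is a null set for an IG subordinator. *)
Definition first_hitting_time (Y : R -> T -> R) (t : R) (w : T) : R :=
  inf [set s | 0 <= s /\ t < Y s w].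

Definition state_prob (Z : T -> int) (n : int) : R := fine (P [set w | Z w = n]).

End processes.

Section special_functions.
Context {R : realType}.
Local Notation mu := (@lebesgue_measure R).

Definition Gamma (a : R) : R :=
  \int[mu]_(x in `]0, +oo[) (x `^ (a - 1) * expR (- x)).

(* Only used for [0 <= x]. *)
Definition erf (x : R) : R :=
  2 / Num.sqrt pi * \int[mu]_(y in `[0, x]) expR (- y ^+ 2).

(* The source of the differential equation prints Erf for this function, but
   it has to be the complementary error function there: [IG_operator gamma]
   maps the constant 1 to [gamma * erf (gamma * sqrt t / sqrt 2)], so summing
   the equation over all states, where the probabilities add up to 1, forces
   the subtracted term to be
   [delta * gamma * (1 - erf (gamma * sqrt t / sqrt 2))]. *)
Definition erfc (x : R) : R := 1 - erf x.

Definition caputo_half_integrand (v : R -> R) (t s : R) : R :=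
  (t - s) `^ (- 2^-1) * derive1 v s.

(* [derive1] and the integral are total functions in the library; this says
   that the Caputo derivative is a genuine one at [t]. *)
Definition has_caputo_half (v : R -> R) (t : R) : Prop :=
  (forall s, 0 < s < t -> derivable v s 1) /\
  mu.-integrable `]0, t[ (EFin \o caputo_half_integrand v t).

Definition caputo_half (v : R -> R) (t : R) : R :=
  (Gamma 2^-1)^-1 * \int[mu]_(s in `]0, t[) caputo_half_integrand v t s.

Definition exp_tilt (gamma : R) (u : R -> R) (t : R) : R :=
  expR (gamma ^+ 2 * t / 2) * u t.

(* (gamma^2 + 2 d/dt)^(1/2) *)
Definition IG_operator (gamma : R) (u : R -> R) (t : R) : R :=
  Num.sqrt 2 * expR (- (gamma ^+ 2 * t / 2)) *
  caputo_half (exp_tilt gamma u) t.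

End special_functions.

(* Main.v *)
Require Import Defs.
From HB Require Import structures.
From mathcomp Require Import all_boot all_order all_algebra.
From mathcomp Require Import all_classical all_reals all_analysis.
From mathcomp Require Import measurable_realfun.
From mathcomp Require Import ring lra zify.

Set Implicit Arguments.
Unset Strict Implicit.
Unset Printing Implicit Defensive.
Import Order.TTheory GRing.Theory Num.Theory.
Import numFieldNormedType.Exports.

Local Open Scope classical_set_scope.
Local Open Scope ring_scope.

(** Let [H t] be the first hitting time and [u t] the mean of [phi (H t)], where
    [phi] is a mass [p n] of the Skellam process as a function of time.
    Conditioning on the independent hitting time identifies [u] with [pbar n]
    ([prob_time_change], by discretising the hitting time from the right).  The
    theorem then combines a half-order equation for [u], valid for every smooth
    [phi] with bounded derivatives ([caputo_mean_cdf]), with the forward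
    equation, which says that the derivative of [phi] is the generator of the
    Skellam process applied to the family of masses ([has_derivative_clamp]).

    Half-order equation.  The hitting time exceeds [x] exactly when the
    subordinator is at most [t] at time [x], up to null sets, so that its tail
    is an inverse Gaussian distribution function ([first_hitting_time_law]):
    [H t] is distributed as the running maximum of a Brownian motion with drift
    [gamma], divided by [delta].  Removing the drift by an exponential change of
    measure turns [expR (gamma ^+ 2 * t / 2) * u t] into the mean of an explicit
    function [f = transform phi J] of the absolute value of a driftless Brownian
    motion at time [t] ([transform_mean]).  On such heat means the half-order
    Caputo derivative acts by differentiating [f]: the time derivative brings
    out the density of a first passage time ([has_derivative_ntail_mean]), and
    the half-integral of that density is the heat kernel again
    ([integral_abel_passage]).  Finally the derivative of [f] is [gamma * f],
    plus [1 / delta] times the transform of the derivative of [phi], minus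
    [gamma * phi 0 * expR (- gamma * r)]; the heat mean of this last exponential
    is the source of the complementary error function.

    The law of the subordinator.  Only its Laplace transform is given.  At
    integer arguments this is the moment sequence of [expR (- Y x)], a variable
    in the unit interval, so Bernstein polynomials determine the law
    ([moment_determinacy], [IG_law]).

    Forward equation.  A Poisson process of order [k] is a compound Poisson
    process with steps at least 1, so its masses are finite sums with an
    explicit derivative ([PPoK_law], [has_derivative_PPoK_pmf]).  The masses of
    the difference of two such processes are series; their partial sums satisfy
    the forward equation up to a shift of the truncation level, and the
    integrated equation passes to the limit by dominated convergence. *)

(** * Derivatives and the fundamental theorem of calculus *)

Section derive_comp.
Context {R : realType}.
Implicit Types (f g : R -> R) (x d e : R).

(** The relational form of differentiability on the line.  It hides the class
    [is_derive], so that applying a rule below never starts an instance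
    search. *)
Definition has_derivative f x d : Prop := is_derive x (1 : R) f d.

Lemma has_derivative_val f x d e : has_derivative f x d -> d = e -> has_derivative f x e.
Proof. by move=> + <-. Qed.

Lemma has_derivative_cst c x : has_derivative (fun=> c) x 0.
Proof. exact: is_derive_cst. Qed.

Lemma has_derivative_id x : has_derivative (fun y : R => y) x 1.
Proof. exact: is_derive_id. Qed.

Lemma has_derivativeD f g x d e : has_derivative f x d -> has_derivative g x e ->
  has_derivative (fun y => f y + g y) x (d + e).
Proof. exact: is_deriveD. Qed.

Lemma has_derivativeB f g x d e : has_derivative f x d -> has_derivative g x e ->
  has_derivative (fun y => f y - g y) x (d - e).
Proof. exact: is_deriveB. Qed.

Lemma has_derivativeN f x d : has_derivative f x d ->
  has_derivative (fun y => - f y) x (- d).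
Proof. exact: is_deriveN. Qed.

Lemma has_derivativeZ (c : R) f x d : has_derivative f x d ->
  has_derivative (fun y => c * f y) x (c * d).
Proof. by move=> hf; exact: (@is_deriveZ _ _ _ _ c). Qed.

Lemma has_derivativeM f g x d e : has_derivative f x d -> has_derivative g x e ->
  has_derivative (fun y => f y * g y) x (d * g x + f x * e).
Proof.
move=> hf hg; have := is_deriveM hf hg; rewrite /GRing.scale/= => h.
by rewrite addrC [d * _]mulrC.
Qed.

Lemma has_derivative_sqr f x d : has_derivative f x d ->
  has_derivative (fun y => f y ^+ 2) x (2 * f x * d).
Proof.
move=> h; apply: (has_derivative_val (has_derivativeM h h)).
by rewrite -mulrA mulr2n mulrDl mul1r [d * _]mulrC.
Qed.

Lemma has_derivative_comp f g x d e : has_derivative f (g x) e -> has_derivative g x d ->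
  has_derivative (fun y => f (g y)) x (d * e).
Proof. by move=> hf hg; rewrite mulrC; exact: (@is_derive1_comp _ f). Qed.

Lemma has_derivative_expR g x d : has_derivative g x d ->
  has_derivative (fun y => expR (g y)) x (d * expR (g x)).
Proof. exact/has_derivative_comp/is_derive_expR. Qed.

Lemma has_derivative_sqrt g x d : 0 < g x -> has_derivative g x d ->
  has_derivative (fun y => Num.sqrt (g y)) x (d / (2 * Num.sqrt (g x))).
Proof. by move=> g0; exact/has_derivative_comp/is_derive1_sqrt. Qed.

Lemma has_derivativeV g x d : g x != 0 -> has_derivative g x d ->
  has_derivative (fun y => (g y)^-1) x (- (d / g x ^+ 2)).
Proof. by move=> g0 h; rewrite mulrC -mulNr; exact: is_deriveV. Qed.

Lemma has_derivative_powR (a : R) g x d : 0 < g x -> has_derivative g x d ->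
  has_derivative (fun y => g y `^ a) x (d * (a * g x `^ (a - 1))).
Proof.
by move=> g0; apply: (@has_derivative_comp (fun y => y `^ a)); exact: is_derive1_powR.
Qed.

Lemma has_derivative_continuous f x d : has_derivative f x d -> {for x, continuous f}.
Proof.
by move=> [h _]; apply: differentiable_continuous; apply/derivable1_diffP.
Qed.

Lemma has_derivative_derivable f x d : has_derivative f x d -> derivable f x 1.
Proof. by case. Qed.

Lemma has_derivative_derive1 f x d : has_derivative f x d -> derive1 f x = d.
Proof. by case=> _ <-; rewrite derive1E. Qed.

End derive_comp.

Section FTC.
Context {R : realType}.
Notation mu := (@lebesgue_measure R).
Implicit Types (f F : R -> R) (a b l : R).

Lemma FTC2_segment f F a b : a < b ->
  (forall x, a <= x <= b -> {for x, continuous f}) ->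
  (forall x, a < x < b -> has_derivative F x (f x)) ->
  {for a, continuous F} -> {for b, continuous F} ->
  (\int[mu]_(x in `[a, b]) (f x)%:E = (F b - F a)%:E)%E.
Proof.
move=> ab cf dF Fa Fb.
rewrite (@continuous_FTC2 R f F)// ?EFinB//.
- apply: continuous_in_subspaceT => x; rewrite inE/= in_itv/= => xab.
  exact: cf.
- split.
  + by move=> x; rewrite in_itv/= => /dF; exact: has_derivative_derivable.
  + exact: cvg_at_right_filter Fa.
  + exact: cvg_at_left_filter Fb.
- by move=> x; rewrite in_itv/= => /dF; exact: has_derivative_derive1.
Qed.

(** Monotone convergence along an exhaustion by segments turns the second
    fundamental theorem into a statement on open intervals, bounded or not,
    at whose ends the integrand may blow up. *)
Lemma ge0_FTC2_bigcup f F (a b : nat -> R) l :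
  (forall n, a n < b n) -> {homo a : n m / (n <= m)%N >-> m <= n} ->
  {homo b : n m / (n <= m)%N >-> n <= m} ->
  (forall n x, a n <= x <= b n -> has_derivative F x (f x)) ->
  (forall n x, a n <= x <= b n -> {for x, continuous f}) ->
  (forall n x, a n <= x <= b n -> 0 <= f x) ->
  F (b n) - F (a n) @[n --> \oo] --> l ->
  (\int[mu]_(x in \bigcup_n `[a n, b n]%classic) (f x)%:E = l%:E)%E.
Proof.
move=> ab na nb dF cf f0 Fl.
have FTCn n : (\int[mu]_(x in `[a n, b n]) (f x)%:E = (F (b n) - F (a n))%:E)%E.
  apply: FTC2_segment => //; first exact: cf.
  - by move=> x /andP[? ?]; apply: (dF n); rewrite !ltW.
  - by apply: has_derivative_continuous (dF n _ _); rewrite lexx ltW.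
  - by apply: has_derivative_continuous (dF n _ _); rewrite lexx ltW.
have sub : {homo (fun n => `[a n, b n]%classic) : n m / (n <= m)%N >-> (n <= m)%O}.
  move=> n m nm; apply/subsetPset => x /=; rewrite !in_itv/= => /andP[anx xbn].
  by rewrite (le_trans (na _ _ nm) anx) (le_trans xbn (nb _ _ nm)).
have mf n : measurable_fun (`[a n, b n]%classic) (EFin \o f).
  apply/measurable_EFinP; apply: subspace_continuous_measurable_fun => //.
  apply: continuous_in_subspaceT => x; rewrite inE/= in_itv/= => xab.
  exact: cf xab.
have f0' n x : `[a n, b n]%classic x -> (0 <= (EFin \o f) x)%E.
  by rewrite /= in_itv/= lee_fin; exact: f0.
have mI n : measurable (`[a n, b n]%classic : set (measurableTypeR R)) by [].
have := @ge0_nondecreasing_set_cvg_integral _ (measurableTypeR R) R _ _ mu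
  sub mI mf f0'.
under eq_fun do rewrite /= FTCn.
move/cvg_unique; apply => //.
by apply: cvg_EFin => //; exact: nearW.
Qed.

Lemma ge0_FTC2_oo f F a b la lb : a < b ->
  (forall x, a < x < b -> has_derivative F x (f x)) ->
  (forall x, a < x < b -> {for x, continuous f}) ->
  (forall x, a < x < b -> 0 <= f x) ->
  F x @[x --> a^'+] --> la -> F x @[x --> b^'-] --> lb ->
  (\int[mu]_(x in `]a, b[) (f x)%:E = (lb - la)%:E)%E.
Proof.
move=> ab dF cf f0 Fa Fb.
pose e n := (b - a) / n.+3%:R.
have e0 n : 0 < e n by rewrite divr_gt0 ?subr_gt0.
have e3 n : e n * 3 <= b - a.
  by rewrite /e mulrAC ler_pdivrMr// ler_wpM2l ?subr_ge0 ?(ltW ab)// ler_nat.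
have ne n m : (n <= m)%N -> e m <= e n.
  move=> nm; rewrite /e ler_wpM2l ?subr_ge0 ?(ltW ab)//.
  by rewrite lef_pV2 ?posrE// ler_nat.
have ecvg : e n @[n --> \oo] --> 0.
  rewrite /e -[X in _ --> X](mulr0 (b - a)); apply: cvgMr.
  have := @cvg_harmonic R; rewrite -(cvg_shiftn 2); apply: cvg_trans.
  by apply: near_eq_cvg; near=> n; rewrite /= addn2.
have -> : `]a, b[%classic = \bigcup_n `[a + e n, b - e n]%classic.
  apply/seteqP; split=> x /=; rewrite in_itv/=.
    move=> /andP[ax xb].
    have : \forall n \near \oo, e n < Num.min (x - a) (b - x).
      move/cvgrPdist_lt : ecvg => /(_ (Num.min (x - a) (b - x))).
      rewrite lt_min !subr_gt0 ax xb => /(_ isT); apply: filterS => n.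
      by rewrite sub0r normrN gtr0_norm.
    move=> [N _ /(_ N (leqnn _))]; rewrite /= lt_min => /andP[h1 h2].
    exists N => //=; rewrite in_itv/=; lra.
  by move=> [n _]/=; rewrite in_itv/= => /andP[h1 h2]; have := e0 n; lra.
have h n x : a + e n <= x <= b - e n -> a < x < b.
  by move=> /andP[h1 h2]; have := e0 n; lra.
apply: (@ge0_FTC2_bigcup f F).
- by move=> n; have := e3 n; have := e0 n; lra.
- by move=> n m /ne; lra.
- by move=> n m /ne; lra.
- by move=> n x /h; exact: dF.
- by move=> n x /h; exact: cf.
- by move=> n x /h; exact: f0.
- apply: cvgB.
  + move/cvg_at_leftP : Fb; apply; split.
      by move=> n; have := e0 n; lra.
    rewrite -[X in _ --> X]subr0; apply: cvgB => //; exact: cvg_cst.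
  + move/cvg_at_rightP : Fa; apply; split.
      by move=> n; have := e0 n; lra.
    rewrite -[X in _ --> X]addr0; apply: cvgD => //; exact: cvg_cst.
Unshelve. all: by end_near. Qed.

Lemma ge0_FTC2_oy f F a la ly :
  (forall x, a < x -> has_derivative F x (f x)) ->
  (forall x, a < x -> {for x, continuous f}) ->
  (forall x, a < x -> 0 <= f x) ->
  F x @[x --> a^'+] --> la -> F x @[x --> +oo] --> ly ->
  (\int[mu]_(x in `]a, +oo[) (f x)%:E = (ly - la)%:E)%E.
Proof.
move=> dF cf f0 Fa Fy.
pose e n : R := n.+1%:R^-1.
have e0 n : 0 < e n by rewrite invr_gt0.
have e1 n : e n <= 1 by rewrite invf_le1// ler1n.
have ne n m : (n <= m)%N -> e m <= e n.
  by move=> nm; rewrite /e lef_pV2 ?posrE// ler_nat.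
have ecvg : e n @[n --> \oo] --> 0 by exact: cvg_harmonic.
have -> : `]a, +oo[%classic = \bigcup_n `[a + e n, a + n.+2%:R]%classic.
  apply/seteqP; split=> x /=; rewrite in_itv/=.
    rewrite andbT => ax.
    near \oo => n; exists n => //=; rewrite in_itv/=; apply/andP; split.
      rewrite addrC -lerBrDr.
      have /andP[_ /ltW//] : (0 < e n) && (e n < x - a).
      rewrite e0/=; near: n.
      move/cvgrPdist_lt : ecvg => /(_ (x - a)).
      rewrite !subr_gt0 ax => /(_ isT); apply: filterS => n.
      by rewrite sub0r normrN gtr0_norm.
    rewrite -lerBlDl (@le_trans _ _ n%:R)// ?ler_nat; last exact: leq_trans (leqnSn _) _.
    by near: n; exact: nbhs_infty_ger.
  by move=> [n _]/=; rewrite in_itv/= => /andP[h1 h2]; have := e0 n; lra.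
have h n x : a + e n <= x <= a + n.+2%:R -> a < x.
  by move=> /andP[h1 h2]; have := e0 n; lra.
apply: (@ge0_FTC2_bigcup f F).
- move=> n; rewrite ltrD2l (le_lt_trans (e1 n))// ltr1n//.
- by move=> n m /ne; lra.
- by move=> n m nm; rewrite lerD2l ler_nat !ltnS.
- by move=> n x /h; exact: dF.
- by move=> n x /h; exact: cf.
- by move=> n x /h; exact: f0.
- apply: cvgB.
  + move/cvg_pinftyP : Fy; apply.
    apply/cvgryPge => r; near=> n.
    rewrite -lerBlDl (@le_trans _ _ n%:R)// ?ler_nat; last exact: leq_trans (leqnSn _) _.
    by near: n; exact: nbhs_infty_ger.
  + move/cvg_at_rightP : Fa; apply; split.
      by move=> n; have := e0 n; lra.
    rewrite -[X in _ --> X]addr0; apply: cvgD => //; exact: cvg_cst.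
Unshelve. all: by end_near. Qed.

End FTC.

(** * The Gaussian tail *)

Section gaussian_tail.
Context {R : realType}.
Notation mu := (@lebesgue_measure R).
Implicit Types (x r t c : R).

Definition npdf x : R := (Num.sqrt (2 * pi))^-1 * expR (- x ^+ 2 / 2).

Lemma npdf_ge0 x : 0 <= npdf x.
Proof. by rewrite mulr_ge0 ?expR_ge0// invr_ge0. Qed.

Lemma npdfE : npdf = normal_pdf 0 1.
Proof.
apply/funext => x; rewrite /npdf normal_pdfE ?oner_eq0// /normal_peak /normal_fun.
by rewrite expr1n mul1r subr0 mulr_natl.
Qed.

Lemma npdfN x : npdf (- x) = npdf x.
Proof. by rewrite /npdf sqrrN. Qed.

Lemma continuous_npdf : continuous npdf.
Proof. by rewrite npdfE; apply: continuous_normal_pdf; rewrite oner_eq0. Qed.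

Definition ncdf x : R := \int[mu]_(y in `]-oo, x]) npdf y.

(** The Gaussian tail: every integral below is a closed form in it. *)
Definition ntail x : R := 1 - ncdf x.

Lemma integrable_npdf : mu.-integrable setT (EFin \o npdf).
Proof. by rewrite npdfE; exact: integrable_normal_pdf. Qed.

Lemma has_derivative_ntail x : has_derivative ntail x (- npdf x).
Proof.
have h : has_derivative ncdf x (npdf x).
  have [||//|d1 d2] := @continuous_FTC1 R npdf -oo%O x (x + 1) _ _ _ (@continuous_npdf x).
  - by rewrite ltrDl.
  - by apply: integrableS integrable_npdf.
  - by rewrite ltNyr.
  - by rewrite -d2 derive1E; exact/derivableP.
rewrite -[X in has_derivative _ _ X]add0r.
exact: has_derivativeB (has_derivative_cst _ _) h.
Qed.

Lemma has_derivative_ntail_comp (g : R -> R) x d : has_derivative g x d ->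
  has_derivative (fun y => ntail (g y)) x (- (d * npdf (g x))).
Proof. by rewrite -mulrN; exact/has_derivative_comp/has_derivative_ntail. Qed.

Lemma has_derivative_npdf x : has_derivative npdf x (- x * npdf x).
Proof.
rewrite /npdf; apply: has_derivative_val.
  by apply: has_derivativeZ; apply: has_derivative_expR;
     apply: has_derivativeM (has_derivative_cst _ _);
     apply: has_derivativeN; apply: has_derivative_sqr; exact: has_derivative_id.
by rewrite /=; set k := (Num.sqrt _)^-1; field.
Qed.

Lemma npdf_ub c x : npdf x <= expR (c ^+ 2 / 2 - c * x).
Proof.
rewrite /npdf -[leRHS]mul1r; apply: ler_pM; rewrite ?invr_ge0 ?expR_ge0//.
  rewrite invf_le1 ?sqrtr_gt0 ?mulr_gt0 ?pi_gt0//.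
  rewrite -[leLHS]sqrtr1 ler_wsqrtr//; have := @pi_ge2 R; lra.
by rewrite ler_expR; have := sqr_ge0 (x - c); nra.
Qed.

Lemma continuous_ntail : continuous ntail.
Proof. by move=> x; exact: has_derivative_continuous (has_derivative_ntail x). Qed.

End gaussian_tail.

(** Structural differentiation of a lambda term.  The derivative is produced by
    unification; what is left to the caller are the side conditions of square
    roots, inverses and powers. *)
Ltac constant_fun F :=
  let T := type of F in
  lazymatch T with ?A -> _ =>
    let r := constr:(fun y : A => ltac:(
      let t := eval cbv beta in (F y) in
      lazymatch t with context [y] => exact false | _ => exact true end)) in
    lazymatch r with (fun _ => true) => idtac end
  end.
Ltac isder_step :=
  lazymatch goal with
  | |- has_derivative (fun y => y) _ _ => exact: has_derivative_id
  | |- has_derivative ntail _ _ => exact: has_derivative_ntail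
  | |- has_derivative npdf _ _ => exact: has_derivative_npdf
  | |- has_derivative (fun _ => _) _ _ =>
    lazymatch goal with |- has_derivative ?F _ _ =>
    tryif constant_fun F then exact: has_derivative_cst else
    lazymatch F with
    | (fun y => (- (@?f y))%R) => apply: has_derivativeN
    | (fun y => (@?f y - @?g y)%R) => apply: has_derivativeB
    | (fun y => (@?f y + @?g y)%R) => apply: has_derivativeD
    | (fun y => (@?f y * @?g y)%R) =>
      tryif constant_fun f then apply: has_derivativeZ else apply: has_derivativeM
    | (fun y => (@?f y ^+ 2)%R) => apply: has_derivative_sqr
    | (fun y => Num.sqrt (@?f y)) => apply: has_derivative_sqrt
    | (fun y => ((@?f y)^-1)%R) => apply: has_derivativeV
    | (fun y => ((@?f y) `^ _)%R) => apply: has_derivative_powR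
    | (fun y => npdf (@?f y)) => apply: (has_derivative_comp (has_derivative_npdf _))
    | (fun y => expR (@?f y)) => apply: has_derivative_expR
    | (fun y => ntail (@?f y)) => apply: has_derivative_ntail_comp
    | _ => eassumption
    end end
  | |- has_derivative ?F ?x ?d => first [ eassumption |
      let T := type of F in
      lazymatch T with ?A -> _ => change (has_derivative (fun y : A => F y) x d) end;
      isder_step ]
  end.
Ltac isder := repeat isder_step.

Section gaussian_tail_limits.
Context {R : realType}.
Notation mu := (@lebesgue_measure R).
Implicit Types (x r t c : R).
Local Notation npdf := (@npdf R).
Local Notation ntail := (@ntail R).
Local Notation ncdf := (@ncdf R).

Let stdnormal : probability (measurableTypeR R) R := normal_prob 0 1.
Let idR : measurableTypeR R -> R := idfun.
HB.instance Definition _ :=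
  @isMeasurableFun.Build _ _ _ _ idR (@measurable_id _ _ setT).

Let ncdf_cdf x : (ncdf x)%:E = cdf (idR : {RV stdnormal >-> R}) x.
Proof.
rewrite /cdf /distribution /pushforward/= /normal_prob /ncdf /Rintegral.
rewrite fineK; last first.
  apply: integrable_fin_num => //; exact: integrableS integrable_npdf.
by rewrite npdfE.
Qed.

Lemma ntail_cvgy : ntail x @[x --> +oo] --> (0 : R).
Proof.
rewrite -[X in _ --> X](subrr 1); apply: cvgB; first exact: cvg_cst.
apply: (@fine_cvg _ _ _ _ (fun x => (ncdf x)%:E)).
by under eq_fun do rewrite ncdf_cdf; exact: cvg_cdfy1.
Qed.

Lemma ntail_cvgNy : ntail x @[x --> -oo] --> (1 : R).
Proof.
rewrite -[X in _ --> X](subr0 1); apply: cvgB; first exact: cvg_cst.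
apply: (@fine_cvg _ _ _ _ (fun x => (ncdf x)%:E)).
by under eq_fun do rewrite ncdf_cdf; exact: cvg_cdfNy0.
Qed.

Lemma ntailN x : ntail (- x) = 1 - ntail x.
Proof.
pose D x := ntail x + ntail (- x).
have dD (y : R) : has_derivative D y 0.
  rewrite /D; apply: has_derivative_val; first isder.
  by rewrite npdfN mulN1r opprK addNr.
have Dc y z : D y = D z.
  by apply: is_derive_0_is_cst => u; exact: dD.
have h : D y @[y --> +oo] --> (0 + 1 : R).
  apply: cvgD; first exact: ntail_cvgy.
  apply: (@cvg_comp _ _ _ (fun y : R => - y) ntail _ -oo); last exact: ntail_cvgNy.
  by apply/cvgNrNy.
have DE : D = cst (D x) by apply/funext => y; exact: Dc.
have : D x = 0 + 1 by rewrite DE in h; apply: (cvg_unique _ (cvg_cst _) h).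
by rewrite /D add0r => <-; rewrite addrC addKr.
Qed.

Lemma ntail0 : ntail 0 = 2^-1.
Proof. by have := ntailN 0; rewrite oppr0 => /eqP h; lra. Qed.

Lemma ntail_ge0 x : 0 <= ntail x.
Proof.
rewrite /ntail subr_ge0 -lee_fin ncdf_cdf; exact: cdf_le1.
Qed.

(** Completing the square. *)
Lemma npdfB x c : expR (c * x - c ^+ 2 / 2) * npdf x = npdf (x - c).
Proof.
rewrite /npdf mulrCA -expRD; congr (_ * expR _); by field.
Qed.

(** Chernoff's bound: the difference of the two sides is nonincreasing and
    tends to zero.  The restriction on [c] makes its derivative nonpositive;
    large [c] is the only case of use, to beat exponential growth. *)
Lemma ntail_ub c x : 1 <= c -> ntail x <= expR (c ^+ 2 / 2 - c * x).
Proof.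
move=> c1.
have c0 : 0 < c by exact: lt_le_trans ltr01 c1.
pose D y := expR (c ^+ 2 / 2 - c * y) - ntail y.
have dD (y : R) : has_derivative D y (npdf y - c * expR (c ^+ 2 / 2 - c * y)).
  rewrite /D; apply: has_derivative_val; first isder.
  by ring.
have D'le0 y : npdf y - c * expR (c ^+ 2 / 2 - c * y) <= 0.
  by rewrite subr_le0 (le_trans (npdf_ub c y))// ler_peMl ?expR_ge0.
have Dni y : x <= y -> D y <= D x.
  move=> xy; apply: (@ler0_derive1_nincry _ D x _ _ _ x y (lexx x) xy).
  - by move=> z _; exact: has_derivative_derivable (dD z).
  - by move=> z _; rewrite (has_derivative_derive1 (dD z)).
  - apply: continuous_subspaceT => z; exact: has_derivative_continuous (dD z).
have Dlim : D y @[y --> +oo] --> (0 : R).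
  rewrite -[X in _ --> X](subrr 0); apply: cvgB; last exact: ntail_cvgy.
  apply: (@cvg_comp _ _ _ (fun y : R => c ^+ 2 / 2 - c * y) expR _ -oo).
    apply/cvgrNyPle => A; near=> y.
    have : c^-1 * (c ^+ 2 / 2 - A) <= y.
      by near: y; apply: nbhs_pinfty_ge; rewrite num_real.
    by rewrite ler_pdivrMl// => h; lra.
  by apply/cvgNy_compNP; exact: cvgr_expR.
suff : 0 <= D x by rewrite subr_ge0.
move/cvg_lim : (Dlim) => <- //; apply: limr_le; first by apply/cvg_ex; exists 0.
near=> y; apply: Dni; near: y; apply: nbhs_pinfty_ge; rewrite num_real.
Unshelve. all: by end_near. Qed.

Lemma ntail_cvgy_comp T (F : set_system T) {FF : Filter F} (g : T -> R) :
  g z @[z --> F] --> +oo -> ntail (g z) @[z --> F] --> (0 : R).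
Proof. by move=> h; exact: cvg_comp h ntail_cvgy. Qed.

Lemma ntail_cvgNy_comp T (F : set_system T) {FF : Filter F} (g : T -> R) :
  g z @[z --> F] --> -oo -> ntail (g z) @[z --> F] --> (1 : R).
Proof. by move=> h; exact: cvg_comp h ntail_cvgNy. Qed.

Lemma ntail_cvg_comp T (F : set_system T) {FF : Filter F} (g : T -> R) (l : R) :
  g z @[z --> F] --> l -> ntail (g z) @[z --> F] --> ntail l.
Proof. by move=> h; apply: continuous_cvg => //; exact: continuous_ntail. Qed.

End gaussian_tail_limits.

(** * The heat kernel on the half-line *)

Section heat_kernel.
Context {R : realType}.
Notation mu := (@lebesgue_measure R).
Implicit Types (a r t c g : R).

(** The density at [r > 0] of [|B_t|] for a standard Brownian motion [B]. *)
Definition heat t r : R := 2 / Num.sqrt t * npdf (r / Num.sqrt t).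

Lemma heat_ge0 t r : 0 <= heat t r.
Proof. by rewrite mulr_ge0 ?npdf_ge0 ?divr_ge0. Qed.

Lemma continuous_heat t : continuous (heat t).
Proof.
move=> r; have h : has_derivative (heat t) r (2 / Num.sqrt t * ((Num.sqrt t)^-1 * (- (r / Num.sqrt t) * npdf (r / Num.sqrt t)))).
  rewrite /heat; apply: has_derivativeZ.
  apply: (@has_derivative_comp _ npdf) (has_derivative_npdf _) _.
  apply: has_derivative_val; first isder.
  by rewrite mul1r mulr0 addr0.
exact: has_derivative_continuous h.
Qed.

Lemma cvgry_affine (F : set_system R) {FF : Filter F} (f : R -> R) c k : 0 < k ->
  f r @[r --> F] --> +oo -> k * f r + c @[r --> F] --> +oo.
Proof.
move=> k0 fy; apply/cvgryPge => A; move/cvgryPge : fy => /(_ (k^-1 * (A - c))).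
by apply: filterS => r; rewrite ler_pdivrMl// lerBlDr.
Qed.

Lemma cvgryZ (F : set_system R) {FF : Filter F} (f : R -> R) k : 0 < k ->
  f r @[r --> F] --> +oo -> k * f r @[r --> F] --> +oo.
Proof.
move=> k0 fy; have := @cvgry_affine F FF f 0 k k0 fy.
by under eq_fun do rewrite addr0.
Qed.

Lemma cvgyD_lb (F : set_system R) {FF : Filter F} (f h : R -> R) B :
  f r @[r --> F] --> +oo -> (\forall r \near F, B <= h r) -> f r + h r @[r --> F] --> +oo.
Proof.
move=> fy hB; apply/cvgryPge => A; move/cvgryPge : fy => /(_ (A - B)) fy.
by apply: filterS2 fy hB => r; lra.
Qed.

(** Completing the square in the heat kernel: exponential moments of the tail
    of [|B_t|]. *)
Lemma integral_expR_heat c t a : 0 < t ->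
  (\int[mu]_(r in `]a, +oo[) (expR (c * r) * heat t r)%:E =
   (2 * expR (c ^+ 2 * t / 2) * ntail (a / Num.sqrt t - c * Num.sqrt t))%:E)%E.
Proof.
move=> t0; have s0 : 0 < Num.sqrt t by rewrite sqrtr_gt0.
have sE : Num.sqrt t ^+ 2 = t by rewrite sqr_sqrtr ?ltW.
set s := Num.sqrt t in s0 sE *.
pose F r := - (2 * expR (c ^+ 2 * t / 2)) * ntail (r / s - c * s).
have dF r : has_derivative F r (expR (c * r) * heat t r).
  rewrite /F; apply: has_derivative_val; first isder.
  rewrite -npdfB /heat -/s -sE.
  have -> : c * r = c ^+ 2 * s ^+ 2 / 2 + (c * s * (r / s) - (c * s) ^+ 2 / 2).
    by field; rewrite gt_eqF.
  rewrite [X in _ = X * _]expRD; move: (expR _) (expR _) (npdf _) => e e' n.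
  by field; rewrite gt_eqF.
have -> : 2 * expR (c ^+ 2 * t / 2) * ntail (a / s - c * s) = 0 - F a.
  by rewrite /F; ring.
apply: (@ge0_FTC2_oy _ _ F).
- by move=> r _; exact: dF.
- move=> r _; apply: cvgM; last exact: continuous_heat.
  apply: (@has_derivative_continuous _ (fun r => expR (c * r))); isder.
- by move=> r _; rewrite mulr_ge0 ?expR_ge0 ?heat_ge0.
- apply: cvg_at_right_filter; exact: has_derivative_continuous (dF a).
- rewrite -[X in _ --> X](mulr0 (- (2 * expR (c ^+ 2 * t / 2)))).
  apply: cvgMr; apply: ntail_cvgy_comp.
  under eq_fun do rewrite mulrC; apply: cvgry_affine; first by rewrite invr_gt0.
  exact: cvg_id.
Qed.

End heat_kernel.

(** * The inverse Gaussian distribution *)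

Section sqrt_limits.
Context {R : realType}.
Implicit Types t : R.

Lemma cvgy_inv_at0 : t^-1 @[t --> (0:R)^'+] --> +oo.
Proof.
apply/cvgryPge => A; near=> t.
have t0 : 0 < t by near: t; exact: nbhs_right_gt.
have A1 : 0 < `|A| + 1 by rewrite ltr_wpDl.
have : t <= (`|A| + 1)^-1 by near: t; apply: nbhs_right_le; rewrite invr_gt0.
move=> tA; rewrite (@le_trans _ _ (`|A| + 1))//.
  by rewrite (le_trans (ler_norm A))// lerDl.
by rewrite -[leLHS]invrK lef_pV2 ?posrE ?invr_gt0.
Unshelve. all: by end_near. Qed.

Lemma cvgy_sqrt : Num.sqrt t @[t --> +oo] --> (+oo : set_system R).
Proof.
apply/cvgryPge => A; near=> t.
apply: (le_trans (ler_norm A)); rewrite -sqrtr_sqr; apply: ler_wsqrtr.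
by near: t; apply: nbhs_pinfty_ge; rewrite num_real.
Unshelve. all: by end_near. Qed.

Lemma cvgy_inv_sqrt_at0 : (Num.sqrt t)^-1 @[t --> (0:R)^'+] --> +oo.
Proof.
have : Num.sqrt t^-1 @[t --> (0:R)^'+] --> +oo by exact: cvg_comp cvgy_inv_at0 cvgy_sqrt.
apply: cvg_trans; apply: near_eq_cvg; near=> t => /=.
by rewrite sqrtrV// ltW//; near: t; exact: nbhs_right_gt.
Unshelve. all: by end_near. Qed.

Lemma cvg_sqrt_at0 : Num.sqrt t @[t --> (0:R)^'+] --> (0 : R).
Proof.
rewrite -[X in _ --> X]sqrtr0; apply: cvg_at_right_filter; exact: sqrt_continuous.
Qed.

End sqrt_limits.

Section inverse_gaussian.
Context {R : realType}.
Notation mu := (@lebesgue_measure R).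
Variables (a : R).
Hypothesis a0 : 0 < a.
Implicit Types (r t g : R).

(** Distribution function and density of the first passage time over [a] of a
    Brownian motion with drift [g]. *)
Definition IGcdf g t : R :=
  ntail (a / Num.sqrt t - g * Num.sqrt t) +
  expR (2 * g * a) * ntail (a / Num.sqrt t + g * Num.sqrt t).

Definition IGpdf g t : R :=
  a / (t * Num.sqrt t) * npdf (a / Num.sqrt t - g * Num.sqrt t).

Lemma IGpdf_ge0 g t : 0 <= t -> 0 <= IGpdf g t.
Proof. by move=> t0; rewrite mulr_ge0 ?npdf_ge0 ?divr_ge0 ?mulr_ge0 ?(ltW a0). Qed.

(** The two Gaussian terms of the derivative combine because the exponential
    weight turns one of the two densities into the other, by [npdfB]. *)
Lemma has_derivative_IGcdf g t : 0 < t -> has_derivative (IGcdf g) t (IGpdf g t).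
Proof.
move=> t0; have s0 : 0 < Num.sqrt t by rewrite sqrtr_gt0.
have sn0 : Num.sqrt t != 0 by rewrite gt_eqF.
have sE : Num.sqrt t ^+ 2 = t by rewrite sqr_sqrtr ?ltW.
rewrite /IGcdf; apply: has_derivative_val; first by isder.
rewrite /IGpdf; set s := Num.sqrt t in s0 sE sn0 *.
have -> : a / (t * s) = a / s ^+ 3 by rewrite -sE -exprSr.
have -> : npdf (a / s - g * s) = expR (2 * g * a) * npdf (a / s + g * s).
  have := npdfB (a / s + g * s) (2 * g * s) => /esym.
  have -> : a / s + g * s - 2 * g * s = a / s - g * s by ring.
  move=> ->; congr (expR _ * _); by field.
by set e := expR _; set n := npdf _; field.
Qed.

Lemma continuous_IGpdf g t : 0 < t -> {for t, continuous (IGpdf g)}.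
Proof.
move=> t0; have s0 : 0 < Num.sqrt t by rewrite sqrtr_gt0.
have sn0 : Num.sqrt t != 0 by rewrite gt_eqF.
have h : exists d, has_derivative (IGpdf g) t d.
  eexists; rewrite /IGpdf; apply: has_derivativeM.
    by isder; rewrite ?mulf_neq0 ?gt_eqF.
  apply: (@has_derivative_comp _ npdf) (has_derivative_npdf _) _.
  by isder.
by case: h => d; exact: has_derivative_continuous.
Qed.

Lemma measurable_IGpdf g : measurable_fun `](0:R), +oo[ (IGpdf g).
Proof.
apply: open_continuous_measurable_fun; first exact: interval_open.
by move=> y; rewrite inE/= in_itv/= andbT; exact: continuous_IGpdf.
Qed.

Lemma IGcdf_cvg0 g : IGcdf g t @[t --> 0^'+] --> (0 : R).
Proof.
have h (k : R) : ntail (a / Num.sqrt t + k * Num.sqrt t) @[t --> 0^'+] --> (0 : R).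
  apply: ntail_cvgy_comp; apply: (@cvgyD_lb _ _ _ _ _ (-1)).
    exact: cvgryZ a0 cvgy_inv_sqrt_at0.
  have : k * Num.sqrt t @[t --> 0^'+] --> (0 : R).
    by rewrite -[X in _ --> X](mulr0 k); apply: cvgMr; exact: cvg_sqrt_at0.
  by move=> h; apply: (cvgr_ge _ h); rewrite ltrN10.
rewrite -[X in _ --> X](addr0 0); apply: cvgD.
  by have := h (- g); under eq_fun do rewrite mulNr.
by rewrite -[X in _ --> X](mulr0 (expR (2 * g * a))); apply: cvgMr; exact: h.
Qed.

Lemma IGcdf_cvgy g : 0 < g -> IGcdf g t @[t --> +oo] --> (1 : R).
Proof.
move=> g0; rewrite -[X in _ --> X](addr0 1); apply: cvgD.
  apply: ntail_cvgNy_comp.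
  have : g * Num.sqrt t - a / Num.sqrt t @[t --> +oo] --> +oo.
    apply: (@cvgyD_lb _ _ _ _ _ (- a)); first exact: cvgryZ g0 cvgy_sqrt.
    near=> t; rewrite lerN2 ler_piMr ?(ltW a0)// invf_le1.
      rewrite -[leLHS]sqrtr1; apply: ler_wsqrtr.
      by near: t; apply: nbhs_pinfty_ge; rewrite num_real.
    by rewrite sqrtr_gt0; near: t; apply: nbhs_pinfty_gt; rewrite num_real.
  move/cvgNrNy; apply: cvg_trans; apply: near_eq_cvg; near=> t.
  by rewrite /= opprB.
rewrite -[X in _ --> X](mulr0 (expR (2 * g * a))); apply: cvgMr.
apply: ntail_cvgy_comp.
under eq_fun do rewrite addrC.
apply: (@cvgyD_lb _ _ _ _ _ 0).
  exact: cvgryZ g0 cvgy_sqrt.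
by near=> t; rewrite divr_ge0 ?(ltW a0).
Unshelve. all: by end_near. Qed.

Lemma integral_IGpdf g t : 0 < t ->
  (\int[mu]_(y in `]0%R, t[) (IGpdf g y)%:E = (IGcdf g t)%:E)%E.
Proof.
move=> t0; rewrite -[X in X%:E]subr0; apply: (@ge0_FTC2_oo _ _ (IGcdf g)) => //.
- by move=> y /andP[y0 _]; exact: has_derivative_IGcdf.
- by move=> y /andP[y0 _]; exact: continuous_IGpdf.
- by move=> y /andP[y0 _]; exact/IGpdf_ge0/ltW.
- exact: IGcdf_cvg0.
- apply: cvg_at_left_filter; exact: has_derivative_continuous (has_derivative_IGcdf g t0).
Qed.

Lemma integral_IGpdfy g : 0 < g ->
  (\int[mu]_(y in `]0%R, +oo[) (IGpdf g y)%:E = 1)%E.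
Proof.
move=> g0; rewrite -[X in X%:E](subr0 1); apply: (@ge0_FTC2_oy _ _ (IGcdf g)).
- by move=> y y0; exact: has_derivative_IGcdf.
- by move=> y y0; exact: continuous_IGpdf.
- by move=> y y0; exact/IGpdf_ge0/ltW.
- exact: IGcdf_cvg0.
- exact: IGcdf_cvgy.
Qed.

(** Multiplying the density by [exp (- s y)] only changes the drift, up to a
    constant. *)
Lemma IGpdf_tilt g s t : 0 < t -> 0 <= g -> 0 <= s ->
  expR (- s * t) * IGpdf g t =
  expR (- a * (Num.sqrt (2 * s + g ^+ 2) - g)) * IGpdf (Num.sqrt (2 * s + g ^+ 2)) t.
Proof.
move=> t0 g0 s0; rewrite /IGpdf /npdf.
set h := Num.sqrt (2 * s + g ^+ 2).
have hE : h ^+ 2 = 2 * s + g ^+ 2 by rewrite sqr_sqrtr ?addr_ge0 ?sqr_ge0 ?mulr_ge0.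
have u0 : 0 < Num.sqrt t by rewrite sqrtr_gt0.
have uE : Num.sqrt t ^+ 2 = t by rewrite sqr_sqrtr ?ltW.
set u := Num.sqrt t in u0 uE *.
have e (x y k l : R) : expR x * (k * (l * expR y)) = k * l * expR (x + y).
  by rewrite expRD; ring.
rewrite !e; congr (_ * expR _).
have -> : s = (h ^+ 2 - g ^+ 2) / 2 by rewrite hE; field.
rewrite -uE; field; rewrite gt_eqF//.
Qed.

(** The tilted density is, up to its constant, again an inverse Gaussian
    density, hence of total mass one. *)
Lemma IG_laplace g s : 0 < g -> 0 <= s ->
  (\int[mu]_(y in `]0%R, +oo[) (expR (- s * y) * IGpdf g y)%:E =
   (expR (- a * (Num.sqrt (2 * s + g ^+ 2) - g)))%:E)%E.
Proof.
move=> g0 s0.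
have h0 : 0 < Num.sqrt (2 * s + g ^+ 2).
  by rewrite sqrtr_gt0 ltr_wpDl ?exprn_gt0 ?mulr_ge0.
under eq_integral => y.
  rewrite inE/= in_itv/= andbT => y0.
  rewrite (IGpdf_tilt y0 (ltW g0) s0) EFinM.
  over.
rewrite ge0_integralZl//=; first by rewrite integral_IGpdfy// mule1.
- apply/measurable_EFinP. have := measurable_IGpdf (Num.sqrt (2 * s + g ^+ 2)). exact.
- by move=> y; rewrite in_itv/= andbT lee_fin => y0; exact/IGpdf_ge0/ltW.
Qed.

End inverse_gaussian.

(** * Integration by layers *)

Section layer_cake.
Context {R : realType} {d : measure_display} {T : measurableType d}.
Variable P : {sigma_finite_measure set T -> \bar R}.
Notation mu := (@lebesgue_measure R).
Implicit Types (x r t : R).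

Variables (w Z : T -> R) (G g h : R -> R).
Hypotheses (mw : measurable_fun setT w) (w0 : forall z, 0 <= w z).
Hypotheses (mZ : measurable_fun setT Z) (Z0 : forall z, 0 <= Z z).
Hypotheses (cg : continuous g) (cG : {for 0, continuous G}).
Hypothesis dG : forall x, 0 < x -> has_derivative G x (g x).
Hypothesis hE : forall x, 0 < x ->
  (\int[P]_z (if x < Z z then w z else 0)%:E = (h x)%:E)%E.
Hypothesis igh : mu.-integrable `]0%R, +oo[ (fun x => (g x * h x)%:E).

(* Integrated first in [z] this gives [g * h]; integrated first in [x] it gives
   [w * (G (Z z) - G 0)].  Both conclusions are Fubini's theorem for it. *)
Let f (p : T * measurableTypeR R) : R :=
  if (0 < p.2) && (p.2 < Z p.1) then w p.1 * g p.2 else 0.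

Let mf : measurable_fun setT f.
Proof.
apply: measurable_fun_ifT.
- apply: measurable_and.
    apply: measurable_fun_ltr => //.
  apply: measurable_fun_ltr => //.
  exact: measurableT_comp.
- apply: measurable_funM; first exact: measurableT_comp.
  apply: measurableT_comp => //.
  exact: continuous_measurable_fun.
- exact: measurable_cst.
Qed.

Let h0 x : 0 < x -> 0 <= h x.
Proof.
move=> x0; rewrite -lee_fin -hE//; apply: integral_ge0 => z _.
by rewrite lee_fin; case: ifP.
Qed.

Let inner_w x k : 0 < x ->
  (\int[P]_z (if x < Z z then w z * k else 0)%:E = (k * h x)%:E)%E.
Proof.
move=> x0.
have mi : measurable_fun setT (fun z => (if x < Z z then w z else 0)%:E).
  apply/measurable_EFinP; apply: measurable_fun_ifT => //.
  exact: measurable_fun_ltr.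
have i0 : P.-integrable setT (fun z => (if x < Z z then w z else 0)%:E).
  apply/integrableP; split => //.
  rewrite (eq_integral (fun z => (if x < Z z then w z else 0)%:E)).
    by rewrite hE// ltry.
  by move=> z _; rewrite gee0_abs// lee_fin; case: ifP.
rewrite EFinM -hE// -integralZl//.
by apply: eq_integral => z _; case: ifP; rewrite ?EFinM ?mulr0 ?mule0// muleC.
Qed.

Let integrable_f : (P \x mu)%E.-integrable setT (EFin \o f).
Proof.
apply/integrable21ltyP; first exact/measurable_EFinP.
have -> : (\int[mu]_x \int[P]_z `|(EFin \o f) (z, x)| =
           \int[mu]_(x in `]0%R, +oo[) `|(g x * h x)%:E|)%E.
  rewrite [RHS]integral_mkcond; apply: eq_integral => x _.
  rewrite patchE; case: ifPn => [|x0].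
    rewrite inE/= in_itv/= andbT => x0.
    rewrite normrM (ger0_norm (h0 x0)) -inner_w//.
    apply: eq_integral => z _; rewrite /f/= x0/=; case: ifP => _; last by rewrite normr0.
    by rewrite normrM (ger0_norm (w0 z)).
  rewrite integral0_eq// => z _; rewrite /f/=; case: ifPn => [/andP[x1 _]|_]; last by rewrite normr0.
  by move: x0; rewrite notin_setE/= in_itv/= x1.
by move/integrableP: igh => [].
Qed.

Let innerF z : (\int[mu]_x (f (z, x))%:E = (w z * (G (Z z) - G 0))%:E)%E.
Proof.
have [Zz|Zz] := leP (Z z) 0.
  have -> : Z z = 0 by apply/eqP; rewrite eq_le Zz Z0.
  rewrite subrr mulr0 (eq_integral (cst 0%E)) ?integral0// => x _.
  rewrite /f/=; case: ifPn => // /andP[x0 xZ].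
  by have := lt_le_trans (lt_trans x0 xZ) Zz; rewrite ltxx.
have -> : (\int[mu]_x (f (z, x))%:E = \int[mu]_(x in `]0%R, Z z[) (w z * g x)%:E)%E.
  rewrite [RHS]integral_mkcond; apply: eq_integral => x _.
  by rewrite patchE mem_setE in_itv/= /f/=; case: ifP.
rewrite -(@integral_itv_bndoo _ _ _ _ true false); last first.
  apply/measurable_EFinP; apply: measurable_funM => //.
  by apply: measurable_funTS; exact: continuous_measurable_fun.
rewrite (@FTC2_segment _ _ (fun x => w z * G x))//.
- by rewrite mulrBr.
- by move=> x _; apply: cvgM; [exact: cvg_cst|exact: cg].
- by move=> x /andP[x0 _]; apply: has_derivativeZ; exact: dG.
- by apply: cvgM; [exact: cvg_cst|exact: cG].
- by apply: cvgM; [exact: cvg_cst|exact: has_derivative_continuous (dG Zz)].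
Qed.

(** The layer cake formula: [h x] is the [w]-mass of the set where [Z] exceeds
    [x], and an increment of [G] is the integral of [g] over the layers below. *)
Lemma integrable_layer_cake :
  P.-integrable setT (fun z => (w z * (G (Z z) - G 0))%:E).
Proof.
have := integrable_fubini_F integrable_f.
apply: eq_integrable => // z _; rewrite /fubini_F/=; exact: innerF.
Qed.

Lemma layer_cake :
  (\int[P]_z (w z * (G (Z z) - G 0))%:E =
   \int[mu]_(x in `]0%R, +oo[) (g x * h x)%:E)%E.
Proof.
have := Fubini integrable_f; under eq_integral do rewrite /=.
under eq_integral do rewrite innerF.
move=> ->; rewrite [RHS]integral_mkcond; apply: eq_integral => x _.
rewrite patchE; case: ifPn => [|x0].
  rewrite inE/= in_itv/= andbT => x0; rewrite -inner_w//.
  by apply: eq_integral => z _; rewrite /f/= x0.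
rewrite integral0_eq// => z _; rewrite /f/=; case: ifPn => [/andP[x1 _]|//].
by move: x0; rewrite notin_setE/= in_itv/= x1.
Qed.

End layer_cake.

Section lebesgue_layer_cake.
Context {R : realType}.
Notation mu := (@lebesgue_measure R).

(** The case where the measure has a density on the half-line and [Z] is a
    dilation. *)
Lemma lebesgue_layer_cake (k : R) (w G g h : R -> R) : 0 < k ->
  measurable_fun setT w -> (forall r, 0 <= w r) ->
  continuous g -> {for 0, continuous G} ->
  (forall x, 0 < x -> has_derivative G x (g x)) ->
  (forall x, 0 < x -> (\int[mu]_(r in `](x / k)%R, +oo[) (w r)%:E = (h x)%:E)%E) ->
  mu.-integrable `]0%R, +oo[ (fun x => (g x * h x)%:E) ->
  mu.-integrable `]0%R, +oo[ (fun r => (w r * (G (k * r) - G 0))%:E) /\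
  (\int[mu]_(r in `]0%R, +oo[) (w r * (G (k * r) - G 0))%:E =
   \int[mu]_(x in `]0%R, +oo[) (g x * h x)%:E)%E.
Proof.
move=> k0 mw w0 cg cG dG hE igh.
pose w' r := if 0 < r then w r else 0.
pose Z r := Num.max (k * r) 0.
have mw' : measurable_fun setT (w' : measurableTypeR R -> R).
  by apply: measurable_fun_ifT => //; apply: measurable_fun_ltr => //.
have w'0 r : 0 <= w' r by rewrite /w'; case: ifP.
have mZ : measurable_fun setT (Z : measurableTypeR R -> R).
  by apply: measurable_maxr => //; apply: measurable_funM.
have Z0 r : 0 <= Z r by rewrite le_max lexx orbT.
have hE' x : 0 < x -> (\int[mu]_z (if x < Z z then w' z else 0)%:E = (h x)%:E)%E.
  move=> x0; rewrite -hE// [RHS]integral_mkcond; apply: eq_integral => r _.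
  rewrite patchE mem_setE in_itv/= andbT /Z lt_max [x < 0]ltNge (ltW x0) orbF.
  rewrite ltr_pdivrMr// mulrC /w'; case: ifP => // xr.
  by rewrite -(pmulr_lgt0 _ k0) (lt_trans x0 xr).
have I1 := @integrable_layer_cake R _ (measurableTypeR R) mu w' Z G g h
  mw' w'0 mZ Z0 cg cG dG hE' igh.
have I2 := @layer_cake R _ (measurableTypeR R) mu w' Z G g h
  mw' w'0 mZ Z0 cg cG dG hE' igh.
have ZE r : 0 < r -> w' r * (G (Z r) - G 0) = w r * (G (k * r) - G 0).
  by move=> r0; rewrite /w' r0 /Z max_l// mulr_ge0 ?ltW.
split.
  have : mu.-integrable `]0%R, +oo[ (fun r => (w' r * (G (Z r) - G 0))%:E).
    by apply: integrableS I1.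
  by apply: eq_integrable => // r; rewrite mem_setE in_itv/= andbT => r0; rewrite ZE.
rewrite -I2 [LHS]integral_mkcond; apply: eq_integral => r _.
rewrite patchE mem_setE in_itv/= andbT; case: ifPn => r0; first by rewrite ZE.
by rewrite /w' (negbTE r0) mul0r.
Qed.

End lebesgue_layer_cake.

(** * Abel inversion of first passage densities *)

Section exponential_bounds.
Context {R : realType}.
Notation mu := (@lebesgue_measure R).
Implicit Types (x r t : R).

Lemma ge0_integrable_fin d (T : measurableType d) (m : {measure set T -> \bar R})
    (D : set T) (f : T -> R) c : measurable D -> measurable_fun D f ->
  (forall z, D z -> 0 <= f z) -> (\int[m]_(z in D) (f z)%:E = c%:E)%E ->
  m.-integrable D (fun z => (f z)%:E).
Proof.
move=> mD mf f0 fc; apply/integrableP; split; first exact/measurable_EFinP.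
rewrite (eq_integral (fun z => (f z)%:E)); first by rewrite fc ltry.
by move=> z; rewrite inE => /f0 fx; rewrite gee0_abs// lee_fin.
Qed.

Lemma integrable_expRN : mu.-integrable `]0%R, +oo[ (fun x => (expR (- x))%:E).
Proof.
have ce (x : R) : has_derivative (fun x => - expR (- x)) x (expR (- x)).
  by apply: has_derivative_val; [isder | rewrite /=; ring].
have cee (x : R) : has_derivative (fun x => expR (- x)) x (- expR (- x)).
  by apply: has_derivative_val; [isder | rewrite /=; ring].
apply/integrableP; split.
  apply/measurable_EFinP; apply: measurable_funTS; apply: continuous_measurable_fun.
  by move=> x; exact: has_derivative_continuous (cee x).
under eq_integral => x _ do rewrite gee0_abs ?lee_fin ?expR_ge0//.
rewrite (@ge0_FTC2_oy _ _ (fun x => - expR (- x)) _ (-1) 0) ?ltry//.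
- by move=> x _; exact: has_derivative_continuous (cee x).
- have := has_derivative_continuous (ce 0).
  by rewrite /prop_for /continuous_at oppr0 expR0 => /cvg_at_right_filter.
- by rewrite -[X in _ --> X]oppr0; apply: cvgN; exact: cvgr_expR.
Qed.

Lemma integrable_expR_bound (f : R -> R) K : measurable_fun `](0 : R), +oo[ f ->
  (forall x, 0 < x -> `|f x| <= K * expR (- x)) ->
  mu.-integrable `]0%R, +oo[ (EFin \o f).
Proof.
move=> mf fK.
have mI : measurable (`]0%R, +oo[%classic : set (measurableTypeR R)) by [].
have i1 := integrableZl mI K integrable_expRN.
apply: (le_integrable mI _ _ i1); first exact/measurable_EFinP.
move=> x; rewrite /= in_itv/= andbT => x0; rewrite lee_fin.
by rewrite (le_trans (fK _ x0))// ler_norm.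
Qed.

End exponential_bounds.

Section half_derivative.
Context {R : realType}.
Notation mu := (@lebesgue_measure R).
Implicit Types (x r t s : R).

(** The time derivative of [2 * ntail (r / sqrt s)], the mass that [heat s]
    puts beyond [r]; as a function of [s], the density of the first passage
    time over [r] of a Brownian motion.  The power [-1/2] instead of a square
    root in a denominator makes it jointly measurable by composition. *)
Definition passage s r : R :=
  r * ((s `^ (- 2^-1)) ^+ 2 * s `^ (- 2^-1)) * npdf (r * s `^ (- 2^-1)).

Lemma powRN12 s : 0 < s -> s `^ (- 2^-1) = (Num.sqrt s)^-1.
Proof. by move=> s0; rewrite powRN powR12_sqrt// ltW. Qed.

Lemma has_derivative_ntail_passage s r : 0 < s ->
  has_derivative (fun s => 2 * ntail (r / Num.sqrt s)) s (passage s r).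
Proof.
move=> s0; have u0 : Num.sqrt s != 0 by rewrite gt_eqF// sqrtr_gt0.
apply: has_derivative_val; first by isder.
rewrite /passage powRN12//; move: (npdf _) => e; by field.
Qed.

Lemma passage_ge0 s r : 0 <= r -> 0 <= passage s r.
Proof. by move=> r0; rewrite !mulr_ge0 ?npdf_ge0 ?sqr_ge0 ?powR_ge0. Qed.

Lemma measurable_passage d (T : measurableType d) (f g : T -> R) :
  measurable_fun setT f -> measurable_fun setT g ->
  measurable_fun setT (fun z => passage (f z) (g z)).
Proof.
move=> mf mg.
have mp : measurable_fun setT (fun z => f z `^ (- 2^-1)).
  by apply: (measurableT_comp (measurable_powR _)).
apply: measurable_funM.
  by apply: measurable_funM => //; apply: measurable_funM => //; apply: measurable_funX.
apply: measurableT_comp; last exact: measurable_funM.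
apply: continuous_measurable_fun; exact: continuous_npdf.
Qed.

(** Abel's equation for the first passage densities, solved by the explicit
    primitive in [ntail (r * sqrt (1 / s - 1 / t))]. *)
Lemma integral_abel_passage t r : 0 < t -> 0 < r ->
  (\int[mu]_(s in `]0%R, t[) ((t - s) `^ (- 2^-1) * passage s r)%:E =
   (Num.sqrt (pi / 2) * heat t r)%:E)%E.
Proof.
move=> t0 r0.
have v0 : 0 < Num.sqrt t by rewrite sqrtr_gt0.
have vE : Num.sqrt t ^+ 2 = t by rewrite sqr_sqrtr ?ltW.
pose c := 2 * expR (- r ^+ 2 / (2 * t)) / Num.sqrt t.
pose W s := c * ntail (r * Num.sqrt (s^-1 - t^-1)).
have q0 s : 0 < s < t -> 0 < s^-1 - t^-1.
  by move=> /andP[s0 st]; rewrite subr_gt0 ltf_pV2.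
have dW s : 0 < s < t -> has_derivative W s ((t - s) `^ (- 2^-1) * passage s r).
  move=> /[dup] st /andP[s0 st'].
  have sn0 : s != 0 by rewrite gt_eqF.
  rewrite /W; apply: has_derivative_val; first by isder; solve [exact: sn0 | exact: q0].
  rewrite /passage !powRN12 ?subr_gt0//.
  set q := Num.sqrt (s^-1 - t^-1).
  have q0' : 0 < q by rewrite sqrtr_gt0 q0.
  have u0 : 0 < Num.sqrt s by rewrite sqrtr_gt0.
  have uE : Num.sqrt s ^+ 2 = s by rewrite sqr_sqrtr ?ltW.
  have qE : q ^+ 2 = s^-1 - t^-1 by rewrite sqr_sqrtr// ltW// q0.
  have y0 : 0 < Num.sqrt (t - s) by rewrite sqrtr_gt0 subr_gt0.
  (* Every square root is expressed through [q], [sqrt s] and [sqrt t], so that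
     the identity becomes one between rational functions. *)
  have yE : Num.sqrt (t - s) = q * Num.sqrt s * Num.sqrt t.
    rewrite -!sqrtrM ?ltW ?mulr_gt0 ?q0//; congr Num.sqrt.
    by field; rewrite !gt_eqF.
  have -> : npdf (r * q) = npdf (r * (Num.sqrt s)^-1) * expR (r ^+ 2 / (2 * t)).
    rewrite /npdf -mulrA -expRD; congr (_ * expR _).
    rewrite !exprMn qE exprVn uE; field; rewrite !gt_eqF//.
  have ee : expR (- r ^+ 2 / (2 * t)) * expR (r ^+ 2 / (2 * t)) = 1.
    by rewrite -expRD mulNr addNr expR0.
  rewrite yE /c.
  set u := Num.sqrt s in u0 uE *; set v := Num.sqrt t in v0 vE *.
  rewrite -uE; move: (npdf _) ee => n; move: (expR _) (expR _) => e1 e2 ee.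
  transitivity (r / (u ^+ 4 * q * v) * n * (e2 * e1)).
    by field; rewrite !gt_eqF.
  by rewrite ee; field; rewrite !gt_eqF.
rewrite (_ : Num.sqrt (pi / 2) * heat t r = c / 2 - 0); last first.
  rewrite subr0 /c /heat /npdf.
  have -> : - (r / Num.sqrt t) ^+ 2 / 2 = - r ^+ 2 / (2 * t).
    by rewrite exprMn exprVn vE; field; rewrite gt_eqF.
  have p0 : 0 < Num.sqrt pi :> R by rewrite sqrtr_gt0 pi_gt0.
  have s20 : 0 < Num.sqrt 2 :> R by rewrite sqrtr_gt0.
  have s22 : Num.sqrt 2 ^+ 2 = 2 :> R by rewrite sqr_sqrtr.
  rewrite sqrtrM ?pi_ge0// sqrtrV// sqrtrM//.
  move: (expR _) => e; transitivity (2 / Num.sqrt 2 ^+ 2 * (e / Num.sqrt t)).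
    by field; rewrite !gt_eqF.
  by rewrite s22; field; rewrite !gt_eqF.
apply: (@ge0_FTC2_oo _ _ W).
- exact: t0.
- exact: dW.
- move=> s /andP[s0 st].
  have [d hd] : exists d, has_derivative (fun s => (t - s) `^ (- 2^-1) * passage s r) s d.
    by eexists; rewrite /passage; isder; rewrite ?subr_gt0.
  exact: has_derivative_continuous hd.
- by move=> s /andP[s0 st]; rewrite mulr_ge0 ?powR_ge0 ?passage_ge0 ?ltW.
- rewrite -[X in _ --> X](mulr0 c); apply: cvgMr.
  apply: ntail_cvgy_comp; apply: cvgryZ => //.
  apply: cvg_comp cvgy_sqrt; apply: (@cvgyD_lb _ _ _ _ _ (- t^-1)).
    exact: cvgy_inv_at0.
  by near=> s.
- rewrite -ntail0 -(mulr0 r) -sqrtr0; apply: cvgMr; apply: ntail_cvg_comp; apply: cvgMr.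
  apply: continuous_cvg; first exact: sqrt_continuous.
  rewrite -[X in _ --> X](subrr t^-1); apply: cvgB; last exact: cvg_cst.
  apply: cvg_at_left_filter; apply: cvgV; first by rewrite gt_eqF.
  exact: cvg_id.
Unshelve. all: by end_near. Qed.

End half_derivative.

(** * Means under the heat kernel and their half-derivative *)

Section heat_means.
Context {R : realType}.
Notation mu := (@lebesgue_measure R).
Implicit Types (x r t s : R).

Variables (f f1 : R -> R) (C b : R).
Hypotheses (b0 : 0 <= b) (C0 : 0 <= C).
Hypotheses (cf1 : continuous f1) (cf : {for 0, continuous f}).
Hypothesis df : forall r, 0 < r -> has_derivative f r (f1 r).
Hypothesis f1_ub : forall r, 0 < r -> `|f1 r| <= C * expR (b * r).

Let pos : set R := `]0%R, +oo[%classic.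

Let mpos : measurable (pos : set (measurableTypeR R)).
Proof. exact: measurable_itv. Qed.

Let mcont (g : R -> R) : continuous g -> measurable_fun pos g.
Proof. by move=> cg; apply: measurable_funTS; exact: continuous_measurable_fun. Qed.

Lemma integrable_ntail_mean s : 0 < s ->
  mu.-integrable pos (fun r => (f1 r * (2 * ntail (r / Num.sqrt s)))%:E).
Proof.
move=> s0; have u0 : 0 < Num.sqrt s by rewrite sqrtr_gt0.
pose c := (b + 1) * Num.sqrt s + 1.
have c1 : 1 <= c by rewrite lerDr mulr_ge0 ?addr_ge0// ltW.
apply: (@integrable_expR_bound _ _ (C * 2 * expR (c ^+ 2 / 2))).
  apply: mcont => r; apply: cvgM; first exact: cf1.
  have [d hd] : exists d, has_derivative (fun r => 2 * ntail (r / Num.sqrt s)) r d.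
    by eexists; isder.
  exact: has_derivative_continuous hd.
move=> r r0; rewrite normrM (ger0_norm (x := 2 * _)) ?mulr_ge0 ?ntail_ge0//.
apply: (@le_trans _ _ (C * expR (b * r) * (2 * expR (c ^+ 2 / 2 - c * (r / Num.sqrt s))))).
  apply: ler_pM => //; rewrite ?mulr_ge0 ?ntail_ge0 ?f1_ub//.
  by rewrite ler_pM2l// ntail_ub.
have -> : C * expR (b * r) * (2 * expR (c ^+ 2 / 2 - c * (r / Num.sqrt s))) =
  C * 2 * expR (c ^+ 2 / 2) * expR (b * r - c * (r / Num.sqrt s)).
  by rewrite !expRD; ring.
apply: ler_wpM2l; first by rewrite !mulr_ge0 ?expR_ge0.
rewrite ler_expR /c.
have -> : ((b + 1) * Num.sqrt s + 1) * (r / Num.sqrt s) = (b + 1) * r + r / Num.sqrt s.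
  by field; rewrite gt_eqF.
have : 0 <= r / Num.sqrt s by rewrite divr_ge0 ?ltW.
lra.
Qed.

(** Integrating by parts against the tail of [heat t] moves all dependence on
    [t] into a tail with an explicit time derivative. *)
Lemma heat_mean t : 0 < t ->
  mu.-integrable pos (fun r => (f r * heat t r)%:E) /\
  (\int[mu]_(r in pos) (f r * heat t r)%:E =
   (f 0)%:E + \int[mu]_(r in pos) (f1 r * (2 * ntail (r / Num.sqrt t)))%:E)%E.
Proof.
move=> t0.
have mheat : measurable_fun setT (heat t).
  by apply: continuous_measurable_fun; exact: continuous_heat.
have tail x : (\int[mu]_(r in `]x, +oo[) (heat t r)%:E = (2 * ntail (x / Num.sqrt t))%:E)%E.
  have := @integral_expR_heat _ 0 t x t0.
  rewrite expr0n/= !mul0r expR0 mulr1 subr0 => <-.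
  by apply: eq_integral => r _; rewrite mul0r expR0 mul1r.
have [i1 E1] : mu.-integrable pos (fun r => (heat t r * (f (1 * r) - f 0))%:E) /\
  (\int[mu]_(r in pos) (heat t r * (f (1 * r) - f 0))%:E =
   \int[mu]_(x in pos) (f1 x * (2 * ntail (x / Num.sqrt t)))%:E)%E.
  apply: lebesgue_layer_cake => //.
  - exact: heat_ge0.
  - by move=> x _; rewrite divr1.
  - exact: integrable_ntail_mean.
have iheat : mu.-integrable pos (fun r => (heat t r)%:E).
  apply: (@ge0_integrable_fin _ _ (measurableTypeR R) mu pos (heat t)) (tail 0) => //.
    exact: measurable_funTS.
  by move=> r _; exact: heat_ge0.
have iw : mu.-integrable pos (fun r => (f 0 * heat t r)%:E).
  under eq_fun do rewrite EFinM; apply: integrableZl => //.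
have fE : (fun r => (f r * heat t r)%:E) =
    (fun r => ((f 0 * heat t r)%:E + (heat t r * (f (1 * r) - f 0))%:E)%E).
  by apply/funext => r; rewrite -EFinD mul1r; congr EFin; ring.
split; first by rewrite fE; exact: integrableD.
rewrite fE integralD//; congr (_ + _)%E; last exact: E1.
under eq_integral do rewrite EFinM.
rewrite integralZl//.
by rewrite tail// mul0r ntail0 mulfV// mule1.
Qed.

(* The constant of the bound of [npdf_ub] for the slope [b + 2]: one unit of the
   slope absorbs the factor [r] of [passage], another leaves [expR (- r)]. *)
Let bigK u : R := let c := (b + 2) * Num.sqrt u in expR (c ^+ 2 / 2).

Lemma passage_mean_ub u x r : 0 < u -> 0 < x <= u -> 0 < r ->
  `|f1 r * passage x r| <= C * bigK u / (x * Num.sqrt x) * expR (- r).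
Proof.
move=> u0 /andP[x0 xu] r0.
have sx0 : 0 < Num.sqrt x by rewrite sqrtr_gt0.
have su0 : 0 < Num.sqrt u by rewrite sqrtr_gt0.
have sxu : Num.sqrt x <= Num.sqrt u by rewrite ler_wsqrtr.
pose c := (b + 2) * Num.sqrt u.
rewrite normrM (ger0_norm (passage_ge0 _ (ltW r0))).
have pE : passage x r = r / (x * Num.sqrt x) * npdf (r / Num.sqrt x).
  rewrite /passage powRN12// exprVn sqr_sqrtr ?(ltW x0)//; congr (_ * _ * _).
  by rewrite invfM.
rewrite pE.
have h1 : npdf (r / Num.sqrt x) <= bigK u * expR (- (b + 2) * r).
  apply: (le_trans (npdf_ub c _)); rewrite /bigK -expRD ler_expR lerD2l mulNr lerN2.
  rewrite /c -mulrA ler_wpM2l ?addr_ge0// mulrCA ler_peMr ?(ltW r0)//.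
  by rewrite ler_pdivlMr// mul1r.
have h2 : r <= expR r by apply: le_trans (expR_ge1Dx r); lra.
have -> : C * bigK u / (x * Num.sqrt x) * expR (- r) =
   C * expR (b * r) * (expR r / (x * Num.sqrt x) * (bigK u * expR (- (b + 2) * r))).
  have -> : - r = b * r + (r + (- (b + 2) * r)) by ring.
  by rewrite !expRD; ring.
apply: ler_pM => //; rewrite ?f1_ub ?mulr_ge0 ?npdf_ge0 ?(ltW r0)// ?invr_ge0 ?mulr_ge0 ?(ltW x0)//.
apply: ler_pM => //; rewrite ?mulr_ge0 ?npdf_ge0 ?(ltW r0)// ?invr_ge0 ?mulr_ge0 ?(ltW x0)//.
by rewrite ler_wpM2r// invr_ge0 mulr_ge0 ?(ltW x0).
Qed.

(** Differentiation under the integral sign, dominated on the neighbourhood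
    from [s / 2] to [2 * s]: near time zero [passage] is not dominated. *)
Lemma has_derivative_ntail_mean s : 0 < s ->
  has_derivative (fun s => \int[mu]_(r in pos) (f1 r * (2 * ntail (r / Num.sqrt s)))) s
    (\int[mu]_(r in pos) (f1 r * passage s r)).
Proof.
move=> s0.
pose F x r := f1 r * (2 * ntail (r / Num.sqrt x)).
have dF x r : 0 < x -> has_derivative (F ^~ r) x (f1 r * passage x r).
  by move=> x0; apply: has_derivativeZ; exact: has_derivative_ntail_passage.
have u0 : 0 < 2 * s by rewrite mulr_gt0.
pose K := C * bigK (2 * s) / (s / 2 * Num.sqrt (s / 2)).
have K0 : 0 <= K by rewrite !mulr_ge0 ?expR_ge0// invr_ge0 mulr_ge0// divr_ge0// ltW.
pose G r := K * expR (- r).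
have Is : `]s / 2, (2 * s)[%classic s by rewrite /= in_itv/=; lra.
have Ipos x : `]s / 2, (2 * s)[%classic x -> [/\ 0 < x, s / 2 < x & x <= 2 * s].
  by rewrite /= in_itv/= => /andP[]; split; lra.
have intF x : `]s / 2, (2 * s)[%classic x -> mu.-integrable pos (EFin \o F x).
  by move=> /Ipos[x0 _ _]; exact: integrable_ntail_mean.
have derF x y : `]s / 2, (2 * s)[%classic x -> pos y -> derivable (F ^~ y) x 1.
  by move=> /Ipos[x0 _ _] _; exact: has_derivative_derivable (dF _ _ x0).
have G0 y : 0 <= G y by rewrite mulr_ge0 ?expR_ge0.
have iG : mu.-integrable pos (EFin \o G).
  rewrite /comp /G; under eq_fun do rewrite EFinM; apply: integrableZl => //.
  exact: integrable_expRN.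
have Gub x y : `]s / 2, (2 * s)[%classic x -> pos y -> `|partial1of2 F x y| <= G y.
  move=> /Ipos[x0 sx xs]; rewrite /pos/= in_itv/= andbT => y0.
  rewrite /partial1of2 (has_derivative_derive1 (dF _ _ x0)).
  apply: (@le_trans _ _ (C * bigK (2 * s) / (x * Num.sqrt x) * expR (- y))).
    by apply: passage_mean_ub => //; rewrite x0.
  rewrite ler_wpM2r ?expR_ge0// ler_wpM2l ?mulr_ge0 ?expR_ge0//.
  have s20 : 0 < s / 2 by rewrite divr_gt0.
  rewrite lef_pV2 ?posrE ?mulr_gt0 ?sqrtr_gt0//.
  by apply: ler_pM; rewrite ?sqrtr_ge0 ?(ltW sx) ?(ltW s20)// ler_wsqrtr// ltW.
have := derivable_under_integral mpos Is intF derF G0 iG Gub.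
have := differentiation_under_integral mpos Is intF derF G0 iG Gub.
rewrite derive1E => d1 d2.
rewrite (_ : \int[mu]_(r in pos) _ = \int[mu]_(y in pos) partial1of2 F s y).
  by rewrite /has_derivative -d1; exact/derivableP.
by apply: eq_Rintegral => r _; rewrite /partial1of2 (has_derivative_derive1 (dF _ _ s0)).
Qed.

Lemma integrable_passage_mean s : 0 < s ->
  mu.-integrable pos (fun r => (f1 r * passage s r)%:E).
Proof.
move=> s0; apply: (@integrable_expR_bound _ _ (C * bigK s / (s * Num.sqrt s))).
  apply: measurable_funTS; apply: measurable_funM.
    exact: continuous_measurable_fun.
  exact: measurable_passage.
by move=> r r0; apply: passage_mean_ub => //; rewrite s0 lexx.
Qed.

Lemma integrable_heat_mean t : 0 < t ->
  mu.-integrable pos (fun r => (f1 r * heat t r)%:E).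
Proof.
move=> t0.
have i1 : mu.-integrable pos (fun r => (expR (b * r) * heat t r)%:E).
  apply: (@ge0_integrable_fin _ _ (measurableTypeR R) mu pos) (integral_expR_heat b 0 t0) => //.
    apply: mcont => r; apply: cvgM; last exact: continuous_heat.
    apply: (@has_derivative_continuous _ (fun r => expR (b * r))); isder.
  by move=> r _; rewrite mulr_ge0 ?expR_ge0 ?heat_ge0.
have := integrableZl mpos C i1; apply: le_integrable => //.
  apply/measurable_EFinP; apply: mcont => r; apply: cvgM; first exact: cf1.
  exact: continuous_heat.
move=> r; rewrite /pos/= in_itv/= andbT => r0; rewrite lee_fin normrM (ger0_norm (heat_ge0 _ _)).
apply: le_trans (ler_norm _); rewrite [leRHS]mulrA.
by apply: ler_wpM2r; [exact: heat_ge0|exact: f1_ub].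
Qed.

(** By Fubini, the half-integral of a mean of first passage densities is
    computed pointwise in [r], where [integral_abel_passage] gives back the
    heat kernel.  Together with [heat_mean] and [has_derivative_ntail_mean]:
    up to a constant, the Caputo half-derivative of a heat mean of [f] is the
    heat mean of the derivative of [f]. *)
Lemma abel_passage_mean t : 0 < t ->
  mu.-integrable `]0%R, t[ (fun s => ((t - s) `^ (- 2^-1) * \int[mu]_(r in pos) (f1 r * passage s r))%:E) /\
  (\int[mu]_(s in `]0%R, t[) ((t - s) `^ (- 2^-1) * \int[mu]_(r in pos) (f1 r * passage s r))%:E =
   (Num.sqrt (pi / 2))%:E * \int[mu]_(r in pos) (f1 r * heat t r)%:E)%E.
Proof.
move=> t0.
pose F (p : measurableTypeR R * measurableTypeR R) : R :=
  if [&& 0 < p.1, p.1 < t & 0 < p.2]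
  then (t - p.1) `^ (- 2^-1) * (f1 p.2 * passage p.1 p.2) else 0.
have mF : measurable_fun setT F.
  apply: measurable_fun_ifT => //.
    apply: measurable_and; first exact: measurable_fun_ltr.
    by apply: measurable_and; exact: measurable_fun_ltr.
  apply: measurable_funM.
    apply: (measurableT_comp (measurable_powR _)); exact: measurable_funB.
  apply: measurable_funM; last exact: measurable_passage.
  apply: measurableT_comp => //; exact: continuous_measurable_fun.
have inner_s r k : 0 < r ->
    (\int[mu]_s (if (0 < s) && (s < t) then (t - s) `^ (- 2^-1) * (k * passage s r) else 0)%:E =
     (Num.sqrt (pi / 2) * (k * heat t r))%:E)%E.
  move=> r0; rewrite mulrCA EFinM -(integral_abel_passage t0 r0).
  rewrite -integralZl//; last first.
    apply: (@ge0_integrable_fin _ _ (measurableTypeR R) mu) (integral_abel_passage t0 r0) => //.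
      apply: measurable_funTS; apply: measurable_funM; last exact: measurable_passage.
      apply: (measurableT_comp (measurable_powR _)); exact: measurable_funB.
    move=> s; rewrite /= in_itv/= => /andP[s0 st].
    by rewrite mulr_ge0 ?powR_ge0 ?passage_ge0 ?ltW.
  rewrite [RHS]integral_mkcond; apply: eq_integral => s _.
  rewrite patchE mem_setE in_itv/=; case: ifP => // _.
  by rewrite -EFinM; congr EFin; ring.
have iF : (mu \x mu)%E.-integrable setT (EFin \o F).
  apply/integrable21ltyP; first exact/measurable_EFinP.
  have -> : (\int[mu]_r \int[mu]_s `|(EFin \o F) (s, r)| =
      \int[mu]_(r in pos) `|(Num.sqrt (pi / 2))%:E * (f1 r * heat t r)%:E|)%E.
    rewrite [RHS]integral_mkcond; apply: eq_integral => r _.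
    rewrite patchE mem_setE in_itv/= andbT; case: ifPn => r0.
      rewrite normrM (ger0_norm (sqrtr_ge0 _)) normrM (ger0_norm (heat_ge0 _ _)) -inner_s//.
      apply: eq_integral => s _; rewrite /F/= r0 andbT; case: ifP => _; last by rewrite normr0.
      rewrite normrM (ger0_norm (powR_ge0 _ _)); congr ((_ * _)%:E).
      by rewrite normrM (ger0_norm (passage_ge0 _ (ltW r0))).
    by rewrite integral0_eq// => s _; rewrite /F/= (negbTE r0) !andbF normr0.
  by have /integrableP[] := integrableZl mpos (Num.sqrt (pi / 2)) (integrable_heat_mean t0).
have FE s : (\int[mu]_r (F (s, r))%:E =
  (if (0 < s) && (s < t) then (t - s) `^ (- 2^-1) * \int[mu]_(r in pos) (f1 r * passage s r) else 0)%:E)%E.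
  case: ifPn => [/andP[s0 st]|st]; last first.
    by rewrite integral0_eq// => r _; rewrite /F/= andbA (negbTE st).
  rewrite EFinM /Rintegral fineK; last first.
    exact: integrable_fin_num (integrable_passage_mean s0).
  rewrite -integralZl//; last exact: integrable_passage_mean.
  rewrite [RHS]integral_mkcond; apply: eq_integral => r _.
  by rewrite patchE mem_setE in_itv/= andbT /F/= s0 st/=; case: ifP.
split.
  have : mu.-integrable `]0%R, t[ (fubini_F mu (EFin \o F)).
    by apply: integrableS (integrable_fubini_F iF).
  apply: eq_integrable => // s; rewrite mem_setE in_itv/= => st.
  by rewrite /fubini_F/= FE st.
transitivity (\int[mu]_s \int[mu]_r (EFin \o F) (s, r))%E.
  rewrite [LHS]integral_mkcond; apply: eq_integral => s _.
  by rewrite patchE mem_setE in_itv/= FE; case: ifP.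
rewrite (Fubini iF) -integralZl//; last exact: integrable_heat_mean.
rewrite [RHS]integral_mkcond; apply: eq_integral => r _.
rewrite patchE mem_setE in_itv/= andbT; case: ifPn => r0.
  rewrite -EFinM -inner_s//; apply: eq_integral => s _.
  by rewrite /F/= r0 andbT.
by rewrite integral0_eq// => s _; rewrite /F/= (negbTE r0) !andbF.
Qed.
End heat_means.

(** * The half-order equation for inverse Gaussian means *)

Section primitive.
Context {R : realType}.
Notation mu := (@lebesgue_measure R).

Lemma continuous_primitive (g : R -> R) : continuous g ->
  exists G : R -> R, G 0 = 0 /\ forall x, has_derivative G x (g x).
Proof.
move=> cg.
have ig (a b : R) : mu.-integrable `[a, b] (EFin \o g).
  by apply: continuous_compact_integrable; [exact: segment_compact|exact: continuous_subspaceT].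
(* The fundamental theorem needs a lower end; [P M] has one, and differs from
   [G] by a constant beyond [- M]. *)
pose P M x : R := \int[mu]_(y in `[- M, x]) g y.
pose G x : R := if 0 <= x then \int[mu]_(y in `]0, x]) g y else - \int[mu]_(y in `]x, 0]) g y.
have GE M x : 0 < M -> - M < x -> G x = P M x - P M 0.
  move=> M0 Mx; rewrite /G /P; case: ifPn => [x0|]; last rewrite -ltNge => x0.
    rewrite Rintegral_itvB// ?bnd_simp//; lra.
  by rewrite -(@Rintegral_itvB _ _ _ _ _ (ig (- M) 0)) ?bnd_simp ?opprB//; lra.
exists G; split.
  by rewrite /G lexx set_itvoc0 Rintegral_set0.
move=> x; pose M : R := `|x| + 1.
have M0 : 0 < M by rewrite ltr_wpDl.
have Mx : - M < x by have := ler_norm (- x); rewrite normrN /M; lra.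
have dP : has_derivative (P M) x (g x).
  have xx : x < x + 1 by rewrite ltrDl.
  have [d1 d2] := @continuous_FTC1_closed R g (- M) x (x + 1) xx (ig _ _) Mx (cg x).
  by rewrite /has_derivative -d2 derive1E; exact/derivableP.
have dPB : has_derivative (fun y => P M y - P M 0) x (g x).
  by rewrite -[g x]subr0; exact: has_derivativeB dP (has_derivative_cst _ _).
apply: (near_eq_is_derive _ dPB); near=> y; apply/esym/GE => //.
have : - y < M by near: y; apply: Nlt_nbhsl; lra.
lra.
Unshelve. all: by end_near. Qed.
End primitive.

Section special_values.
Context {R : realType}.
Notation mu := (@lebesgue_measure R).

Lemma sqrt_pi_gt0 : 0 < Num.sqrt pi :> R.
Proof. by rewrite sqrtr_gt0 pi_gt0. Qed.

Lemma npdf_sqrt2 (x : R) : npdf (Num.sqrt 2 * x) =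
  (Num.sqrt 2 * Num.sqrt pi)^-1 * expR (- x ^+ 2).
Proof.
rewrite /npdf sqrtrM//; congr (_ * expR _).
by rewrite exprMn sqr_sqrtr//; field.
Qed.

(** Substituting a square root turns the Gamma integral into a Gaussian tail. *)
Lemma Gamma_half : Gamma 2^-1 = Num.sqrt pi :> R.
Proof.
have s20 : 0 < Num.sqrt 2 :> R by rewrite sqrtr_gt0.
have p0 := sqrt_pi_gt0.
rewrite /Gamma /Rintegral.
pose F (x : R) := - (2 * Num.sqrt pi) * ntail (Num.sqrt 2 * Num.sqrt x).
have e1 : 2^-1 - 1 = - 2^-1 :> R by field.
suff h : (\int[mu]_(x in `]0%R, +oo[) (x `^ (- 2^-1) * expR (- x))%:E =
    (0 - - Num.sqrt pi)%:E)%E by rewrite e1 h /= sub0r opprK.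
apply: (@ge0_FTC2_oy _ _ F).
- move=> x x0; have u0 : Num.sqrt x != 0 by rewrite gt_eqF// sqrtr_gt0.
  rewrite /F; apply: has_derivative_val; first isder => //.
  rewrite npdf_sqrt2 sqr_sqrtr ?(ltW x0)// powRN12//.
  by move: (expR _) => e; field; rewrite u0 !gt_eqF.
- move=> x x0.
  have [d hd] : exists d, has_derivative (fun x : R => x `^ (- 2^-1) * expR (- x)) x d.
    by eexists; isder.
  exact: has_derivative_continuous hd.
- by move=> x x0; rewrite mulr_ge0 ?powR_ge0 ?expR_ge0.
- have -> : - Num.sqrt pi = - (2 * Num.sqrt pi) * ntail (Num.sqrt 2 * 0) :> R.
    by rewrite mulr0 ntail0; field.
  by apply: cvgMr; apply: ntail_cvg_comp; apply: cvgMr; exact: cvg_sqrt_at0.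
- rewrite -[X in _ --> X](mulr0 (- (2 * Num.sqrt pi))); apply: cvgMr.
  by apply: ntail_cvgy_comp; apply: cvgryZ => //; exact: cvgy_sqrt.
Qed.

Lemma erfc_ntail (x : R) : 0 < x -> erfc x = 2 * ntail (Num.sqrt 2 * x).
Proof.
move=> x0.
have s20 : 0 < Num.sqrt 2 :> R by rewrite sqrtr_gt0.
have p0 := sqrt_pi_gt0.
rewrite /erfc /erf /Rintegral.
pose F (x : R) := - Num.sqrt pi * ntail (Num.sqrt 2 * x).
have dF y : has_derivative F y (expR (- y ^+ 2)).
  rewrite /F; apply: has_derivative_val; first isder.
  rewrite npdf_sqrt2; move: (expR _) => e; by field; rewrite !gt_eqF.
have h : (\int[mu]_(y in `[0%R, x]) (expR (- y ^+ 2))%:E = (F x - F 0)%:E)%E.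
  apply: (@FTC2_segment _ _ F); first exact: x0.
  - move=> y _; apply: (@has_derivative_continuous _ (fun y => expR (- y ^+ 2))).
    by isder.
  - by move=> y _; exact: dF.
  - exact: has_derivative_continuous (dF 0).
  - exact: has_derivative_continuous (dF x).
by rewrite h /F mulr0 ntail0/=; field; rewrite gt_eqF.
Qed.

End special_values.

Section transform.
Context {R : realType}.
Notation mu := (@lebesgue_measure R).
Variables (gamma delta : R).
Hypotheses (g0 : 0 < gamma) (d0 : 0 < delta).
Implicit Types (psi J : R -> R) (r t x : R).

Let pos : set R := `]0%R, +oo[%classic.

Let mpos : measurable (pos : set (measurableTypeR R)).
Proof. exact: measurable_itv. Qed.

(** With [J] the primitive of [psi x * expR (2 * gamma * delta * x)] that
    vanishes at zero, this is the function whose heat mean is the mean of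
    [psi] over the hitting time, exponentially tilted: the passage from the
    running maximum of a Brownian motion with drift [gamma] to that of one
    without drift, which has the distribution of an absolute value. *)
Definition transform psi J r : R :=
  expR (gamma * r) * psi (delta^-1 * r) -
  gamma * delta * expR (- gamma * r) * J (delta^-1 * r).

(** When [psi1] is the derivative of [psi], the mean of [psi] over a nonnegative
    variable that exceeds [x] with probability [IGcdf (delta * x) gamma t]. *)
Definition mean_cdf psi (psi1 : R -> R) t : R :=
  psi 0 + \int[mu]_(x in pos) (psi1 x * IGcdf (delta * x) gamma t).

(** A Gaussian tail beats any exponential. *)
Lemma ntail_exp_bound (b k0 kappa : R) : 0 < kappa ->
  exists2 K, 0 <= K & forall x, 0 < x ->
    expR (b * x) * ntail (kappa * x + k0) <= K * expR (- x).
Proof.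
move=> ka0; pose c := (`|b| + 1) / kappa + 1.
have c1 : 1 <= c by rewrite lerDr divr_ge0 ?addr_ge0// ltW.
exists (expR (c ^+ 2 / 2 - c * k0)); first exact: expR_ge0.
move=> x x0.
apply: (@le_trans _ _ (expR (b * x) * expR (c ^+ 2 / 2 - c * (kappa * x + k0)))).
  by rewrite ler_wpM2l ?expR_ge0// ntail_ub.
rewrite -!expRD ler_expR.
have -> : c * (kappa * x + k0) = (`|b| + 1) * x + kappa * x + c * k0.
  by rewrite /c; field; rewrite gt_eqF.
have : b * x <= `|b| * x by rewrite ler_wpM2r ?(ltW x0)// ler_norm.
have : 0 < kappa * x by rewrite mulr_gt0.
lra.
Qed.

Lemma integrable_ntail_exp (psi1 : R -> R) (b k0 kappa M : R) : 0 < kappa -> continuous psi1 ->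
  (forall x, 0 < x -> `|psi1 x| <= M) ->
  mu.-integrable pos (fun x => (psi1 x * (expR (b * x) * ntail (kappa * x + k0)))%:E).
Proof.
move=> ka0 cpsi psiM; have [K K0 hK] := ntail_exp_bound b k0 ka0.
apply: (@integrable_expR_bound _ _ (M * K)).
  apply: measurable_funTS; apply: continuous_measurable_fun => x.
  apply: cvgM; first exact: cpsi.
  have [d hd] : exists d, has_derivative (fun x => expR (b * x) * ntail (kappa * x + k0)) x d.
    by eexists; isder.
  exact: has_derivative_continuous hd.
move=> x x0; rewrite normrM [X in _ * X]ger0_norm ?mulr_ge0 ?expR_ge0 ?ntail_ge0//.
by rewrite -mulrA ler_pM ?psiM ?hK ?mulr_ge0 ?expR_ge0 ?ntail_ge0.
Qed.

(** Both sides are expanded into layers.  The tails of [expR (c * r) * heat t r]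
    for [c = gamma] and [c = - gamma] are the two terms of [IGcdf], and their
    increments are those of [psi] and of [psi x * expR (2 * gamma * delta * x)
    - 2 * gamma * delta * J x]: half the sum of the two is [transform psi J]. *)
Lemma transform_mean psi (psi1 : R -> R) J M t : 0 < t ->
  continuous psi -> continuous psi1 ->
  (forall x, 0 < x -> has_derivative psi x (psi1 x)) ->
  (forall x, 0 < x -> `|psi1 x| <= M) ->
  continuous J -> J 0 = 0 ->
  (forall x, 0 < x -> has_derivative J x (psi x * expR (2 * gamma * delta * x))) ->
  mu.-integrable pos (fun r => (transform psi J r * heat t r)%:E) /\
  \int[mu]_(r in pos) (transform psi J r * heat t r) =
  expR (gamma ^+ 2 * t / 2) * mean_cdf psi psi1 t.
Proof.
move=> t0 cpsi cpsi1 dpsi psiM cJ J0 dJ.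
have s0 : 0 < Num.sqrt t by rewrite sqrtr_gt0.
pose E := expR (gamma ^+ 2 * t / 2).
pose ka := delta / Num.sqrt t.
have ka0 : 0 < ka by rewrite divr_gt0.
pose e2 x := expR (2 * gamma * delta * x).
pose h1 x := 2 * E * ntail (ka * x + - (gamma * Num.sqrt t)).
pose h2 x := 2 * E * ntail (ka * x + gamma * Num.sqrt t).
pose w1 r := expR (gamma * r) * heat t r.
pose w2 r := expR (- gamma * r) * heat t r.
pose J' x := psi x * e2 x - psi 0 - 2 * gamma * delta * J x.
have J'0 : J' 0 = 0 by rewrite /J' J0 /e2 mulr0 expR0 mulr1 subrr subr0.
have de2 x : has_derivative e2 x (2 * gamma * delta * e2 x).
  by rewrite /e2; apply: has_derivative_val; first isder; rewrite mulr1.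
have ce2 : continuous e2 by move=> x; exact: has_derivative_continuous (de2 x).
have cE c : continuous (fun r => expR (c * r)).
  by move=> r; apply: (@has_derivative_continuous _ (fun r => expR (c * r))); isder.
have cw c : continuous (fun r => expR (c * r) * heat t r).
  by move=> r; apply: cvgM; [exact: cE|exact: continuous_heat].
have mw c : measurable_fun setT (fun r => expR (c * r) * heat t r).
  by apply: continuous_measurable_fun; exact: cw.
have w_ge0 c r : 0 <= expR (c * r) * heat t r by rewrite mulr_ge0 ?expR_ge0 ?heat_ge0.
have tailE c x : (\int[mu]_(r in `](x / delta^-1)%R, +oo[) (expR (c * r) * heat t r)%:E =
    (2 * expR (c ^+ 2 * t / 2) * ntail (ka * x + - (c * Num.sqrt t)))%:E)%E.
  have -> : ka * x = x / delta^-1 / Num.sqrt t by rewrite /ka invrK; ring.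
  exact: integral_expR_heat.
have di0 : 0 < delta^-1 by rewrite invr_gt0.
have [i1 I1] : mu.-integrable pos (fun r => (w1 r * (psi (delta^-1 * r) - psi 0))%:E) /\
    (\int[mu]_(r in pos) (w1 r * (psi (delta^-1 * r) - psi 0))%:E =
     \int[mu]_(x in pos) (psi1 x * h1 x)%:E)%E.
  apply: (lebesgue_layer_cake di0 (mw _) (w_ge0 _) cpsi1 (cpsi 0) dpsi).
    by move=> x _; exact: tailE.
  have := integrableZl mpos (2 * E)
    (integrable_ntail_exp 0 (- (gamma * Num.sqrt t)) ka0 cpsi1 psiM).
  apply: eq_integrable => // x _.
  by rewrite /h1 -EFinM mul0r expR0; congr EFin; ring.
have [i2 I2] : mu.-integrable pos (fun r => (w2 r * (J' (delta^-1 * r) - J' 0))%:E) /\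
    (\int[mu]_(r in pos) (w2 r * (J' (delta^-1 * r) - J' 0))%:E =
     \int[mu]_(x in pos) (psi1 x * e2 x * h2 x)%:E)%E.
  apply: (lebesgue_layer_cake di0 (mw _) (w_ge0 _)).
  - by move=> x; apply: cvgM; [exact: cpsi1|exact: ce2].
  - apply: cvgB; last by apply: cvgMr; exact: cJ.
    by apply: cvgB; [apply: cvgM; [exact: cpsi|exact: ce2]|exact: cvg_cst].
  - move=> x x0; rewrite /J'; apply: has_derivative_val.
      apply: has_derivativeB; last by apply: has_derivativeZ; exact: dJ.
      apply: has_derivativeB (has_derivative_cst _ _).
      exact: has_derivativeM (dpsi _ x0) (de2 _).
    by rewrite /e2; ring.
  - move=> x _; rewrite /w2 tailE /h2 /E; congr (((2 * expR _ * ntail _))%:E).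
      by rewrite sqrrN.
    by rewrite mulNr opprK.
  - have := integrableZl mpos (2 * E)
      (integrable_ntail_exp (2 * gamma * delta) (gamma * Num.sqrt t) ka0 cpsi1 psiM).
    apply: eq_integrable => // x _.
    by rewrite /h2 -EFinM /e2; congr EFin; ring.
have W c : (\int[mu]_(r in pos) (expR (c * r) * heat t r)%:E =
    (2 * expR (c ^+ 2 * t / 2) * ntail (- (c * Num.sqrt t)))%:E)%E.
  by have := tailE c 0; rewrite mul0r mulr0 add0r.
have iW c : mu.-integrable pos (fun r => (expR (c * r) * heat t r)%:E).
  apply: (@ge0_integrable_fin _ _ (measurableTypeR R) mu pos) (W c) => //.
  by apply: measurable_funTS; exact: mw.
pose q r := psi 0 / 2 * (w1 r + w2 r).
have iq : mu.-integrable pos (EFin \o q).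
  have := integrableZl mpos (psi 0 / 2) (integrableD mpos (iW gamma) (iW (- gamma))).
  by apply: eq_integrable => // r _; rewrite -EFinD -EFinM.
have i12 : mu.-integrable pos (EFin \o (fun r => 2^-1 * (w1 r * (psi (delta^-1 * r) - psi 0) +
    w2 r * (J' (delta^-1 * r) - J' 0)))).
  have := integrableZl mpos 2^-1 (integrableD mpos i1 i2).
  by apply: eq_integrable => // r _; rewrite -EFinD -EFinM.
(* The increments leave out the values at zero, which [q] restores. *)
have TE r : transform psi J r * heat t r =
    2^-1 * (w1 r * (psi (delta^-1 * r) - psi 0) + w2 r * (J' (delta^-1 * r) - J' 0)) + q r.
  rewrite J'0 subr0 /J' /q /w1 /w2 /e2 /transform.
  have -> : expR (2 * gamma * delta * (delta^-1 * r)) = expR (gamma * r) * expR (gamma * r).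
    by rewrite -expRD; congr expR; field; rewrite gt_eqF.
  have ee : expR (- gamma * r) * expR (gamma * r) = 1.
    by rewrite -expRD mulNr addNr expR0.
  move: (expR (- gamma * r)) (expR (gamma * r)) ee => em ep ee.
  have epE : em * (ep * ep) = ep by rewrite mulrA ee mul1r.
  move: (psi _) (psi 0) (J _) (heat t r) => p p0 j h.
  transitivity (2^-1 * (ep * h * (p - p0) + h * (p * (em * (ep * ep)) - em * p0 -
    2 * gamma * delta * em * j)) + p0 / 2 * (ep * h + em * h)); last by field.
  by rewrite epE; field.
split.
  have := integrableD mpos i12 iq.
  by apply: eq_integrable => // r _; rewrite TE EFinD.
under eq_Rintegral do rewrite TE.
rewrite RintegralD// RintegralZl//; last first.
  have := integrableD mpos i1 i2.
  by apply: eq_integrable => // r _; rewrite -EFinD.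
rewrite RintegralD// RintegralZl//; last first.
  have := integrableD mpos (iW gamma) (iW (- gamma)).
  by apply: eq_integrable => // r _; rewrite -EFinD.
rewrite RintegralD//; [|exact: iW..].
have WR c : \int[mu]_(r in pos) (expR (c * r) * heat t r) =
    2 * expR (c ^+ 2 * t / 2) * ntail (- (c * Num.sqrt t)) by rewrite /Rintegral W.
have -> := WR gamma; have -> := WR (- gamma).
rewrite sqrrN mulNr opprK ntailN.
have RI1 : \int[mu]_(r in pos) (w1 r * (psi (delta^-1 * r) - psi 0)) =
    \int[mu]_(x in pos) (psi1 x * h1 x).
  exact: (congr1 fine I1).
have RI2 : \int[mu]_(r in pos) (w2 r * (J' (delta^-1 * r) - J' 0)) =
    \int[mu]_(x in pos) (psi1 x * e2 x * h2 x).
  exact: (congr1 fine I2).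
rewrite {}RI1 {}RI2.
have j1 : mu.-integrable pos (fun x => (psi1 x * (expR (0 * x) * ntail (ka * x + - (gamma * Num.sqrt t))))%:E).
  exact: (integrable_ntail_exp _ _ ka0 cpsi1 psiM).
have j2 : mu.-integrable pos (fun x => (psi1 x * (expR (2 * gamma * delta * x) * ntail (ka * x + gamma * Num.sqrt t)))%:E).
  exact: (integrable_ntail_exp _ _ ka0 cpsi1 psiM).
have -> : \int[mu]_(x in pos) (psi1 x * h1 x) = 2 * E *
    \int[mu]_(x in pos) (psi1 x * (expR (0 * x) * ntail (ka * x + - (gamma * Num.sqrt t)))).
  rewrite -RintegralZl//; apply: eq_Rintegral => x _.
  by rewrite mul0r expR0 /h1; ring.
have -> : \int[mu]_(x in pos) (psi1 x * e2 x * h2 x) = 2 * E *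
    \int[mu]_(x in pos) (psi1 x * (expR (2 * gamma * delta * x) * ntail (ka * x + gamma * Num.sqrt t))).
  by rewrite -RintegralZl//; apply: eq_Rintegral => x _; rewrite /h2 /e2; ring.
rewrite /mean_cdf -/E.
have -> : \int[mu]_(x in pos) (psi1 x * IGcdf (delta * x) gamma t) =
    \int[mu]_(x in pos) (psi1 x * (expR (0 * x) * ntail (ka * x + - (gamma * Num.sqrt t)))) +
    \int[mu]_(x in pos) (psi1 x * (expR (2 * gamma * delta * x) * ntail (ka * x + gamma * Num.sqrt t))).
  rewrite -(RintegralD mpos j1 j2).
  apply: eq_Rintegral => x _.
  rewrite -mulrDr mul0r expR0 mul1r /IGcdf; congr (_ * (ntail _ + expR _ * ntail _)).
  - by rewrite /ka; ring.
  - by ring.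
  - by rewrite /ka; ring.
move: (Rintegral _ _ _) (Rintegral _ _ _) => a b; by field.
Qed.

Variables (phi psi chi : R -> R) (M : R).
Hypotheses (cphi : continuous phi) (cpsi : continuous psi) (cchi : continuous chi).
Hypotheses (dphi : forall x, 0 < x -> has_derivative phi x (psi x))
  (dpsi : forall x, 0 < x -> has_derivative psi x (chi x)).
Hypotheses (psiM : forall x, 0 < x -> `|psi x| <= M)
  (chiM : forall x, 0 < x -> `|chi x| <= M)
  (phiM : forall x, 0 < x -> `|phi x| <= M).

(** The tilted function [u] is the heat mean of [f = transform phi J], so that its
    half-derivative is, up to a constant, the heat mean of the derivative [f1]
    of [f].  The point is [f1E]: [f1] is a combination of [f], of the transform of [psi], and of
    an exponential whose heat mean is the complementary error function. *)
Lemma caputo_mean_cdf (u : R -> R) t : 0 < t ->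
  (forall s, 0 < s -> u s = mean_cdf phi psi s) ->
  has_caputo_half (exp_tilt gamma u) t /\
  delta * IG_operator gamma u t =
    delta * gamma * u t + mean_cdf psi chi t -
    delta * gamma * erfc (gamma * Num.sqrt t / Num.sqrt 2) * phi 0.
Proof.
move=> t0 uE.
pose e2 x := expR (2 * gamma * delta * x).
have de2 x : has_derivative e2 x (2 * gamma * delta * e2 x).
  by rewrite /e2; apply: has_derivative_val; first isder; rewrite mulr1.
have ce2 : continuous e2 by move=> x; exact: has_derivative_continuous (de2 x).
have cE c : continuous (fun r => expR (c * r)).
  by move=> r; apply: (@has_derivative_continuous _ (fun r => expR (c * r))); isder.
have [|J [J0 dJ]] := @continuous_primitive R (fun x => phi x * e2 x).
  by move=> x; apply: cvgM; [exact: cphi|exact: ce2].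
have cJ : continuous J by move=> x; exact: has_derivative_continuous (dJ x).
(* The primitive of [psi * e2], by parts. *)
pose Jp x := phi x * e2 x - phi 0 - 2 * gamma * delta * J x.
have Jp0 : Jp 0 = 0 by rewrite /Jp J0 /e2 mulr0 expR0 mulr1 subrr subr0.
have dJp x : 0 < x -> has_derivative Jp x (psi x * e2 x).
  move=> x0; rewrite /Jp; apply: has_derivative_val.
    apply: has_derivativeB; last by apply: has_derivativeZ; exact: dJ.
    apply: has_derivativeB (has_derivative_cst _ _).
    exact: has_derivativeM (dphi x0) (de2 _).
  by ring.
have cJp : continuous Jp.
  move=> x; apply: cvgB; last by apply: cvgMr; exact: cJ.
  by apply: cvgB; [apply: cvgM; [exact: cphi|exact: ce2]|exact: cvg_cst].
pose f := transform phi J.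
pose f1 r := delta^-1 * expR (gamma * r) * psi (delta^-1 * r) +
  gamma ^+ 2 * delta * expR (- gamma * r) * J (delta^-1 * r).
have cdil (h : R -> R) : continuous h -> continuous (fun r => h (delta^-1 * r)).
  move=> ch r; apply: continuous_comp; last exact: ch.
  by apply: cvgMr; exact: cvg_id.
have cf : continuous f.
  move=> r; apply: cvgB.
    by apply: cvgM; [exact: cE|exact: cdil].
  by apply: cvgM; [apply: cvgMr; exact: cE|exact: cdil].
have cf1 : continuous f1.
  move=> r; apply: cvgD.
    by apply: cvgM; [apply: cvgMr; exact: cE|exact: cdil].
  by apply: cvgM; [apply: cvgMr; exact: cE|exact: cdil].
have eee r : e2 (delta^-1 * r) = expR (gamma * r) * expR (gamma * r).
  by rewrite /e2 -expRD; congr expR; field; rewrite gt_eqF.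
have ee r : expR (- gamma * r) * expR (gamma * r) = 1.
  by rewrite -expRD mulNr addNr expR0.
have di0 : 0 < delta^-1 by rewrite invr_gt0.
have ddil (h : R -> R) r c : has_derivative h (delta^-1 * r) c ->
    has_derivative (fun r => h (delta^-1 * r)) r (delta^-1 * 1 * c).
  by move=> hh; apply: (has_derivative_comp hh); isder.
have df r : 0 < r -> has_derivative f r (f1 r).
  move=> r0; have y0 : 0 < delta^-1 * r by rewrite mulr_gt0.
  rewrite /f /transform; apply: has_derivative_val.
    apply: has_derivativeB.
      by apply: has_derivativeM; [isder|apply: ddil; exact: dphi].
    by apply: has_derivativeM; [isder|apply: ddil; exact: dJ].
  rewrite /f1 eee; have := ee r.
  move: (expR (- gamma * r)) (expR (gamma * r)) => em ep eme.
  have epE : em * (ep * ep) = ep by rewrite mulrA eme mul1r.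
  move: (phi _) (psi _) (J _) => p q j.
  transitivity (gamma * ep * p + ep * (delta^-1 * q) + gamma ^+ 2 * delta * em * j -
    gamma * p * (em * (ep * ep))); first by field; rewrite gt_eqF.
  by rewrite epE; ring.
have f1E r : f1 r = gamma * f r + delta^-1 * transform psi Jp r - gamma * phi 0 * expR (- gamma * r).
  rewrite /f1 /f /transform /Jp eee; have := ee r.
  move: (expR (- gamma * r)) (expR (gamma * r)) => em ep eme.
  have epE : em * (ep * ep) = ep by rewrite mulrA eme mul1r.
  move: (phi _) (phi 0) (psi _) (J _) => p p0 q j.
  transitivity (delta^-1 * ep * q + gamma ^+ 2 * delta * em * j +
    gamma * p * (ep - em * (ep * ep))); first by rewrite epE; ring.
  by field; rewrite gt_eqF.
(* Bounds [f1] exponentially; [delta^-1] pays for the linear factor in the bound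
   [JM] of [J]. *)
pose b := gamma + delta^-1.
pose C := M / delta + gamma ^+ 2 * delta * M.
have M0 : 0 <= M by apply: le_trans (psiM ltr01).
have b0 : 0 <= b by rewrite addr_ge0 ?ltW.
have dn0 : 0 <= delta^-1 by exact: ltW.
have gn0 : 0 <= gamma ^+ 2 * delta by rewrite mulr_ge0 ?sqr_ge0// ltW.
have C0 : 0 <= C by apply: addr_ge0; apply: mulr_ge0.
have JM x : 0 < x -> `|J x| <= M * (x * e2 x).
  move=> x0.
  have hd y : y \in `]0, x[ -> is_derive y 1 J (phi y * e2 y) by move=> _; exact: dJ.
  have [|c] := MVT x0 hd; first exact: continuous_subspaceT.
  rewrite in_itv/= => /andP[c0 cx]; rewrite J0 !subr0 => ->.
  rewrite !normrM (ger0_norm (expR_ge0 _)) (gtr0_norm x0) -mulrA.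
  apply: ler_pM; rewrite ?phiM//; first by rewrite mulr_ge0 ?expR_ge0// ltW.
  rewrite mulrC ler_wpM2l ?(ltW x0)// ler_expR ler_wpM2l ?(ltW cx)//.
  by rewrite !mulr_ge0 ?ltW.
have f1M r : 0 < r -> `|f1 r| <= C * expR (b * r).
  move=> r0; have y0 : 0 < delta^-1 * r by rewrite mulr_gt0.
  have -> : C * expR (b * r) = delta^-1 * expR (gamma * r) * M * expR (delta^-1 * r) +
     gamma ^+ 2 * delta * (M * (expR (gamma * r) * expR (delta^-1 * r))).
    have -> : expR (b * r) = expR (gamma * r) * expR (delta^-1 * r) by rewrite -expRD -mulrDl.
    by rewrite /C; ring.
  apply: (le_trans (ler_normD _ _)); apply: lerD.
    rewrite !normrM (ger0_norm dn0) (ger0_norm (expR_ge0 _)) -mulrA -[leRHS]mulrA -[leRHS]mulrA.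
    rewrite ler_wpM2l// ler_wpM2l ?expR_ge0// (le_trans (psiM y0))// ler_peMr//.
    by rewrite -expR0 ler_expR ltW.
  rewrite -[X in `|X|]mulrA normrM (ger0_norm gn0) normrM (ger0_norm (expR_ge0 _)) ler_wpM2l//.
  apply: (@le_trans _ _ (expR (- gamma * r) * (M * (delta^-1 * r * e2 (delta^-1 * r))))).
    by rewrite ler_wpM2l ?expR_ge0// JM.
  have -> : expR (- gamma * r) * (M * (delta^-1 * r * e2 (delta^-1 * r))) =
    M * (expR (gamma * r) * (delta^-1 * r)).
    rewrite eee; have := ee r.
    move: (expR (- gamma * r)) (expR (gamma * r)) => em ep eme.
    transitivity (M * ((em * ep) * ep * (delta^-1 * r))); first ring.
    by rewrite eme mul1r.
  rewrite ler_wpM2l// ler_wpM2l ?expR_ge0//.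
  by apply: le_trans (expR_ge1Dx _); rewrite lerDr.
have cf0 : {for 0, continuous f} by exact: cf.
have tm s : 0 < s -> \int[mu]_(r in pos) (f r * heat s r) = expR (gamma ^+ 2 * s / 2) * u s.
  move=> s0; rewrite uE//.
  by have [_ ->] := transform_mean s0 cphi cpsi dphi psiM cJ J0 (fun x _ => dJ x).
pose D s := \int[mu]_(r in pos) (f1 r * passage s r).
have dv s : 0 < s -> has_derivative (exp_tilt gamma u) s (D s).
  move=> s0.
  have h0 : has_derivative (fun s => f 0 + \int[mu]_(r in pos) (f1 r * (2 * ntail (r / Num.sqrt s)))) s (D s).
    rewrite -[D s]add0r; apply: has_derivativeD (has_derivative_cst _ _) _.
    exact: (has_derivative_ntail_mean b0 C0 cf1 f1M s0).
  apply: (near_eq_is_derive _ h0); near=> z.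
  have z0 : 0 < z by near: z; exact: lt_nbhsr.
  have [_ hm] := heat_mean b0 C0 cf1 cf0 df f1M z0.
  have fn := integrable_fin_num mpos (integrable_ntail_mean b0 C0 cf1 f1M z0).
  have fine_add (A B : \bar R) c : B \is a fin_num -> A = (c%:E + B)%E -> fine A = c + fine B.
    by move=> fB ->; rewrite fineD.
  rewrite /exp_tilt -tm//; exact: (esym (fine_add _ _ _ fn hm)).
have [iA EA] := abel_passage_mean b0 cf1 f1M t0.
have cE2 s : 0 < s < t -> caputo_half_integrand (exp_tilt gamma u) t s =
    (t - s) `^ (- 2^-1) * D s.
  by move=> /andP[s0 _]; rewrite /caputo_half_integrand (has_derivative_derive1 (dv _ s0)).
split.
  split; first by move=> s /andP[s0 _]; exact: has_derivative_derivable (dv _ s0).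
  by apply: eq_integrable iA => // s; rewrite mem_setE in_itv/= => st; rewrite cE2.
have s20 : 0 < Num.sqrt 2 :> R by rewrite sqrtr_gt0.
have p0 := @sqrt_pi_gt0 R.
have cap : caputo_half (exp_tilt gamma u) t =
    (Num.sqrt 2)^-1 * \int[mu]_(r in pos) (f1 r * heat t r).
  rewrite /caputo_half Gamma_half.
  have -> : \int[mu]_(s in `]0, t[) caputo_half_integrand (exp_tilt gamma u) t s =
      Num.sqrt (pi / 2) * \int[mu]_(r in pos) (f1 r * heat t r).
    transitivity (\int[mu]_(s in `]0, t[) ((t - s) `^ (- 2^-1) * D s)).
      by apply: eq_Rintegral => s; rewrite mem_setE in_itv/=; exact: cE2.
    have fn := integrable_fin_num mpos (integrable_heat_mean cf1 f1M t0).
    have fine_mul (A B : \bar R) c : B \is a fin_num -> A = (c%:E * B)%E -> fine A = c * fine B.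
      by move=> fB ->; rewrite fineM.
    exact: (fine_mul _ _ _ fn EA).
  by rewrite sqrtrM ?pi_ge0// sqrtrV//; field; rewrite !gt_eqF.
rewrite /IG_operator cap.
pose E := expR (gamma ^+ 2 * t / 2).
have -> : \int[mu]_(r in pos) (f1 r * heat t r) =
    gamma * (E * u t) + delta^-1 * (E * mean_cdf psi chi t) -
    gamma * phi 0 * (2 * E * ntail (gamma * Num.sqrt t)).
  have [jf If] := transform_mean t0 cphi cpsi dphi psiM cJ J0 (fun x _ => dJ x).
  have [jT IT] := transform_mean t0 cpsi cchi dpsi chiM cJp Jp0 dJp.
  have We := integral_expR_heat (- gamma) 0 t0.
  have je : mu.-integrable pos (fun r => (expR (- gamma * r) * heat t r)%:E).
    apply: (@ge0_integrable_fin _ _ (measurableTypeR R) mu pos) We => //.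
      apply: measurable_funTS; apply: continuous_measurable_fun => r.
      by apply: cvgM; [exact: cE|exact: continuous_heat].
    by move=> r _; rewrite mulr_ge0 ?expR_ge0 ?heat_ge0.
  have Ie : \int[mu]_(r in pos) (expR (- gamma * r) * heat t r) =
      2 * E * ntail (gamma * Num.sqrt t).
    by have := congr1 fine We; rewrite sqrrN mul0r mulNr opprK add0r.
  have jf' := integrableZl mpos gamma jf.
  have jT' := integrableZl mpos delta^-1 jT.
  have je' := integrableZl mpos (gamma * phi 0) je.
  have e1 : \int[mu]_(r in pos) (gamma * (f r * heat t r)) = gamma * (E * u t).
    by rewrite uE// -If RintegralZl.
  have e2' : \int[mu]_(r in pos) (delta^-1 * (transform psi Jp r * heat t r)) =
      delta^-1 * (E * mean_cdf psi chi t) by rewrite -IT RintegralZl.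
  have e3 : \int[mu]_(r in pos) (gamma * phi 0 * (expR (- gamma * r) * heat t r)) =
      gamma * phi 0 * (2 * E * ntail (gamma * Num.sqrt t)) by rewrite -Ie RintegralZl.
  have jfT : mu.-integrable pos (EFin \o (fun r => gamma * (f r * heat t r) +
      delta^-1 * (transform psi Jp r * heat t r))).
    have := integrableD mpos jf' jT'.
    by apply: eq_integrable => // r _; rewrite -EFinD.
  rewrite -e1 -e2' -e3 -RintegralD// -RintegralB//.
  by apply: eq_Rintegral => r _; rewrite f1E -/f; ring.
have -> : erfc (gamma * Num.sqrt t / Num.sqrt 2) = 2 * ntail (gamma * Num.sqrt t).
  rewrite erfc_ntail ?divr_gt0 ?mulr_gt0 ?sqrtr_gt0//; congr (_ * ntail _).
  by field; rewrite gt_eqF.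
have EE : expR (- (gamma ^+ 2 * t / 2)) * E = 1 by rewrite -expRD addNr expR0.
move: (u t) (mean_cdf _ _ _) (ntail _) (phi 0) => U V n ph.
move: (expR _) EE => em EE.
transitivity (em * E * (delta * gamma * U + V - delta * gamma * (2 * n) * ph)).
  by field; rewrite !gt_eqF.
by rewrite EE mul1r.
Unshelve. all: by end_near. Qed.

End transform.

(** * Determinacy by moments *)

Section bernstein.
Context {R : realType}.
Implicit Types (h g : nat -> R) (u c L M : R).

(** The mean of [h] under the binomial distribution with parameters [n] and [u],
    conditioned on the first trial: means and variances then follow by
    induction. *)
Fixpoint bernstein n h : {poly R} :=
  if n is m.+1 then 'X * bernstein m (fun k => h k.+1) + (1 - 'X) * bernstein m h
  else (h 0%N)%:P.

Lemma bernsteinS n h u : (bernstein n.+1 h).[u] =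
  u * (bernstein n (fun k => h k.+1)).[u] + (1 - u) * (bernstein n h).[u].
Proof. by rewrite /= !hornerE. Qed.

Lemma bernstein_cst n c u : (bernstein n (fun=> c)).[u] = c.
Proof.
elim: n => [|n IH]; first by rewrite /= hornerC.
by rewrite bernsteinS IH; ring.
Qed.

Lemma bernsteinD n h g u :
  (bernstein n (fun k => h k + g k)).[u] = (bernstein n h).[u] + (bernstein n g).[u].
Proof.
elim: n h g => [|n IH] h g; first by rewrite /= !hornerC.
by rewrite !bernsteinS !IH; ring.
Qed.

Lemma bernsteinZ n c h u :
  (bernstein n (fun k => c * h k)).[u] = c * (bernstein n h).[u].
Proof.
elim: n h => [|n IH] h; first by rewrite /= !hornerC.
by rewrite !bernsteinS !IH; ring.
Qed.

Lemma bernstein_le n h g u : 0 <= u <= 1 -> (forall k, h k <= g k) ->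
  (bernstein n h).[u] <= (bernstein n g).[u].
Proof.
move=> /andP[u0 u1]; elim: n h g => [|n IH] h g hg; first by rewrite /= !hornerC.
by rewrite !bernsteinS lerD// ler_wpM2l ?subr_ge0// IH.
Qed.

Lemma bernstein_norm n h u : 0 <= u <= 1 ->
  `|(bernstein n h).[u]| <= (bernstein n (fun k => `|h k|)).[u].
Proof.
move=> u01; rewrite ler_norml -mulN1r -bernsteinZ; apply/andP; split;
  apply: bernstein_le => // k; rewrite ?mulN1r ?ler_norm//.
by rewrite lerNl -normrN ler_norm.
Qed.

Lemma bernstein_variance n c u :
  (bernstein n (fun k => (k%:R - c) ^+ 2)).[u] = n%:R * u * (1 - u) + (n%:R * u - c) ^+ 2.
Proof.
elim: n c => [|n IH] c; first by rewrite /= hornerC; ring.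
rewrite bernsteinS.
have -> : (fun k => (k.+1%:R - c) ^+ 2) = (fun k : nat => (k%:R - (c - 1)) ^+ 2).
  by apply/funext => k; rewrite -natr1; ring.
by rewrite !IH -natr1; ring.
Qed.

(** Bernstein's proof of the Weierstrass theorem for a Lipschitz function: its
    increment is bounded by a parabola, whose binomial mean is the variance. *)
Lemma bernstein_cvg (g : R -> R) L u : 0 <= L -> 0 <= u <= 1 ->
  (forall x y, `|g x - g y| <= L * `|x - y|) ->
  (bernstein n.+1 (fun k => g (k%:R / n.+1%:R))).[u] @[n --> \oo] --> g u.
Proof.
move=> L0 u01 gL; apply/cvgrPdist_le => e e0.
pose a := e / (L + 1).
have L1 : 0 < L + 1 by rewrite ltr_wpDl.
have a0 : 0 < a by rewrite divr_gt0.
near=> n.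
have n0 : 0 < n.+1%:R :> R by [].
have na : a ^- 2 <= n.+1%:R.
  near: n; have := @nbhs_infty_ger R (a ^- 2); apply: filterS => n h.
  by rewrite (le_trans h)// ler_nat.
rewrite distrC -(bernstein_cst n.+1 (g u) u) -[X in _ - X]mul1r -mulNr -bernsteinZ -bernsteinD.
apply: (le_trans (bernstein_norm _ _ u01)).
(* The arithmetic-geometric inequality, balanced at distance [a]. *)
apply: (@le_trans _ _ (bernstein n.+1 (fun k => L / 2 * (a + (n.+1%:R ^+ 2 * a)^-1 * (k%:R - n.+1%:R * u) ^+ 2))).[u]).
  apply: bernstein_le => // k; rewrite mulN1r (le_trans (gL _ _))//.
  rewrite -mulrA ler_wpM2l//.
  set x := k%:R / n.+1%:R - u.
  have -> : (n.+1%:R ^+ 2 * a)^-1 * (k%:R - n.+1%:R * u) ^+ 2 = a^-1 * x ^+ 2.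
    by rewrite /x; field; rewrite !gt_eqF.
  have h : 2 * `|x| * a <= a ^+ 2 + x ^+ 2.
    by rewrite -[x ^+ 2]real_normK ?num_real//; have := sqr_ge0 (a - `|x|); lra.
  rewrite -(ler_pM2r a0) -(ler_pM2l (ltr0Sn R 1)).
  have -> : 2 * (2^-1 * (a + a^-1 * x ^+ 2) * a) = a ^+ 2 + x ^+ 2.
    by field; rewrite gt_eqF.
  by rewrite mulrA.
rewrite bernsteinZ bernsteinD bernstein_cst bernsteinZ bernstein_variance subrr.
have -> : (n.+1%:R ^+ 2 * a)^-1 * (n.+1%:R * u * (1 - u) + 0 ^+ 2) = u * (1 - u) / (n.+1%:R * a).
  by field; rewrite !gt_eqF.
have h1 : u * (1 - u) / (n.+1%:R * a) <= a.
  have na0 : 0 < n.+1%:R * a by exact: mulr_gt0.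
  rewrite ler_pdivrMr//.
  have : a ^- 2 * a ^+ 2 <= n.+1%:R * a ^+ 2 by rewrite ler_wpM2r ?sqr_ge0.
  rewrite mulVf ?gt_eqF ?exprn_gt0// => h2.
  have : u * (1 - u) <= 1 by case/andP: u01 => ? ?; nra.
  by rewrite mulrCA -expr2; lra.
apply: (@le_trans _ _ (L / 2 * (a + a))).
  by rewrite ler_wpM2l ?divr_ge0// lerD2l.
have -> : L / 2 * (a + a) = L * a by field.
rewrite /a mulrCA ler_piMr ?(ltW e0)// ler_pdivrMr// mul1r lerDl//.
Unshelve. all: by end_near. Qed.

End bernstein.

Section real_dominated_convergence.
Context {d : measure_display} {T : measurableType d} {R : realType}.
Variables (m : {measure set T -> \bar R}) (D : set T) (mD : measurable D).
Variables (f_ : nat -> T -> R) (f g : T -> R).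
Hypothesis mf_ : forall n, measurable_fun D (f_ n).
Hypothesis mf : measurable_fun D f.
Hypothesis f_f : forall z, D z -> f_ n z @[n --> \oo] --> f z.
Hypothesis ig : m.-integrable D (EFin \o g).
Hypothesis f_g : forall n z, D z -> `|f_ n z| <= g z.

Lemma Rintegral_dominated_cvg :
  m.-integrable D (EFin \o f) /\
  \int[m]_(z in D) f_ n z @[n --> \oo] --> \int[m]_(z in D) f z.
Proof.
have [i1 _ c1] : [/\ m.-integrable D (EFin \o f),
    [sequence \int[m]_(x in D) `|(EFin \o f_ n) x - (EFin \o f) x|]_n @ \oo --> 0 &
    [sequence \int[m]_(x in D) ((EFin \o f_ n) x)]_n @ \oo --> \int[m]_(x in D) ((EFin \o f) x)]%E.
  apply: (@dominated_convergence _ _ _ m D mD _ _ (EFin \o g)) => //.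
  - by move=> n; exact/measurable_EFinP.
  - exact/measurable_EFinP.
  - by apply/aeW => z Dz; apply: cvg_EFin; [exact: nearW|exact: f_f].
  - by apply/aeW => z n Dz; rewrite lee_fin; exact: f_g.
split => //; apply: fine_cvg; rewrite fineK//.
exact: integrable_fin_num.
Qed.

End real_dominated_convergence.

Section moments.
Context {d : measure_display} {T : measurableType d} {R : realType}.
Variables (m : {measure set T -> \bar R}) (D : set T) (mD : measurable D).
Variables (w U : T -> R).
Hypotheses (iw : m.-integrable D (EFin \o w)) (w0 : forall z, D z -> 0 <= w z).
Hypotheses (mU : measurable_fun D U) (U01 : forall z, D z -> 0 <= U z <= 1).

(** The weight allows one notion for the mean under a probability and for the
    mean against a density. *)
Definition weighted_mean (f : R -> R) : R := \int[m]_(z in D) (w z * f (U z)).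

Let mw : measurable_fun D w.
Proof. by have /integrableP[/measurable_EFinP] := iw. Qed.

Let iwf (f : R -> R) (M : R) : measurable_fun setT f ->
  (forall u, 0 <= u <= 1 -> `|f u| <= M) ->
  m.-integrable D (EFin \o (fun z => w z * f (U z))).
Proof.
move=> mf fM; have := integrableZl mD M iw; apply: le_integrable => //.
  apply/measurable_EFinP/measurable_funM => //.
  exact: measurableT_comp.
move=> z Dz; rewrite lee_fin [leLHS]normrM [leRHS]normrM !(ger0_norm (w0 Dz)) mulrC.
by rewrite ler_wpM2r ?w0// (le_trans (fM _ (U01 Dz)))// ler_norm.
Qed.

Lemma integrable_weighted_poly (p : {poly R}) :
  m.-integrable D (EFin \o (fun z => w z * p.[U z])).
Proof.
apply: (@iwf _ (\sum_(i < size p) `|p`_i|)).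
  by apply: continuous_measurable_fun; exact: continuous_horner.
move=> u /andP[u0 u1]; rewrite horner_coef (le_trans (ler_norm_sum _ _ _))//.
apply: ler_sum => i _; rewrite normrM ler_piMr// ger0_norm ?exprn_ge0//.
by rewrite exprn_ile1.
Qed.

Lemma weighted_mean_poly j c (p : {poly R}) :
  weighted_mean (fun u => ('X^j * (p * 'X + c%:P)).[u]) =
  weighted_mean (fun u => ('X^(j.+1) * p).[u]) + c * weighted_mean (fun u => ('X^j).[u]).
Proof.
rewrite /weighted_mean -RintegralZl//; last exact: integrable_weighted_poly.
rewrite -RintegralD//; last 2 first.
- exact: integrable_weighted_poly.
- have := integrable_weighted_poly (c *: 'X^j); apply: eq_integrable => // z _ /=.
  by rewrite hornerZ; congr EFin; ring.
by apply: eq_Rintegral => z _; rewrite !hornerM !hornerXn hornerD hornerMX hornerC exprS; ring.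
Qed.

Lemma weighted_mean_bernstein (g : R -> R) L M : 0 <= L ->
  (forall x y, `|g x - g y| <= L * `|x - y|) -> (forall x, `|g x| <= M) ->
  weighted_mean (fun u => (bernstein n.+1 (fun k => g (k%:R / n.+1%:R))).[u])
    @[n --> \oo] --> weighted_mean g.
Proof.
move=> L0 gL gM.
have cg : continuous g.
  move=> x; apply/cvgrPdist_le => e e0.
  near=> y; rewrite (le_trans (gL _ _))//.
  have : `|x - y| <= e / (L + 1).
    near: y; apply: cvgr_dist_le; first exact: cvg_id.
    by rewrite divr_gt0// ltr_wpDl.
  rewrite ler_pdivlMr ?ltr_wpDl// => h; apply: le_trans h.
  by rewrite mulrC ler_wpM2l// lerDl.
have mg : measurable_fun setT g by exact: continuous_measurable_fun.
have [|||||//] := @Rintegral_dominated_cvg _ _ _ m D mD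
  (fun n z => w z * (bernstein n.+1 (fun k => g (k%:R / n.+1%:R))).[U z])
  (fun z => w z * g (U z)) (fun z => M * w z).
- by move=> n; have /integrableP[/measurable_EFinP] := integrable_weighted_poly (bernstein n.+1 (fun k => g (k%:R / n.+1%:R))).
- by apply: measurable_funM => //; exact: measurableT_comp.
- by move=> z Dz; apply: cvgMr; apply: bernstein_cvg gL => //; exact: U01.
- exact: (integrableZl mD M iw).
- move=> n z Dz; rewrite normrM (ger0_norm (w0 Dz)) mulrC ler_wpM2r ?w0//.
  rewrite (le_trans (bernstein_norm _ _ (U01 Dz)))// -[leRHS](bernstein_cst n.+1 M (U z)).
  by apply: bernstein_le => //; exact: U01.
Unshelve. all: by end_near. Qed.

End moments.

Section moment_determinacy.
Context {R : realType}.
Context {d1 : measure_display} {T1 : measurableType d1} {m1 : {measure set T1 -> \bar R}}.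
Context {d2 : measure_display} {T2 : measurableType d2} {m2 : {measure set T2 -> \bar R}}.
Variables (D1 : set T1) (w1 U1 : T1 -> R) (D2 : set T2) (w2 U2 : T2 -> R).
Hypotheses (mD1 : measurable D1) (mD2 : measurable D2).
Hypotheses (iw1 : m1.-integrable D1 (EFin \o w1)) (w10 : forall z, D1 z -> 0 <= w1 z).
Hypotheses (iw2 : m2.-integrable D2 (EFin \o w2)) (w20 : forall z, D2 z -> 0 <= w2 z).
Hypotheses (mU1 : measurable_fun D1 U1) (U101 : forall z, D1 z -> 0 <= U1 z <= 1).
Hypotheses (mU2 : measurable_fun D2 U2) (U201 : forall z, D2 z -> 0 <= U2 z <= 1).
Hypothesis moments_eq : forall j,
  weighted_mean m1 D1 w1 U1 (fun u => u ^+ j) =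
  weighted_mean m2 D2 w2 U2 (fun u => u ^+ j).

(** A bounded random variable is determined by its moments, by uniform
    polynomial approximation. *)
Lemma moment_determinacy (g : R -> R) L M : 0 <= L ->
  (forall x y, `|g x - g y| <= L * `|x - y|) -> (forall x, `|g x| <= M) ->
  weighted_mean m1 D1 w1 U1 g = weighted_mean m2 D2 w2 U2 g.
Proof.
move=> L0 gL gM.
have poly_eq (p : {poly R}) j :
    weighted_mean m1 D1 w1 U1 (fun u => ('X^j * p).[u]) =
    weighted_mean m2 D2 w2 U2 (fun u => ('X^j * p).[u]).
  elim/poly_ind: p j => [|p c IH] j.
    by rewrite /weighted_mean /Rintegral !integral0_eq// => z _; rewrite mulr0 horner0 mulr0.
  rewrite !weighted_mean_poly// IH; congr (_ + _ * _).
  have := moments_eq j; rewrite /weighted_mean.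
  by under eq_Rintegral do rewrite -hornerXn; under [RHS]eq_Rintegral do rewrite -hornerXn.
have c1 := weighted_mean_bernstein mD1 iw1 w10 mU1 U101 L0 gL gM.
have c2 := weighted_mean_bernstein mD2 iw2 w20 mU2 U201 L0 gL gM.
apply: cvg_unique c1 _ => //.
rewrite (_ : (fun n => _) = (fun n => weighted_mean m2 D2 w2 U2
  (fun u => (bernstein n.+1 (fun k => g (k%:R / n.+1%:R))).[u])))//.
apply/funext => n; have := poly_eq (bernstein n.+1 (fun k => g (k%:R / n.+1%:R))) 0%N.
by rewrite expr0 mul1r.
Qed.

End moment_determinacy.

(** * The law of the inverse Gaussian subordinator *)

Section inverse_gaussian_law.
Context {R : realType}.
Notation mu := (@lebesgue_measure R).
Implicit Types (a b g s t u x y : R).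

(** A Lipschitz approximation of the indicator of the half-line above [b]:
    moments determine means of continuous functions only. *)
Definition ramp a b u : R := Num.max 0 (Num.min 1 ((u - a) / (b - a))).

Lemma ramp_ge0 a b u : 0 <= ramp a b u.
Proof. by rewrite le_max lexx. Qed.

Lemma ramp_le1 a b u : ramp a b u <= 1.
Proof. by rewrite ge_max ler01 ge_min lexx. Qed.

Lemma ramp0 a b u : a < b -> u <= a -> ramp a b u = 0.
Proof.
move=> ab ua; rewrite /ramp; apply/max_idPl; rewrite ge_min; apply/orP; right.
by rewrite pmulr_lle0 ?invr_gt0 ?subr_gt0// subr_le0.
Qed.

Lemma ramp1 a b u : a < b -> b <= u -> ramp a b u = 1.
Proof.
move=> ab bu; rewrite /ramp min_l ?max_r//.
by rewrite ler_pdivlMr ?subr_gt0// mul1r lerD2r.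
Qed.

Lemma ramp_lipschitz a b u v : a < b ->
  `|ramp a b u - ramp a b v| <= (b - a)^-1 * `|u - v|.
Proof.
move=> ab; have ab0 : 0 < (b - a)^-1 by rewrite invr_gt0 subr_gt0.
have -> : (b - a)^-1 * `|u - v| = `|(u - a) / (b - a) - (v - a) / (b - a)|.
  rewrite -mulrBl; have -> : u - a - (v - a) = u - v by ring.
  by rewrite normrM (gtr0_norm ab0) mulrC.
rewrite /ramp; move: (_ / _) (_ / _) => x y.
have clip (p q : R) : Num.max 0 (Num.min 1 p) <= Num.max 0 (Num.min 1 q) + `|p - q|.
  rewrite ge_max addr_ge0 ?le_max ?lexx//=.
  have : Num.min 1 p <= Num.min 1 q + `|p - q|.
    rewrite -lerBlDr le_min !lerBlDr !ge_min; apply/andP; split; apply/orP.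
      by left; rewrite lerDl.
    by right; rewrite -lerBlDl ler_norm.
  by move=> /le_trans; apply; rewrite lerD2r le_max lexx orbT.
by rewrite ler_distl lerBlDr clip distrC clip.
Qed.

Lemma measurable_ramp a b : measurable_fun setT (ramp a b).
Proof.
apply: measurable_maxr => //; apply: measurable_minr => //.
by apply: measurable_funM => //; exact: measurable_funB.
Qed.

Lemma cvg_at_right_ge_limit (F : R -> R) t k : {for t, continuous F} ->
  (forall t', t < t' -> k <= F t') -> k <= F t.
Proof.
move=> cF kF; have : F x @[x --> t^'+] --> F t by exact: cvg_at_right_filter.
move/cvg_lim => <- //; apply: limr_ge.
  by apply/cvg_ex; exists (F t); exact: cvg_at_right_filter.
by near=> t'; apply: kF; near: t'; exact: nbhs_right_gt.
Unshelve. all: by end_near. Qed.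

Lemma cvg_at_right_le_limit (F : R -> R) t k : {for t, continuous F} ->
  (forall t', t < t' -> F t' <= k) -> F t <= k.
Proof.
move=> cF kF; rewrite -lerN2.
apply: (@cvg_at_right_ge_limit (fun x => - F x)) => [|t' /kF]; last by rewrite lerN2.
exact: cvgN.
Qed.

Lemma cvg_at_left_le_limit (F : R -> R) t k : {for t, continuous F} ->
  (forall s, s < t -> 0 < s -> F s <= k) -> 0 < t -> F t <= k.
Proof.
move=> cF kF t0; have : F x @[x --> t^'-] --> F t by exact: cvg_at_left_filter.
move/cvg_lim => <- //; apply: limr_le.
  by apply/cvg_ex; exists (F t); exact: cvg_at_left_filter.
near=> s; apply: kF; near: s; [exact: nbhs_left_lt|exact: nbhs_left_gt].
Unshelve. all: by end_near. Qed.

Context {d : measure_display} {T : measurableType d} (P : probability T R).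
Variables (a g : R) (Y : T -> R).
Hypotheses (a0 : 0 < a) (g0 : 0 < g).
Hypotheses (mY : measurable_fun setT Y) (Y0 : {ae P, forall z, 0 <= Y z}).
Hypothesis laplaceY : forall s, 0 < s ->
  ('E_P[(fun z => expR (- s * Y z))] = (expR (- a * (Num.sqrt (2 * s + g ^+ 2) - g)))%:E)%E.

Let pos : set R := `]0%R, +oo[%classic.

Let mpos : measurable (pos : set (measurableTypeR R)).
Proof. exact: measurable_itv. Qed.

(* In the variable [expR (- y)], which is bounded, the Laplace transform at the
   integers is the sequence of moments.  The maximum keeps [U1] below one off
   the null set where [Y] is negative. *)
Let U1 (z : T) : R := expR (- Num.max (Y z) 0).
Let U2 (y : measurableTypeR R) : R := expR (- y).

Let mU1 : measurable_fun setT U1.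
Proof.
apply: measurableT_comp => //; apply: measurableT_comp => //.
exact: measurable_maxr.
Qed.

Let U101 z : setT z -> 0 <= U1 z <= 1.
Proof.
by move=> _; rewrite expR_ge0 -expR0 ler_expR oppr_le0 le_max lexx orbT.
Qed.

Let mU2 : measurable_fun pos U2.
Proof.
by apply: measurable_funTS; apply: measurableT_comp => //; exact: measurableT_comp.
Qed.

Let U201 y : pos y -> 0 <= U2 y <= 1.
Proof.
by rewrite /pos/= in_itv/= andbT => y0; rewrite expR_ge0 -expR0 ler_expR oppr_le0 ltW.
Qed.

Let iw1 : P.-integrable setT (EFin \o (cst 1 : T -> R)).
Proof. exact: finite_measure_integrable_cst. Qed.

Let iw2 : mu.-integrable pos (EFin \o (IGpdf a g : measurableTypeR R -> R)).
Proof.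
apply: (@ge0_integrable_fin _ _ (measurableTypeR R) mu pos) (integral_IGpdfy a0 g0) => //.
- exact: measurable_IGpdf.
- by move=> y; rewrite /pos/= in_itv/= andbT => y0; exact/IGpdf_ge0/ltW.
Qed.

Let w20 y : pos y -> 0 <= IGpdf a g y.
Proof. by rewrite /pos/= in_itv/= andbT => y0; exact/IGpdf_ge0/ltW. Qed.

Let moments_eq j :
  weighted_mean P setT (cst 1) U1 (fun u => u ^+ j) =
  weighted_mean mu pos (IGpdf a g) U2 (fun u => u ^+ j).
Proof.
case: j => [|j].
  rewrite /weighted_mean.
  under eq_Rintegral do rewrite expr0 mulr1; under [RHS]eq_Rintegral do rewrite expr0 mulr1.
  by rewrite [RHS]/Rintegral integral_IGpdfy// Rintegral_cst// mul1r [X in fine X]probability_setT.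
rewrite /weighted_mean /Rintegral; congr fine.
have j0 : 0 < j.+1%:R :> R by [].
transitivity (expR (- a * (Num.sqrt (2 * j.+1%:R + g ^+ 2) - g)))%:E.
  rewrite -laplaceY// unlock; apply: ae_eq_integral => //.
  - apply/measurable_EFinP; apply: measurable_funM => //; exact: measurable_funX.
  - apply/measurable_EFinP; apply: measurableT_comp => //; exact: measurable_funM.
  - move: Y0; apply: filterS => z Yz _; congr EFin.
    by rewrite mul1r /U1 max_l// -expRM_natl mulNr mulrN.
rewrite -IG_laplace ?(ltW j0)//; apply: eq_integral => y _.
by rewrite /U2 -expRM_natl mulrC mulNr mulrN.
Qed.

Let ramp_eq b c : b < c ->
  weighted_mean P setT (cst 1) U1 (ramp b c) = weighted_mean mu pos (IGpdf a g) U2 (ramp b c).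
Proof.
move=> bc; apply: (moment_determinacy measurableT mpos iw1 _ iw2 w20 mU1 U101 mU2 U201 moments_eq
  (L := (c - b)^-1) (M := 1)) => //.
- by rewrite invr_ge0 subr_ge0 ltW.
- by move=> x y; exact: ramp_lipschitz.
- by move=> x; rewrite ger0_norm ?ramp_ge0 ?ramp_le1.
Qed.

Let ramp_eqE b c : b < c ->
  (\int[P]_z (ramp b c (U1 z))%:E = \int[mu]_(y in pos) (IGpdf a g y * ramp b c (U2 y))%:E)%E.
Proof.
move=> bc; have := ramp_eq bc; rewrite /weighted_mean => e.
have mr (k : R -> R) : measurable_fun setT k -> measurable_fun setT (fun y => ramp b c (k y)).
  by move=> mk; apply: measurableT_comp => //; exact: measurable_ramp.
have i1 : P.-integrable setT (fun z => (cst 1 z * ramp b c (U1 z))%:E).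
  apply: le_integrable iw1 => //.
    apply/measurable_EFinP; apply: measurable_funM => //.
    by apply: measurableT_comp => //; exact: measurable_ramp.
  by move=> z _; rewrite lee_fin mul1r normr1 ger0_norm ?ramp_ge0 ?ramp_le1.
have i2 : mu.-integrable pos (fun y => (IGpdf a g y * ramp b c (U2 y))%:E).
  apply: le_integrable iw2 => //.
    apply/measurable_EFinP; apply: measurable_funM.
      exact: measurable_IGpdf.
    by apply: measurableT_comp => //; exact: measurable_ramp.
  move=> y /w20 p0; rewrite lee_fin [leRHS]ger0_norm// ger0_norm.
    by rewrite ler_piMr ?ramp_le1.
  by apply: mulr_ge0 => //; exact: ramp_ge0.
have f1 := integrable_fin_num measurableT i1.
have f2 := integrable_fin_num mpos i2.
rewrite -(fineK f2) -[X in _ = X%:E]e fineK//.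
by apply: eq_integral => z _; rewrite mul1r.
Qed.

Let U1_le t z : 0 <= t -> (Y z <= t) = (expR (- t) <= U1 z).
Proof. by move=> t0; rewrite ler_expR lerN2 ge_max t0 andbT. Qed.

Let mYle t : measurable [set z | Y z <= t].
Proof.
rewrite (_ : [set z | Y z <= t] = Y @^-1` `]-oo, t]%classic).
  by rewrite -[X in measurable X]setTI; apply: mY.
by apply/seteqP; split => z /=; rewrite in_itv.
Qed.

Let probE (A : set T) : measurable A -> P A = (\int[P]_z (\1_A z)%:E)%E.
Proof. by move=> mA; rewrite integral_indic// setIT. Qed.

Let mramp b c : measurable_fun pos (fun y => (IGpdf a g y * ramp b c (U2 y))%:E).
Proof.
apply/measurable_EFinP; apply: measurable_funM; first exact: measurable_IGpdf.
by apply: measurableT_comp => //; exact: measurable_ramp.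
Qed.

Let pramp_ge0 b c y : pos y -> (0 <= (IGpdf a g y * ramp b c (U2 y))%:E)%E.
Proof. by move=> /w20 p0; rewrite lee_fin; apply: mulr_ge0 => //; exact: ramp_ge0. Qed.

Let mpdf t :
  measurable_fun setT ((fun y : measurableTypeR R => (IGpdf a g y)%:E) \_ `]0%R, t[%classic).
Proof.
have mi : measurable (`]0%R, t[%classic : set (measurableTypeR R)) by exact: measurable_itv.
apply: (measurable_restrictT _ mi).1.
apply/measurable_EFinP; apply: measurable_funS (@measurable_IGpdf _ a g) => //.
by move=> y /=; rewrite !in_itv/= andbT => /andP[].
Qed.

Let cdf_ub t t' : 0 < t -> t < t' -> (P [set z | (Y z <= t)%R] <= (IGcdf a g t')%:E)%E.
Proof.
move=> t0 tt'; have bc : expR (- t') < expR (- t) by rewrite ltr_expR ltrN2.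
apply: (@le_trans _ _ (\int[P]_z (ramp (expR (- t')) (expR (- t)) (U1 z))%:E)%E).
  rewrite probE//; apply: ge0_le_integral => //.
  - exact/measurable_EFinP/measurable_indic.
  - by apply/measurable_EFinP; apply: measurableT_comp => //; exact: measurable_ramp.
  - move=> z _; rewrite lee_fin indicE; case: (boolP (z \in _)) => /=; last by rewrite ramp_ge0.
    by rewrite inE/= (U1_le _ (ltW t0)) => h; rewrite ramp1.
rewrite ramp_eqE// -(integral_IGpdf a0 g (lt_trans t0 tt')) integral_mkcond [leRHS]integral_mkcond.
apply: ge0_le_integral => //.
- by move=> y _; rewrite patchE; case: ifPn => // /[!inE]; exact: pramp_ge0.
- exact: (measurable_restrictT _ mpos).1 (mramp _ _).
- exact: mpdf.
- move=> y _; rewrite !patchE !mem_setE !in_itv/= andbT; case: ifPn => y0 /=; last first.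
    by [].
  case: ifPn => yt.
    rewrite lee_fin ler_piMr ?ramp_le1//; apply: w20.
    by rewrite /pos/= in_itv/= y0.
  by rewrite ramp0 ?mulr0// ler_expR lerN2 leNgt.
Qed.

Let cdf_lb s t : 0 < s -> s < t -> ((IGcdf a g s)%:E <= P [set z | (Y z <= t)%R])%E.
Proof.
move=> s0 st; have bc : expR (- t) < expR (- s) by rewrite ltr_expR ltrN2.
apply: (@le_trans _ _ (\int[P]_z (ramp (expR (- t)) (expR (- s)) (U1 z))%:E)%E); last first.
  rewrite probE//; apply: ge0_le_integral => //.
  - by move=> z _; rewrite lee_fin ramp_ge0.
  - by apply/measurable_EFinP; apply: measurableT_comp => //; exact: measurable_ramp.
  - exact/measurable_EFinP/measurable_indic.
  - move=> z _; rewrite lee_fin indicE; case: (boolP (z \in _)) => /=; first by rewrite ramp_le1.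
    rewrite notin_setE/= => /negP; rewrite (U1_le _ (ltW (lt_trans s0 st))) -ltNge => h.
    by rewrite (ramp0 bc (ltW h)).
rewrite ramp_eqE// -(integral_IGpdf a0 g s0) integral_mkcond [leRHS]integral_mkcond.
apply: ge0_le_integral => //.
- move=> y _; rewrite patchE; case: ifPn => // /[!inE] /=; rewrite in_itv/= => /andP[y0 _].
  by rewrite lee_fin; exact/IGpdf_ge0/ltW.
- exact: mpdf.
- exact: (measurable_restrictT _ mpos).1 (mramp _ _).
- move=> y _; rewrite !patchE !mem_setE !in_itv/= andbT; case: ifPn => [/andP[y0 ys]|_].
    by rewrite y0 ramp1 ?mulr1// ler_expR lerN2 ltW.
  by case: ifPn => // y0; apply: pramp_ge0; rewrite /pos/= in_itv/= y0.
Qed.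

(** [IG_laplace] and the hypothesis say that the two laws have the same moments
    after the change of variable [expR (- y)].  Ramps on both sides of
    [expR (- t)] then squeeze one distribution function between values of the
    other, which is continuous. *)
Lemma IG_law t : 0 < t -> P [set z | Y z <= t] = (IGcdf a g t)%:E.
Proof.
move=> t0; have fP : P [set z | Y z <= t] \is a fin_num by exact: fin_num_measure.
have cF : {for t, continuous (IGcdf a g)}.
  exact: has_derivative_continuous (has_derivative_IGcdf a g t0).
apply/eqP; rewrite eq_le -(fineK fP) !lee_fin; apply/andP; split.
  apply: cvg_at_right_ge_limit cF _ => t' tt'.
  by rewrite -lee_fin fineK// cdf_ub.
apply: cvg_at_left_le_limit cF _ t0 => s st s0.
by rewrite -lee_fin fineK// cdf_lb.
Qed.

End inverse_gaussian_law.

(** * The hitting time of the inverse Gaussian subordinator *)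

Section hitting_time.
Context {R : realType} {d : measure_display} {T : measurableType d} (P : probability T R).
Notation mu := (@lebesgue_measure R).
Variables (delta gamma : R) (Y : R -> T -> R).
Hypotheses (d0 : 0 < delta) (g0 : 0 < gamma) (hY : is_IG_subordinator P delta gamma Y).
Implicit Types (x t s c : R) (z : T).

Local Notation H := (first_hitting_time Y).
Let pos : set R := `]0%R, +oo[%classic.

Let mpos : measurable (pos : set (measurableTypeR R)).
Proof. exact: measurable_itv. Qed.

Let subY := IG_subordinator hY.
Let ndY := subordinator_nondecreasing subY.

Lemma IG_marginal x t : 0 < x -> 0 < t ->
  P [set z | Y x z <= t] = (IGcdf (delta * x) gamma t)%:E.
Proof.
move=> x0 t0; apply: IG_law => //.
- exact: mulr_gt0.
- exact/(subordinator_measurable subY)/ltW.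
- move: (subordinator_start subY); apply: filterS => z Yz0.
  by rewrite -Yz0; apply: ndY => //; exact: ltW.
- move=> s s0; rewrite (IG_Laplace hY s0 (ltW x0)) /IG_Bernstein.
  by congr (expR _)%:E; ring.
Qed.

Lemma IGcdf_exp_bound t : 0 < t -> exists2 K, 0 <= K &
  forall x, 0 < x -> 0 <= IGcdf (delta * x) gamma t <= K * expR (- x).
Proof.
move=> t0; have ka0 : 0 < delta / Num.sqrt t by rewrite divr_gt0 ?sqrtr_gt0.
have [K1 K10 h1] := ntail_exp_bound 0 (- (gamma * Num.sqrt t)) ka0.
have [K2 K20 h2] := ntail_exp_bound (2 * gamma * delta) (gamma * Num.sqrt t) ka0.
exists (K1 + K2); first exact: addr_ge0.
move=> x x0; rewrite /IGcdf; apply/andP; split.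
  by rewrite addr_ge0 ?mulr_ge0 ?expR_ge0 ?ntail_ge0.
have := h1 x x0; rewrite mul0r expR0 mul1r => h1x; have h2x := h2 x x0.
have e1 : delta * x / Num.sqrt t - gamma * Num.sqrt t = delta / Num.sqrt t * x + - (gamma * Num.sqrt t) by ring.
have e2 : delta * x / Num.sqrt t + gamma * Num.sqrt t = delta / Num.sqrt t * x + gamma * Num.sqrt t by ring.
have e3 : 2 * gamma * (delta * x) = 2 * gamma * delta * x by ring.
by rewrite e1 e2 e3 [leRHS]mulrDl; exact: lerD h1x h2x.
Qed.

Lemma first_hitting_time_ge0 t z : 0 <= H t z.
Proof.
rewrite /first_hitting_time; have [->|/set0P ne] := eqVneq [set s | 0 <= s /\ t < Y s z] set0.
  by rewrite inf0.
by apply: lb_le_inf => // s [].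
Qed.

Lemma lt_first_hitting_time t x z : 0 <= x -> x < H t z -> Y x z <= t.
Proof.
move=> x0; rewrite ltNge => /negP xH; rewrite leNgt; apply/negP => tY.
by apply: xH; apply: ge_inf => //; exists 0 => s [].
Qed.

Lemma le_first_hitting_time t x s z : 0 <= s -> t < Y s z -> 0 <= x ->
  Y x z <= t -> x <= H t z.
Proof.
move=> s0 tY x0 Yt; apply: lb_le_inf; first by exists s.
move=> r [r0 tr]; rewrite leNgt; apply/negP => rx.
by move: (lt_le_trans tr (le_trans (ndY z r0 (ltW rx)) Yt)); rewrite ltxx.
Qed.

Let mY x t : 0 <= x -> measurable [set z | Y x z <= t].
Proof.
move=> x0; rewrite (_ : [set z | Y x z <= t] = Y x @^-1` `]-oo, t]%classic).
  by rewrite -[X in measurable X]setTI; apply: (subordinator_measurable subY x0).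
by apply/seteqP; split => z /=; rewrite in_itv.
Qed.

(** The paths on which the hitting time is an infimum over the empty set; by
    monotonicity the integer times suffice. *)
Definition never_exceeds t : set T := \bigcap_n [set z | Y n%:R z <= t].

Lemma measurable_never_exceeds t : measurable (never_exceeds t).
Proof. by apply: bigcapT_measurable => n; exact: mY. Qed.

Lemma exceeds t z : ~ never_exceeds t z -> exists2 s, 0 <= s & t < Y s z.
Proof.
move=> nz; apply: contrapT => h; apply: nz => n _ /=.
by rewrite leNgt; apply/negP => tY; apply: h; exists n%:R.
Qed.

Lemma never_exceeds_le t z s : never_exceeds t z -> 0 <= s -> Y s z <= t.
Proof.
move=> nz s0; apply: le_trans (nz (Num.truncn s).+1 I).
by apply: ndY => //; apply/ltW; rewrite truncnS_gt.
Qed.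

Lemma never_exceeds0 t : 0 < t -> P (never_exceeds t) = 0%E.
Proof.
move=> t0; have [K K0 hK] := IGcdf_exp_bound t0.
have hn n : (P (never_exceeds t) <= (K * expR (- n.+1%:R))%:E)%E.
  apply: (@le_trans _ _ (P [set z | Y n.+1%:R z <= t])).
    apply: le_measure; rewrite ?inE; [exact: measurable_never_exceeds|exact: mY|].
    by move=> z; exact.
  by rewrite IG_marginal// lee_fin; case/andP: (hK n.+1%:R (ltr0Sn _ n)).
apply/eqP; rewrite eq_le measure_ge0 andbT.
have fP : P (never_exceeds t) \is a fin_num.
  by apply: fin_num_measure; exact: measurable_never_exceeds.
rewrite -(fineK fP) lee_fin leNgt; apply/negP => e0.
have : K * expR (- n%:R) @[n --> \oo] --> K * 0.
  apply: cvgMr; apply: (@cvg_comp _ _ _ (fun n : nat => n%:R : R) (fun x => expR (- x)) _ +oo).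
    exact: cvgr_idn.
  exact: cvgr_expR.
rewrite mulr0 => /cvgr_lt /(_ _ e0) [n _ hn'].
have := hn n; rewrite -(fineK fP) lee_fin leNgt => /negP; apply.
by apply: hn' => /=.
Qed.

(** Monotone paths make the event [x < H t] a countable union over rational
    times. *)
Lemma measurable_first_hitting_time t : measurable_fun setT (H t).
Proof.
move=> _; apply: (measurability _ (RGenOInfty.measurableE R)) => //.
move=> /= _ [_ [x ->] <-]; rewrite setTI.
have [x0|x0] := ltP x 0.
  rewrite (_ : _ @^-1` _ = setT)//; apply/seteqP; split => z //= _.
  by rewrite in_itv/= andbT (lt_le_trans x0)// first_hitting_time_ge0.
rewrite (_ : _ @^-1` _ = (~` never_exceeds t) `&`
    \bigcup_(q : rat) (if x < ratr q then [set z | Y (ratr q) z <= t] else set0)).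
  apply: measurableI; first exact/measurableC/measurable_never_exceeds.
  apply: bigcupT_measurable_rat => q; case: ifPn => // xq.
  by apply: mY; rewrite (le_trans x0)// ltW.
apply/seteqP; split => z /=; rewrite in_itv/= andbT.
  move=> xH; split.
    move=> nz; move: xH; rewrite /first_hitting_time (_ : [set s | _] = set0).
      by rewrite inf0 ltNge x0.
    by rewrite -subset0 => s [s0]; rewrite ltNge (never_exceeds_le nz).
  have [q] := rat_in_itvoo xH; rewrite in_itv/= => /andP[xq qH].
  exists q => //; rewrite xq /=; apply: lt_first_hitting_time qH.
  by rewrite (le_trans x0)// ltW.
move=> [/exceeds[s s0 tY] [q _]]; case: ifPn => // xq /= Yq.
apply: (lt_le_trans xq); apply: (le_first_hitting_time s0 tY) => //.
by rewrite (le_trans x0)// ltW.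
Qed.

(** The hitting time inverts the path: [x < H t] implies [Y x <= t], and up to a
    null set [Y y <= t] implies [y <= H t].  The gap between the two
    implications closes by continuity of the distribution function. *)
Lemma first_hitting_time_law t x : 0 < t -> 0 < x ->
  P [set z | x < H t z] = (IGcdf (delta * x) gamma t)%:E.
Proof.
move=> t0 x0.
have mH : measurable [set z | x < H t z].
  rewrite (_ : [set z | x < H t z] = H t @^-1` `]x, +oo[%classic).
    by rewrite -[X in measurable X]setTI; apply: measurable_first_hitting_time.
  by apply/seteqP; split => z /=; rewrite in_itv/= andbT.
apply/eqP; rewrite eq_le; apply/andP; split.
  rewrite -IG_marginal//; apply: le_measure; rewrite ?inE//; first exact/mY/ltW.
  by move=> z /=; apply: lt_first_hitting_time; exact: ltW.
have fP : P [set z | x < H t z] \is a fin_num by exact: fin_num_measure.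
rewrite -(fineK fP) lee_fin.
apply: (@cvg_at_right_le_limit _ (fun y => IGcdf (delta * y) gamma t)).
  have [e he] : exists e, has_derivative (fun y => IGcdf (delta * y) gamma t) x e.
    by eexists; rewrite /IGcdf; isder.
  exact: has_derivative_continuous he.
move=> y xy; rewrite -lee_fin fineK// -(IG_marginal (lt_trans x0 xy) t0).
rewrite -[leRHS]adde0 -(never_exceeds0 t0).
have mN := measurable_never_exceeds t.
apply: le_trans (measureU2 _ _ _) => //.
apply: le_measure; rewrite ?inE.
- by apply: mY; rewrite ltW// (lt_trans x0).
- exact: measurableU.
move=> z /= Yt; have [nz|/exceeds[s s0 tY]] := pselect (never_exceeds t z); first by right.
left => /=; apply: (lt_le_trans xy); apply: (le_first_hitting_time s0 tY) => //.
by rewrite ltW// (lt_trans x0).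
Qed.

(** The layer cake formula applied to [first_hitting_time_law]. *)
Lemma mean_first_hitting_time (psi psi1 : R -> R) M t : 0 < t ->
  continuous psi -> continuous psi1 ->
  (forall x, 0 < x -> has_derivative psi x (psi1 x)) ->
  (forall x, 0 < x -> `|psi1 x| <= M) ->
  P.-integrable setT (fun z => (psi (H t z))%:E) /\
  \int[P]_z psi (H t z) = mean_cdf gamma delta psi psi1 t.
Proof.
move=> t0 cpsi cpsi1 dpsi psiM; have [K K0 hK] := IGcdf_exp_bound t0.
have hE x : 0 < x -> (\int[P]_z (if x < H t z then cst 1 z else 0)%:E =
    (IGcdf (delta * x) gamma t)%:E)%E.
  move=> x0; rewrite -first_hitting_time_law//.
  have mH : measurable [set z | x < H t z].
    rewrite (_ : [set z | x < H t z] = H t @^-1` `]x, +oo[%classic).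
      by rewrite -[X in measurable X]setTI; apply: measurable_first_hitting_time.
    by apply/seteqP; split => z /=; rewrite in_itv/= andbT.
  rewrite -[X in P X]setIT -integral_indic//; apply: eq_integral => z _.
  by rewrite indicE; case: ifPn => h; [rewrite mem_set|rewrite memNset//=; exact/negP].
have igh : mu.-integrable pos (fun x => (psi1 x * IGcdf (delta * x) gamma t)%:E).
  apply: (@integrable_expR_bound _ _ (M * K)).
    apply: measurable_funM.
      by apply: measurable_funTS; exact: continuous_measurable_fun.
    apply: measurable_funTS; apply: continuous_measurable_fun => x.
    have [e he] : exists e, has_derivative (fun y => IGcdf (delta * y) gamma t) x e.
      by eexists; rewrite /IGcdf; isder.
    exact: has_derivative_continuous he.
  move=> x x0; rewrite normrM -mulrA; case/andP: (hK x x0) => h0 hx.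
  by rewrite (ger0_norm h0) ler_pM ?psiM.
have mH := measurable_first_hitting_time t.
have H0 := first_hitting_time_ge0 t.
have i1 := integrable_layer_cake (measurable_cst _) (fun=> ler01) mH H0 cpsi1 (cpsi 0) dpsi hE igh.
have I1 := layer_cake (measurable_cst _) (fun=> ler01) mH H0 cpsi1 (cpsi 0) dpsi hE igh.
have ic : P.-integrable setT (cst (psi 0)%:E) by exact: finite_measure_integrable_cst.
have iH : P.-integrable setT (fun z => (psi (H t z))%:E).
  have := integrableD measurableT i1 ic; apply: eq_integrable => // z _.
  by rewrite -EFinD mul1r subrK.
split=> //.
rewrite /mean_cdf [X in _ + X]/Rintegral -I1 -/(Rintegral _ _ _).
have psi0E : \int[P]_z (cst (psi 0) z) = psi 0.
  by rewrite Rintegral_cst// [X in fine X]probability_setT mulr1.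
rewrite -[X in _ = X + _]psi0E -RintegralD//; apply: eq_Rintegral => z _.
by rewrite mul1r addrC subrK.
Qed.

End hitting_time.

(** * The mass function of the Poisson process of order k *)

Section PPoK_pmf.
Context {R : realType}.
Implicit Types (t lambda mu : R) (z : int) (j m l k : nat).

Lemma has_derivative_sum (I : Type) (s : seq I) (p : pred I) (f : I -> R -> R) (e : I -> R) t :
  (forall i, has_derivative (f i) t (e i)) ->
  has_derivative (fun y => \sum_(i <- s | p i) f i y) t (\sum_(i <- s | p i) e i).
Proof.
move=> fe; elim: s => [|i s ih].
  rewrite big_nil; rewrite (_ : (fun y => _) = cst 0); first exact: has_derivative_cst.
  by apply/funext => y; rewrite big_nil.
rewrite big_cons; have -> : (fun y => \sum_(i <- i :: s | p i) f i y) =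
    (fun y => if p i then f i y + \sum_(i <- s | p i) f i y else \sum_(i <- s | p i) f i y).
  by apply/funext => y; rewrite big_cons.
by case: (p i) => //; exact: has_derivativeD.
Qed.

Lemma has_derivative_exprn j t : has_derivative (fun y => y ^+ j) t (j%:R * t ^+ j.-1).
Proof.
elim: j => [|j ih].
  rewrite mul0r (_ : (fun y => _) = cst 1); first exact: has_derivative_cst.
  by apply/funext => y; rewrite expr0.
rewrite (_ : (fun y => _) = (fun y => y * y ^+ j)); last by apply/funext => y; rewrite exprS.
apply: (has_derivative_val (has_derivativeM (has_derivative_id t) ih)).
case: j {ih} => [|j]; first by rewrite expr0 !mul0r mulr0 addr0 mul1r.
by rewrite /= exprS -[X in _ = X * _]natr1; ring.
Qed.

Definition poisson_weight mu j t : R := expR (- (mu * t)) * (mu * t) ^+ j / j`!%:R.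

Lemma has_derivative_poisson_weight mu j t :
  has_derivative (poisson_weight mu j) t
    (mu * ((if j is j'.+1 then poisson_weight mu j' t else 0) - poisson_weight mu j t)).
Proof.
have dm : has_derivative (fun t => mu * t) t mu.
  by apply: has_derivative_val; first isder; rewrite mulr1.
have de : has_derivative (fun t => expR (- (mu * t))) t (- mu * expR (- (mu * t))).
  by apply: has_derivative_val; first isder; ring.
have dp : has_derivative (fun t => (mu * t) ^+ j) t (mu * (j%:R * (mu * t) ^+ j.-1)).
  apply: has_derivative_val; first exact: (has_derivative_comp (has_derivative_exprn j _) dm).
  by ring.
apply: has_derivative_val.
  by apply: has_derivativeM (has_derivative_cst _ _); exact: has_derivativeM de dp.
rewrite /poisson_weight mulr0 addr0; case: j {dp} => [|j].
  by rewrite mul0r fact0 !expr0; field.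
rewrite /= exprS factS natrM -natr1.
by field; rewrite natr1 !pnatr_eq0 -lt0n fact_gt0.
Qed.

(** The mass at [m] of a sum of [j] independent uniform steps from 1 to [k]. *)
Fixpoint step_mass k j m : R :=
  if j is j'.+1 then k%:R^-1 * \sum_(1 <= l < k.+1 | (l <= m)%N) step_mass k j' (m - l)
  else (m == 0)%:R.

Lemma step_mass_small k j m : (m < j)%N -> step_mass k j m = 0.
Proof.
elim: j m => [//|j ih] m /= mj; rewrite big_nat_cond big1 ?mulr0// => l /andP[/andP[l1 lk] lm].
by rewrite ih//; lia.
Qed.

(** Steps are at least 1, so that [m] is reached in at most [m] steps and the
    mixture over the number of steps is a finite sum.  Extending it by zero to
    negative integers makes the equation below uniform in [z]. *)
Definition PPoK_pmf k lambda z t : R :=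
  if z is Posz m then
    \sum_(j < m.+1) poisson_weight (k%:R * lambda) j t * step_mass k j m
  else 0.

Lemma PPoK_pmf_widen k lambda m n t : (m < n)%N ->
  \sum_(j < n) poisson_weight (k%:R * lambda) j t * step_mass k j m =
  PPoK_pmf k lambda m t.
Proof.
move=> mn; rewrite /PPoK_pmf.
rewrite [RHS](big_ord_widen n (fun j => poisson_weight (k%:R * lambda) j t * step_mass k j m))//.
rewrite [RHS]big_mkcond; apply: eq_bigr => j _; case: ifPn => // jm.
by rewrite step_mass_small ?mulr0//; lia.
Qed.

(** The Poisson weights satisfy the equation of a pure birth process; peeling
    off one step of the sum converts the shift in the number of steps into a
    uniform shift in space. *)
Lemma has_derivative_PPoK_pmf k lambda z t : (0 < k)%N ->
  has_derivative (PPoK_pmf k lambda z) t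
    (lambda * \sum_(1 <= l < k.+1) PPoK_pmf k lambda (z - l%:Z) t -
     k%:R * lambda * PPoK_pmf k lambda z t).
Proof.
move=> k0; case: z => [m|m]; last first.
  apply: has_derivative_val; first exact: has_derivative_cst.
  rewrite big_nat_cond big1 ?mulr0 ?subr0// => l _.
  rewrite NegzE (_ : _ - _ = Negz (m + l)%N)//; lia.
apply: has_derivative_val.
  apply: has_derivative_sum => j; apply: has_derivativeM (has_derivative_cst _ _).
  exact: has_derivative_poisson_weight.
set mu := k%:R * lambda; pose c j := step_mass k j m.
pose pw j := poisson_weight mu j t.
have -> : \sum_(j < m.+1) (mu * ((if j : nat is j'.+1 then pw j' else 0) - pw j) * c j + pw j * 0) =
    mu * \sum_(j < m) pw j * c j.+1 - mu * PPoK_pmf k lambda m t.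
  rewrite (eq_bigr (fun j : 'I_m.+1 => mu * ((if j : nat is j'.+1 then pw j' else 0) * c j) -
      mu * (pw j * c j))) => [|j _]; last by rewrite mulr0 addr0; case: (nat_of_ord j) => [|i]; ring.
  rewrite sumrB -!mulr_sumr; congr (_ * _ - _ * _).
  by rewrite big_ord_recl mul0r add0r.
congr (_ - _); rewrite /c /=.
rewrite [X in mu * X](_ : _ = k%:R^-1 * \sum_(1 <= l < k.+1) PPoK_pmf k lambda (m%:Z - l%:Z) t).
  by rewrite /mu mulrA [_ * k%:R^-1]mulrAC divff ?mul1r// pnatr_eq0 -lt0n.
under eq_bigr do rewrite mulrCA big_mkcond mulr_sumr.
rewrite -mulr_sumr exchange_big/=; congr (_ * _).
rewrite !big_nat; apply: eq_bigr => l /andP[l1 _].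
case: (boolP (l <= m)%N) => lm; last first.
  rewrite big1 => [|j _]; last by rewrite mulr0.
  by have -> : m%:Z - l%:Z = Negz (l - m).-1 by lia.
have -> : m%:Z - l%:Z = (m - l)%N%:Z by lia.
by rewrite -(@PPoK_pmf_widen _ _ _ m)//; lia.
Qed.

End PPoK_pmf.

(** * The law of the Poisson process of order k *)

Section probability_facts.
Context {R : realType} {d : measure_display} {T : measurableType d} (P : probability T R).
Implicit Types (A B : set T).

Lemma prob_ae_eq A B : measurable A -> measurable B ->
  {ae P, forall w, A w <-> B w} -> P A = P B.
Proof.
move=> mA mB AB.
have E C : measurable C -> P C = (\int[P]_z (\1_C z)%:E)%E.
  by move=> mC; rewrite integral_indic// setIT.
rewrite !E//; apply: ae_eq_integral => //.
- exact/measurable_EFinP/measurable_indic.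
- exact/measurable_EFinP/measurable_indic.
move: AB; apply: filterS => w AB _; congr (_%:E); rewrite !indicE.
have [h|h] := pselect (A w); first by rewrite !mem_set//; exact/AB.
by rewrite !memNset// => /AB.
Qed.

Lemma fin_prob A : measurable A -> P A \is a fin_num.
Proof. exact: fin_num_measure. Qed.

Section fibers.
Variables (A : set T) (Z : T -> nat).
Hypotheses (mA : measurable A) (mZ : forall m, measurable [set w | Z w = m]).

Lemma cvg_sum_fibers :
  \sum_(0 <= m < M) fine (P (A `&` [set w | Z w = m])) @[M --> \oo] --> fine (P A).
Proof.
pose F m := A `&` [set w | Z w = m].
have mF m : measurable (F m) by exact: measurableI.
have AE : \bigcup_m F m = A.
  by apply/seteqP; split => w; [case=> m _ []|move=> Aw; exists (Z w)].
have := @measure_semi_sigma_additive _ _ _ P F mF; rewrite AE => /(_ _ mA) h.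
have {}h : (\sum_(0 <= i < n) P (F i))%E @[n --> \oo] --> P A.
  apply: h => m n _ _ [w [[_ /= <-] [_ /= <-]]] //.
rewrite -(fineK (fin_prob mA)) in h; have [_ /=] := (fine_cvgP _ _).1 h.
apply: cvg_trans; apply: near_eq_cvg; near=> n => /=.
by rewrite -sum_fine// => m _; exact: fin_prob.
Unshelve. all: by end_near. Qed.

Lemma sum_fibers_le M :
  \sum_(0 <= m < M) fine (P (A `&` [set w | Z w = m])) <= fine (P A).
Proof.
rewrite -(cvg_lim _ cvg_sum_fibers)//.
apply: nondecreasing_cvgn_le; last by apply/cvg_ex; exists (fine (P A)); exact: cvg_sum_fibers.
by apply: nondecreasing_series => n _ _; exact: fine_ge0.
Qed.

Lemma sum_fibers_fin M : (forall m, (M <= m)%N -> P (A `&` [set w | Z w = m]) = 0%E) ->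
  fine (P A) = \sum_(0 <= m < M) fine (P (A `&` [set w | Z w = m])).
Proof.
move=> A0; have := cvg_sum_fibers; move/cvg_lim => <- //.
apply: cvg_lim => //; apply: cvg_near_cst; near=> n.
rewrite (@big_cat_nat _ _ _ M)//=; last by near: n; exact: nbhs_infty_ge.
by rewrite [X in _ + X]big_nat_cond [X in _ + X]big1 ?addr0// => i /andP[/andP[iM _] _]; rewrite A0.
Unshelve. all: by end_near. Qed.

End fibers.
End probability_facts.

Definition partial_sum (T : Type) (X : nat -> T -> nat) j w := (\sum_(i < j) X i w)%N.

Lemma measurable_partial_sum d (T : measurableType d) (X : nat -> T -> nat) :
  (forall i m, measurable [set w | X i w = m]) ->
  forall j m, measurable [set w | partial_sum X j w = m].
Proof.
move=> mX; elim=> [|j ih] m.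
  case: m => [|m].
    rewrite (_ : [set w | _] = setT)//; apply/seteqP; split => w //= _.
    by rewrite /partial_sum big_ord0.
  rewrite (_ : [set w | _] = set0)//; apply/seteqP; split => w //=.
  by rewrite /partial_sum big_ord0.
rewrite (_ : [set w | _] = \bigcup_(l in [set l | (l <= m)%N])
    ([set w | partial_sum X j w = (m - l)%N] `&` [set w | X j w = l])).
  by apply: bigcup_measurable => l _; exact: measurableI.
apply/seteqP; split => w /=; rewrite /partial_sum big_ord_recr/=.
  by move=> e; exists (X j w) => /=; [lia|split => //; lia].
by move=> [l /= lm [-> ->]]; rewrite subnK.
Qed.

Section sum_law.
Context {R : realType} {d : measure_display} {T : measurableType d} (P : probability T R).
Variables (k : nat) (X : nat -> T -> nat).
Hypothesis k0 : (0 < k)%N.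
Hypothesis mX : forall i, measurable_fun setT (X i).
Hypothesis unifX : forall i j, (1 <= j <= k)%N -> P [set w | X i w = j] = (k%:R^-1)%:E.
Hypothesis indX : mutually_independent P X.

Lemma measurable_fiber (Z : T -> nat) : measurable_fun setT Z ->
  forall m, measurable [set w | Z w = m].
Proof. by move=> mZ m; rewrite -[X in measurable X]setTI; exact: (mZ measurableT [set m]). Qed.

(** The values from 1 to [k] carry the whole mass, which leaves none to the
    others. *)
Lemma uniform_law i l : P [set w | X i w = l] =
  (if (1 <= l <= k)%N then k%:R^-1 else 0)%:E.
Proof.
case: ifPn => [/unifX //|lk].
have mXi := measurable_fiber (mX i).
have := sum_fibers_le P measurableT mXi (maxn k l).+1.
under eq_bigr do rewrite setTI.
rewrite probability_setT/= (bigID (fun m => (1 <= m <= k)%N))/=.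
have -> : \sum_(0 <= m < (maxn k l).+1 | (1 <= m <= k)%N) fine (P [set w | X i w = m]) = 1.
  transitivity (\sum_(1 <= m < k.+1) (k%:R^-1 : R)).
    rewrite [RHS](@big_nat_widen _ _ _ _ _ (maxn k l).+1); last lia.
    rewrite [RHS](@big_nat_widenl _ _ _ _ 0)//; apply: eq_big => [m|m /unifX -> //].
    by rewrite ltnS andbC.
  by rewrite sumr_const_nat subSS subn0 -[X in X = _]mulr_natl divff// pnatr_eq0 -lt0n.
rewrite gerDl big_mkcond (bigD1_seq l)/=; last 2 first.
- by rewrite mem_index_iota; lia.
- exact: (iota_uniq 0 (maxn k l).+1).
rewrite lk => h; apply/eqP; rewrite eq_le measure_ge0 andbT.
have fl : P [set w | X i w = l] \is a fin_num by exact: fin_prob.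
rewrite -(fineK fl) lee_fin; apply: le_trans h; rewrite lerDl.
by apply: sumr_ge0 => m _; case: ifP => // _; exact: fine_ge0.
Qed.

Lemma step_massE j m :
  step_mass k j.+1 m =
  \sum_(0 <= l < m.+1) step_mass k j (m - l) * (if (1 <= l <= k)%N then k%:R^-1 else 0) :> R.
Proof.
rewrite /= mulr_sumr (@big_nat_widenl _ _ _ _ 0)//.
rewrite (@big_nat_widen _ _ _ _ _ (m + k).+1)%N; last lia.
rewrite [RHS](@big_nat_widen _ _ _ _ _ (m + k).+1)%N; last lia.
rewrite big_mkcond [RHS]big_mkcond; apply: eq_bigr => l _ /=.
rewrite !ltnS; case: (l <= m)%N => //=.
by case: ifP => _; rewrite ?mulr0// mulrC.
Qed.

(** Keeping an arbitrary finite family of later steps in the statement lets the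
    induction on [j] use only the product rule of mutual independence: the
    event on step [j] joins the family. *)
Lemma partial_sum_law j m (s : seq nat) (B : nat -> set nat) : uniq s ->
  (forall i, i \in s -> (j <= i)%N) ->
  P ([set w | partial_sum X j w = m] `&` \bigcap_(i in [set` s]) (X i @^-1` B i)) =
  ((step_mass k j m)%:E * \prod_(i <- s) P (X i @^-1` B i))%E.
Proof.
elim: j m s B => [|j ih] m s B us js.
  have -> : [set w | partial_sum X 0 w = m] = [set _ | 0%N = m].
    by apply/seteqP; split => w /=; rewrite /partial_sum big_ord0.
  case: m => [|m] /=.
    by rewrite mul1e -(indX us)//; congr (P _); apply/seteqP; split=> w; [case|].
  rewrite mul0e; rewrite (_ : _ `&` _ = set0) ?measure0//.
  by apply/seteqP; split => w //= -[].
set I := \bigcap_(i in _) _.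
have mpX i C : measurable (X i @^-1` C).
  by rewrite -[X in measurable X]setTI; exact: mX.
have mI : measurable I by apply: bigcap_measurableType => i _; exact: mpX.
have mA : measurable ([set w | partial_sum X j.+1 w = m] `&` I).
  by apply: measurableI => //; apply: measurable_partial_sum => i; exact: measurable_fiber.
have jNs : j \notin s by apply/negP => /js; rewrite ltnn.
(* The family of events enlarged by: step [j] equals [l]. *)
pose B' l i := if i == j then [set l] else B i.
have AE l : (l <= m)%N -> [set w | partial_sum X j.+1 w = m] `&` I `&` [set w | X j w = l] =
    [set w | partial_sum X j w = (m - l)%N] `&` \bigcap_(i in [set` j :: s]) (X i @^-1` B' l i).
  move=> lm; apply/seteqP; split => w /=; rewrite /partial_sum big_ord_recr/=.
    move=> [[e Iw] Xl]; split; first by rewrite -e Xl addnK.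
    move=> i /=; rewrite inE => /predU1P[->|si]; rewrite /B'/= ?eqxx//.
    case: eqP => [ij|_]; first by rewrite -ij si in jNs.
    exact: Iw.
  move=> [e Iw]; have := Iw j; rewrite /= mem_head /B' eqxx /= => /(_ isT) Xl.
  split => //; split; first by rewrite e Xl subnK.
  move=> i /= si; have := Iw i; rewrite /= inE si orbT /B' => /(_ isT).
  by case: eqP => // ij; rewrite -ij si in jNs.
have PE l : P ([set w | partial_sum X j.+1 w = m] `&` I `&` [set w | X j w = l]) =
    ((if (l <= m)%N then step_mass k j (m - l) * (if (1 <= l <= k)%N then k%:R^-1 else 0) else 0)%:E *
    \prod_(i <- s) P (X i @^-1` B i))%E.
  case: ifPn => lm; last first.
    rewrite mul0e (_ : _ `&` _ = set0) ?measure0//.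
    apply/seteqP; split => w //= -[[+ _] Xl].
    by rewrite /partial_sum big_ord_recr/= Xl; lia.
  rewrite AE// ih/=; first last.
  - by move=> i; rewrite inE => /predU1P[->//|/js /ltnW].
  - by rewrite jNs.
  rewrite big_cons {1}/B' eqxx uniform_law EFinM -muleA; congr (_ * (_ * _))%E.
  by apply: eq_big_seq => i si; rewrite /B'; case: eqP => // ij; rewrite -ij si in jNs.
have fA : (\prod_(i <- s) P (X i @^-1` B i))%E \is a fin_num.
  by apply: prode_fin_num => i _; exact: fin_prob.
rewrite -(fineK (fin_prob P mA)) -(fineK fA) -EFinM; congr EFin.
rewrite (sum_fibers_fin mA (measurable_fiber (mX j)) (M := m.+1)) => [|l ml]; last first.
  by rewrite PE leqNgt ml mul0e.
rewrite step_massE mulr_suml; apply: eq_big_nat => l /andP[_ lm].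
by rewrite PE -ltnS lm -{1}(fineK fA) -EFinM.
Qed.

End sum_law.

Section PPoK_law.
Context {R : realType} {d : measure_display} {T : measurableType d} (P : probability T R).
Variables (k : nat) (lambda : R) (Nk : R -> T -> nat).
Hypotheses (k0 : (0 < k)%N) (hNk : is_PPoK P k lambda Nk).

Lemma Poisson_pmf (mu : R) (N : R -> T -> nat) t j : is_Poisson_process P mu N -> 0 <= t ->
  P [set w | N t w = j] = (poisson_weight mu j t)%:E.
Proof.
move=> hN t0; have mN s := measurable_fiber (Poisson_measurable hN s).
have := Poisson_increment_law hN j (lexx 0) t0; rewrite subr0 => <-.
apply: prob_ae_eq; first exact: mN.
  rewrite (_ : [set w | _] = \bigcup_l ([set w | N 0 w = l] `&` [set w | N t w = (l + j)%N])).
    by apply: bigcupT_measurable => l; apply: measurableI; exact: mN.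
  have nd w := Poisson_nondecreasing hN w (lexx 0) t0.
  apply/seteqP; split => w /=; first by move=> <-; exists (N 0 w) => //; split => //=; rewrite subnKC.
  by move=> [l _ [/= -> ->]]; rewrite addKn.
by move: (Poisson_start hN); apply: filterS => w /= ->; rewrite subn0.
Qed.

(** Split according to the number of steps, which is independent of them. *)
Lemma PPoK_law t m : 0 <= t ->
  measurable [set w | Nk t w = m] /\ P [set w | Nk t w = m] = (PPoK_pmf k lambda m t)%:E.
Proof.
have [N [X [hN hX indX indNX NkE]]] := hNk.
move=> t0; have mX i : measurable_fun setT (X i) by case: (hX i).
have mXf i l : measurable [set w | X i w = l] by exact: measurable_fiber.
have mN l : measurable [set w | N t w = l] by exact/measurable_fiber/(Poisson_measurable hN).
have mW j : measurable [set w | partial_sum X j w = m] by exact: measurable_partial_sum.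
have AE j : [set w | Nk t w = m] `&` [set w | N t w = j] =
    [set w | N t w = j] `&` [set w | partial_sum X j w = m].
  by apply/seteqP; split => w /= []; rewrite NkE// => + + ; [move=> + Nj|move=> Nj]; rewrite Nj.
have mA : measurable [set w | Nk t w = m].
  rewrite (_ : [set w | Nk t w = m] = \bigcup_j ([set w | Nk t w = m] `&` [set w | N t w = j])).
    by apply: bigcupT_measurable => j; rewrite AE; exact: measurableI.
  by apply/seteqP; split => w; [move=> Nm; exists (N t w)|case=> j _ []].
split=> //.
have PE j : P ([set w | Nk t w = m] `&` [set w | N t w = j]) =
    (poisson_weight (k%:R * lambda) j t * step_mass k j m)%:E.
  have unifX i l : (1 <= l <= k)%N -> P [set w | X i w = l] = (k%:R^-1)%:E.
    by case: (hX i) => _; exact.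
  have := @partial_sum_law _ _ _ P k X k0 mX unifX indX j m [::] (fun=> setT) isT.
  rewrite big_nil mule1 set_nil bigcap_set0 setIT => sl.
  rewrite AE indNX; first by rewrite (Poisson_pmf j hN)// sl// -EFinM.
    apply: sub_gen_smallest; exists t => //; exists [set j] => //.
    by rewrite setTI.
  (* Partial sums are measurable for the sigma-algebra of the steps, so
     [measurable_partial_sum] is applied over the space that carries it. *)
  pose G := \bigcup_(i in setT) preimage_set_system setT (X i) measurable.
  apply: (@measurable_partial_sum _ (g_sigma_algebraType G)) => i l.
  apply: sub_gen_smallest; exists i => //; exists [set l] => //.
  by rewrite setTI.
rewrite -(fineK (fin_prob P mA)); congr EFin.
rewrite (sum_fibers_fin mA mN (M := m.+1)) => [|j mj].
  by rewrite big_mkord; apply: eq_bigr => j _; rewrite PE.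
by rewrite PE step_mass_small ?mulr0.
Qed.

Lemma PPoK_right_constant w t : 0 <= t -> \forall s \near t^'+, Nk s w = Nk t w.
Proof.
have [N [X [hN _ _ _ NkE]]] := hNk.
move=> t0; have : \forall s \near t^'+, N s w = N t w.
  have := @Poisson_right_continuous _ _ _ _ _ _ hN w t t0 => h.
  exact: (h [set N t w] (discrete_set1 _)).
move=> h; near=> s.
rewrite !NkE//; last by rewrite ltW// (le_lt_trans t0)//; near: s; exact: nbhs_right_gt.
by rewrite (_ : N s w = N t w)//; near: s.
Unshelve. all: by end_near. Qed.

End PPoK_law.

(** * Forward equations as limits of truncated ones *)

Lemma cvg_sum (R : realType) (T : Type) (F : set_system T) {FF : Filter F} (I : Type)
    (r : seq I) (u : I -> T -> R) (v : I -> R) :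
  (forall i, u i M @[M --> F] --> v i) ->
  \sum_(i <- r) u i M @[M --> F] --> \sum_(i <- r) v i.
Proof.
move=> uv; elim: r => [|i r ih].
  by under eq_fun do rewrite big_nil; rewrite big_nil; exact: cvg_cst.
by under eq_fun do rewrite big_cons; rewrite big_cons; exact: cvgD.
Qed.

Lemma cvg_norm_le (R : realType) (u : nat -> R) (l C : R) :
  u M @[M --> \oo] --> l -> (forall M, `|u M| <= C) -> `|l| <= C.
Proof.
move=> ul uC; have h : `|u M| @[M --> \oo] --> `|l| by exact: cvg_norm.
by rewrite -(cvg_lim _ h)//; apply: limr_le; [by apply/cvg_ex; exists `|l| | exact: nearW].
Qed.

Section forward_equation.
Context {R : realType}.
Notation mu := (@lebesgue_measure R).
Variables (k : nat) (l1 l2 : R).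
Hypotheses (l10 : 0 <= l1) (l20 : 0 <= l2).
Implicit Types (n : int) (M j : nat) (x y s t C : R).

(** The forward operator of the Skellam process of order [k]. *)
Definition generator (f : int -> R) n : R :=
  l1 * \sum_(1 <= j < k.+1) f (n - j%:Z) + l2 * \sum_(1 <= j < k.+1) f (n + j%:Z) -
  k%:R * (l1 + l2) * f n.

Definition generator_norm : R := 2 * k%:R * (l1 + l2).

Lemma generator_norm_ge0 : 0 <= generator_norm.
Proof. by rewrite !mulr_ge0 ?addr_ge0. Qed.

Let sum_bound (a : nat -> R) C : (forall j, `|a j| <= C) -> `|\sum_(1 <= j < k.+1) a j| <= k%:R * C.
Proof.
move=> aC; apply: le_trans (ler_norm_sum _ _ _) _.
apply: le_trans (ler_sum _ (fun j _ => aC j)) _.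
by rewrite sumr_const_nat subSS subn0 mulr_natl.
Qed.

Lemma generator_bound (a b : nat -> R) (c : R) C : (forall j, `|a j| <= C) -> (forall j, `|b j| <= C) ->
  `|c| <= C ->
  `|l1 * \sum_(1 <= j < k.+1) a j + l2 * \sum_(1 <= j < k.+1) b j - k%:R * (l1 + l2) * c| <=
  generator_norm * C.
Proof.
move=> aC bC cC; have sa := sum_bound aC; have sb := sum_bound bC.
apply: le_trans (ler_normB _ _) _; apply: le_trans (lerD (ler_normD _ _) (lexx _)) _.
rewrite !normrM (ger0_norm l10) (ger0_norm l20) (ger0_norm (addr_ge0 l10 l20)) normr_nat.
have h1 := ler_wpM2l l10 sa; have h2 := ler_wpM2l l20 sb.
have h3 : k%:R * (l1 + l2) * `|c| <= k%:R * (l1 + l2) * C by rewrite ler_wpM2l// mulr_ge0 ?addr_ge0.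
have -> : generator_norm * C = l1 * (k%:R * C) + l2 * (k%:R * C) + k%:R * (l1 + l2) * C.
  by rewrite /generator_norm; ring.
exact: lerD (lerD h1 h2) h3.
Qed.

Lemma generator_cvg (F : set_system nat) {FF : Filter F} (a b : nat -> nat -> R) (c : nat -> R)
    (f : int -> R) n :
  (forall j, a M j @[M --> F] --> f (n - j%:Z)) -> (forall j, b M j @[M --> F] --> f (n + j%:Z)) ->
  c M @[M --> F] --> f n ->
  l1 * \sum_(1 <= j < k.+1) a M j + l2 * \sum_(1 <= j < k.+1) b M j - k%:R * (l1 + l2) * c M
    @[M --> F] --> generator f n.
Proof.
have sumc (u : nat -> nat -> R) (v : nat -> R) : (forall j, u M j @[M --> F] --> v j) ->
    \sum_(1 <= j < k.+1) u M j @[M --> F] --> \sum_(1 <= j < k.+1) v j.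
  by move=> uv; exact: (@cvg_sum _ _ _ _ _ _ (fun j M => u M j)).
move=> ha hb hc; apply: cvgB; last by apply: cvgMr; exact: hc.
by apply: cvgD; apply: cvgMr; exact: sumc.
Qed.

Lemma has_derivative_generator (f g : int -> R -> R) n x :
  (forall n, has_derivative (f n) x (g n x)) ->
  has_derivative (fun y => generator (f^~ y) n) x (generator (g^~ x) n).
Proof.
move=> fg; rewrite /generator; apply: has_derivativeB; last by apply: has_derivativeZ; exact: fg.
by apply: has_derivativeD; apply: has_derivativeZ; apply: has_derivative_sum => j; exact: fg.
Qed.

Lemma continuous_generator (f : int -> R -> R) n : (forall n, continuous (f n)) ->
  continuous (fun y => generator (f^~ y) n).
Proof.
move=> cf x; apply: cvgB; last by apply: cvgMr; exact: cf.
by apply: cvgD; apply: cvgMr; apply: cvg_sum => j; exact: cf.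
Qed.

Variables (q : nat -> int -> R -> R) (p : int -> R -> R).
(* The truncations [q M] satisfy the forward equation up to a shift of the
   truncation level in the upward jumps. *)
Let q' M n t : R :=
  l1 * \sum_(1 <= j < k.+1) q M (n - j%:Z) t + l2 * \sum_(1 <= j < k.+1) q (M - j)%N (n + j%:Z) t -
  k%:R * (l1 + l2) * q M n t.
Hypothesis dq : forall M n t, has_derivative (q M n) t (q' M n t).
Hypothesis q01 : forall M n t, 0 <= t -> 0 <= q M n t <= 1.
Hypothesis qp : forall n t, 0 <= t -> q M n t @[M --> \oo] --> p n t.

(** Freezing the function at negative times gives a function that is continuous
    on the whole line, with the right derivative at positive times. *)
Definition clamp n x : R := p n (Num.max x 0).

Lemma clampE n x : 0 <= x -> clamp n x = p n x.
Proof. by move=> x0; rewrite /clamp max_l. Qed.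

Let q_norm M n t : 0 <= t -> `|q M n t| <= 1.
Proof. by move=> t0; case/andP: (q01 M n t0) => h0 h1; rewrite ger0_norm. Qed.

Let q'_norm M n t : 0 <= t -> `|q' M n t| <= generator_norm.
Proof.
by move=> t0; rewrite -[leRHS]mulr1; apply: generator_bound => [j|j|]; exact: q_norm.
Qed.

Lemma clamp_norm n x : `|clamp n x| <= 1.
Proof.
have x0 : 0 <= Num.max x 0 by rewrite le_max lexx orbT.
by apply: cvg_norm_le (@qp n _ x0) _ => M; exact: q_norm.
Qed.

Let cq M n : continuous (q M n).
Proof. by move=> x; exact: has_derivative_continuous (dq _ _ _). Qed.

Let q_lip M n s t : 0 <= s -> s <= t -> `|q M n t - q M n s| <= generator_norm * (t - s).
Proof.
move=> s0 st.
have [||c] := @MVT_segment R (q M n) (q' M n) s t st; [|exact: continuous_subspaceT|].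
  by move=> x _; exact: dq.
rewrite in_itv/= => /andP[sc _] ->; rewrite normrM (@ger0_norm _ (t - s)) ?subr_ge0//.
by rewrite ler_wpM2r ?subr_ge0// q'_norm// (le_trans s0).
Qed.

Let p_lip n s t : 0 <= s -> s <= t -> `|p n t - p n s| <= generator_norm * (t - s).
Proof.
move=> s0 st; have t0 := le_trans s0 st.
by apply: cvg_norm_le (cvgB (@qp n _ t0) (@qp n _ s0)) _ => M; exact: q_lip.
Qed.

(** The truncations are Lipschitz with a constant independent of the level. *)
Lemma continuous_clamp n : continuous (clamp n).
Proof.
have lip x y : `|clamp n x - clamp n y| <= generator_norm * `|x - y|.
  have wl u v : v <= u -> `|clamp n u - clamp n v| <= generator_norm * (u - v).
    move=> vu; have hm : Num.max v 0 <= Num.max u 0 by rewrite ge_max !le_max vu lexx orbT.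
    apply: le_trans (p_lip n _ hm) _; first by rewrite le_max lexx orbT.
    rewrite ler_wpM2l ?generator_norm_ge0// lerBlDr ge_max; apply/andP; split.
      by rewrite -lerBlDl opprB addrC subrK le_max lexx.
    by rewrite addr_ge0 ?subr_ge0// le_max lexx orbT.
  have [yx|/ltW xy] := leP y x; first by rewrite (ger0_norm (_ : 0 <= x - y)) ?subr_ge0// wl.
  by rewrite distrC [`|x - y|]distrC (ger0_norm (_ : 0 <= y - x)) ?subr_ge0// wl.
move=> x; apply/cvgrPdist_le => e e0.
have C0 : 0 < generator_norm + 1 by rewrite ltr_wpDl ?generator_norm_ge0.
near=> y; apply: le_trans (lip x y) _.
apply: (@le_trans _ _ ((generator_norm + 1) * `|x - y|)).
  by rewrite ler_wpM2r// lerDl.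
rewrite mulrC -ler_pdivlMr//; near: y.
by apply: (cvgrPdist_le _ _).1 (cvg_id) _ _; rewrite divr_gt0.
Unshelve. all: by end_near. Qed.

(** The integrated equations of the truncations pass to the limit by dominated
    convergence; the limit equation has a continuous integrand, hence can be
    differentiated. *)
Lemma has_derivative_clamp n x : 0 < x ->
  has_derivative (clamp n) x (generator (clamp^~ x) n).
Proof.
move=> x0.
pose G y := generator (clamp^~ y) n.
have cG : continuous G by apply: continuous_generator => m; exact: continuous_clamp.
have [Q [_ dQ]] := continuous_primitive cG.
have cQ : continuous Q by move=> y; exact: has_derivative_continuous (dQ y).
have pQ t : 0 < t -> p n t - p n 0 = Q t - Q 0.
  move=> t0; have mI : measurable (`[0, t]%classic : set (measurableTypeR R)) by exact: measurable_itv.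
  have cq' M : continuous (q' M n).
    move=> y; apply: cvgB; last by apply: cvgMr; exact: cq.
    by apply: cvgD; apply: cvgMr; apply: cvg_sum => j; exact: cq.
  have [_] : mu.-integrable `[0, t] (EFin \o G) /\
      \int[mu]_(y in `[0, t]) q' M n y @[M --> \oo] --> \int[mu]_(y in `[0, t]) G y.
    apply: (@Rintegral_dominated_cvg _ (measurableTypeR R) R mu _ mI (fun M => q' M n) G
      (cst generator_norm)).
    - by move=> M; apply: measurable_funTS; exact: continuous_measurable_fun (cq' M).
    - by apply: measurable_funTS; exact: continuous_measurable_fun cG.
    - move=> y /=; rewrite in_itv/= => /andP[y0 _]; rewrite /G.
      apply: generator_cvg => [j|j|]; rewrite clampE//; [exact: qp| |exact: qp].
      by rewrite -(cvg_shiftn j); under eq_fun do rewrite addnK; exact: qp.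
    - apply: (@continuous_compact_integrable R (cst generator_norm)); first exact: segment_compact.
      by apply: continuous_subspaceT => y; exact: cvg_cst.
    - by move=> M y /=; rewrite in_itv/= => /andP[y0 _]; exact: q'_norm.
  have IE M : \int[mu]_(y in `[0, t]) q' M n y = q M n t - q M n 0.
    rewrite /Rintegral (@FTC2_segment R (q' M n) (q M n) 0 t t0)//.
    - by move=> y _; exact: cq'.
    - exact: cq.
    - exact: cq.
  have IG : \int[mu]_(y in `[0, t]) G y = Q t - Q 0.
    rewrite /Rintegral (@FTC2_segment R G Q 0 t t0)//.
    - by move=> y _; exact: cG.
    - exact: cQ.
    - exact: cQ.
  under eq_fun do rewrite IE; rewrite IG => h.
  exact: (cvg_unique _ (cvgB (@qp n _ (ltW t0)) (@qp n _ (lexx 0))) h).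
apply: (@near_eq_is_derive _ _ _ (fun y => p n 0 - Q 0 + Q y)).
  near=> y; have y0 : 0 < y by near: y; exact: lt_nbhsr.
  by rewrite clampE ?ltW// -[LHS]addrA [- _ + _]addrC -pQ// addrC subrK.
apply: has_derivative_val; first exact: has_derivativeD (has_derivative_cst _ _) (dQ x).
by rewrite add0r.
Unshelve. all: by end_near. Qed.

End forward_equation.

(** * The Skellam process of order k *)

Section SPoK_truncation.
Context {R : realType}.
Variables (k : nat) (l1 l2 : R).
Hypothesis k0 : (0 < k)%N.
Implicit Types (n : int) (M m l : nat) (t : R).

(** The mass function of a difference of two independent variables, with the
    second one restricted to values below [M]. *)
Definition SPoK_truncation M n t : R :=
  \sum_(0 <= m < M) PPoK_pmf k l1 (n + m%:Z) t * PPoK_pmf k l2 m t.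

Lemma SPoK_truncation_shift M n l t :
  \sum_(0 <= m < M) PPoK_pmf k l1 (n + m%:Z) t * PPoK_pmf k l2 (m%:Z - l%:Z) t =
  SPoK_truncation (M - l) (n + l%:Z) t.
Proof.
have z m : (m < l)%N -> PPoK_pmf k l1 (n + m%:Z) t * PPoK_pmf k l2 (m%:Z - l%:Z) t = 0.
  by move=> ml; have -> : m%:Z - l%:Z = Negz (l - m).-1 by [lia]; rewrite /= mulr0.
rewrite /SPoK_truncation; have [lM|Ml] := leqP l M; last first.
  rewrite (eqP (_ : (M - l)%N == 0%N)); last by lia.
  rewrite [RHS]big_geq// big_nat_cond big1// => m /andP[/andP[_ mM] _]; apply: z; lia.
rewrite (@big_cat_nat _ _ _ l)// big_nat_cond big1 => [|m /andP[/andP[_ ml] _]]; last exact: z.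
rewrite [LHS]add0r -{1}(add0n l) big_addn; apply: eq_bigr => m _.
by congr (PPoK_pmf _ _ _ _ * PPoK_pmf _ _ _ _); lia.
Qed.

Lemma has_derivative_SPoK_truncation M n t :
  has_derivative (SPoK_truncation M n) t
    (l1 * \sum_(1 <= j < k.+1) SPoK_truncation M (n - j%:Z) t +
     l2 * \sum_(1 <= j < k.+1) SPoK_truncation (M - j)%N (n + j%:Z) t -
     k%:R * (l1 + l2) * SPoK_truncation M n t).
Proof.
apply: has_derivative_val.
  by apply: has_derivative_sum => m; apply: has_derivativeM; exact: has_derivative_PPoK_pmf.
under [X in l2 * X]eq_bigr do rewrite -SPoK_truncation_shift.
rewrite exchange_big/= [X in l2 * X]exchange_big/= !mulr_sumr -big_split -sumrB/=.
apply: eq_bigr => m _; rewrite -mulr_suml -mulr_sumr.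
have -> : \sum_(1 <= j < k.+1) PPoK_pmf k l1 (n - j%:Z + m%:Z) t =
    \sum_(1 <= j < k.+1) PPoK_pmf k l1 (n + m%:Z - j%:Z) t.
  by apply: eq_bigr => j _; rewrite addrAC.
by ring.
Qed.

End SPoK_truncation.

Section SPoK_law.
Context {R : realType} {d : measure_display} {T : measurableType d} (P : probability T R).
Variables (k : nat) (l1 l2 : R) (S : R -> T -> int).
Hypothesis k0 : (0 < k)%N.
Hypothesis hS : is_SPoK P k l1 l2 S.

Lemma SPoK_law n t : 0 <= t ->
  [/\ measurable [set w | S t w = n],
      forall M, 0 <= SPoK_truncation k l1 l2 M n t <= 1 &
      SPoK_truncation k l1 l2 M n t @[M --> \oo] --> state_prob P (S t) n].
Proof.
have [N1 [N2 [hN1 hN2 ind SE]]] := hS => t0.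
have m1 m := (PPoK_law k0 hN1 m t0).1; have m2 m := (PPoK_law k0 hN2 m t0).1.
have AE m : [set w | S t w = n] `&` [set w | N2 t w = m] =
    [set w | (N1 t w)%:Z = n + m%:Z] `&` [set w | N2 t w = m].
  by apply/seteqP; split => w /= [+ Nm]; rewrite SE// Nm; lia.
have m1' z : measurable [set w | (N1 t w)%:Z = z] /\
    P [set w | (N1 t w)%:Z = z] = (PPoK_pmf k l1 z t)%:E.
  case: z => m; last first.
    rewrite (_ : [set w | _] = set0) ?measure0//.
    by apply/seteqP; split.
  have -> : [set w | (N1 t w)%:Z = m%:Z] = [set w | N1 t w = m].
    by apply/seteqP; split => w /=; [case|move=> ->].
  by have [? ?] := PPoK_law k0 hN1 m t0.
have mS : measurable [set w | S t w = n].
  rewrite (_ : [set w | S t w = n] = \bigcup_m ([set w | S t w = n] `&` [set w | N2 t w = m])).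
    by apply: bigcupT_measurable => m; rewrite AE; apply: measurableI => //; exact: (m1' _).1.
  by apply/seteqP; split => w; [move=> Sn; exists (N2 t w)|case=> m _ []].
have QE M : SPoK_truncation k l1 l2 M n t =
    \sum_(0 <= m < M) fine (P ([set w | S t w = n] `&` [set w | N2 t w = m])).
  apply: eq_bigr => m _; rewrite AE ind.
  - by rewrite (m1' _).2 (PPoK_law k0 hN2 m t0).2.
  - apply: sub_gen_smallest; exists t => //; exists [set j | j%:Z = n + m%:Z] => //.
    by rewrite setTI.
  - apply: sub_gen_smallest; exists t => //; exists [set m] => //.
    by rewrite setTI.
split => //.
- move=> M; rewrite QE; apply/andP; split.
    by apply: sumr_ge0 => m _; exact: fine_ge0.
  apply: le_trans (sum_fibers_le P mS m2 M) _.
  by rewrite -lee_fin fineK ?probability_le1//; exact: fin_prob.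
- by under eq_fun do rewrite QE; exact: cvg_sum_fibers.
Qed.

Lemma SPoK_right_constant w t : 0 <= t -> \forall s \near t^'+, S s w = S t w.
Proof.
have [N1 [N2 [hN1 hN2 _ SE]]] := hS => t0; near=> s.
have s0 : 0 <= s by rewrite ltW// (le_lt_trans t0)//; near: s; exact: nbhs_right_gt.
rewrite !SE//; congr (_%:Z - _%:Z); near: s.
  exact: PPoK_right_constant hN1 _ _ t0.
exact: PPoK_right_constant hN2 _ _ t0.
Unshelve. all: by end_near. Qed.

End SPoK_law.

(** * Time change by an independent random time *)

Section time_change.
Context {R : realType} {d : measure_display} {T : measurableType d} (P : probability T R).
Variables (S : R -> T -> int) (H : T -> R) (n : int) (g : R -> R).
Hypotheses (mH : measurable_fun setT H) (H0 : forall w, 0 <= H w).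
Hypothesis mS : forall t, 0 <= t -> measurable [set w | S t w = n].
Hypothesis rS : forall w t, 0 <= t -> \forall s \near t^'+, S s w = S t w.
Hypothesis ind : forall (B : set R) t, measurable B -> 0 <= t ->
  P (H @^-1` B `&` [set w | S t w = n]) = (P (H @^-1` B) * P [set w | S t w = n])%E.
Hypothesis cg : continuous g.
Hypothesis gE : forall t, 0 <= t -> P [set w | S t w = n] = (g t)%:E.
Hypothesis g1 : forall t, `|g t| <= 1.

(* [Hm m] approximates [H] strictly from the right by points of the grid of mesh
   [1 / m.+1], so that right-continuity of the paths of [S] applies. *)
Let grid m j : R := j.+1%:R / m.+1%:R.
Let Z m w := Num.truncn (m.+1%:R * H w).
Let Hm m w := grid m (Z m w).
Let cell m j : set R := `[j%:R / m.+1%:R, grid m j[%classic.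

Let grid_ge0 m j : 0 <= grid m j. Proof. by rewrite divr_ge0. Qed.

Let cellE m j : H @^-1` cell m j = [set w | Z m w = j].
Proof.
have m0 : 0 < m.+1%:R :> R by [].
apply/seteqP; split => w; rewrite /cell /grid /= in_itv/= ler_pdivrMr// ltr_pdivlMr// mulrC.
  by move=> h; apply: truncn_def; exact: h.
by move=> <-; rewrite truncn_itv// mulr_ge0.
Qed.

Let mcell m j : measurable [set w | Z m w = j].
Proof. by rewrite -cellE -[X in measurable X]setTI; apply: mH => //; exact: measurable_itv. Qed.

Let cover_cell m : \bigcup_j [set w | Z m w = j] = setT.
Proof. by apply/seteqP; split => w // _; exists (Z m w). Qed.

Let mAcell m j : measurable ([set w | S (Hm m w) w = n] `&` [set w | Z m w = j]).
Proof.
rewrite (_ : _ `&` _ = [set w | Z m w = j] `&` [set w | S (grid m j) w = n]).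
  by apply: measurableI => //; exact: mS.
by apply/seteqP; split => w /=; rewrite /Hm => -[]; [move=> + Zj|move=> Zj]; rewrite Zj.
Qed.

Let mA m : measurable [set w | S (Hm m w) w = n].
Proof.
rewrite -[X in measurable X]setIT -(cover_cell m) setI_bigcupr.
by apply: bigcupT_measurable => j; exact: mAcell.
Qed.

Let mgH m : measurable_fun setT (fun w => g (Hm m w)).
Proof.
move=> _ B mB; rewrite setTI.
rewrite (_ : _ @^-1` B = \bigcup_(j in [set j | B (g (grid m j))]) [set w | Z m w = j]).
  by apply: bigcup_measurable => j _; exact: mcell.
by apply/seteqP; split => w /=; [move=> Bw; exists (Z m w)|case=> j /= Bj Zj; rewrite /Hm Zj].
Qed.

Let g_ge0 t : 0 <= t -> 0 <= g t.
Proof. by move=> t0; rewrite -lee_fin -gE. Qed.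

(** On each cell the discretised time is deterministic, so independence
    applies cell by cell. *)
Let prob_discretised m : P [set w | S (Hm m w) w = n] = (\int[P]_w (g (Hm m w))%:E)%E.
Proof.
rewrite -[X in P X]setIT -(cover_cell m) setI_bigcupr measure_semi_bigcup//; last 2 first.
- by move=> i j _ _ [w [[_ /= <-] [_ /= <-]]].
- by apply: bigcupT_measurable => j; exact: mAcell.
rewrite ge0_integral_bigcup//; last 3 first.
- by rewrite cover_cell; apply/measurable_EFinP; exact: mgH.
- by move=> w _; rewrite lee_fin g_ge0 ?grid_ge0.
- by move=> i j _ _ [w [/= <- <-]].
apply: eq_eseriesr => j _.
have -> : [set w | S (Hm m w) w = n] `&` [set w | Z m w = j] =
    H @^-1` cell m j `&` [set w | S (grid m j) w = n].
  by rewrite cellE; apply/seteqP; split => w /=; rewrite /Hm => -[]; [move=> + Zj|move=> Zj]; rewrite Zj.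
apply: etrans (@ind (cell m j) (grid m j) (measurable_itv _) (grid_ge0 m j)) _.
rewrite gE ?grid_ge0// cellE muleC -integral_cst//.
by apply: eq_integral => w; rewrite inE /= /Hm => ->.
Qed.

Let Hm_gt m w : H w < Hm m w.
Proof.
rewrite ltr_pdivlMr// mulrC; have := @truncn_itv R (m.+1%:R * H w).
by rewrite mulr_ge0// => /(_ isT)/andP[].
Qed.

Let Hm_cvg w : Hm m w @[m --> \oo] --> H w.
Proof.
have ub m : Hm m w <= H w + m.+1%:R^-1.
  have := @truncn_itv R (m.+1%:R * H w); rewrite mulr_ge0// => /(_ isT)/andP[h _].
  rewrite /Hm /grid ler_pdivrMr// mulrDl mulVf// [H w * _]mulrC -[X in X <= _]natr1.
  by rewrite lerD2r.
have c : H w + m.+1%:R^-1 @[m --> \oo] --> H w + 0 by apply: cvgD; [exact: cvg_cst|exact: cvg_harmonic].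
rewrite addr0 in c.
apply: (squeeze_cvgr _ (cvg_cst (H w)) c).
by apply: nearW => m; rewrite ub (ltW (Hm_gt m w)).
Qed.

Let SHm_near w : \forall m \near \oo, S (Hm m w) w = S (H w) w.
Proof.
have : \forall s \near H w, H w < s -> S s w = S (H w) w by exact: rS.
move=> /(@Hm_cvg w _) h; near=> m; have : H w < Hm m w by exact: Hm_gt.
by near: m; exact: h.
Unshelve. all: by end_near.
Qed.

(** Along the discretised times the event is eventually constant, hence equal to
    its lower limit. *)
Lemma measurable_time_change : measurable [set w | S (H w) w = n].
Proof.
rewrite (_ : [set w | _] = \bigcup_M \bigcap_(m in [set m | (M <= m)%N]) [set w | S (Hm m w) w = n]).
  by apply: bigcupT_measurable => M; apply: bigcap_measurableType => m _; exact: mA.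
apply/seteqP; split => w /=; have [M _ hM] := SHm_near w.
  by move=> Sn; exists M => // m /= Mm; rewrite -Sn; exact: hM.
move=> [M' _ /(_ (maxn M M'))]; rewrite /= leq_maxr => /(_ isT) <-.
by apply/esym/hM; rewrite /= leq_maxl.
Qed.

Let ic : P.-integrable setT (EFin \o (cst 1 : T -> R)).
Proof. exact: finite_measure_integrable_cst. Qed.

(** Both sides are limits of their discretised versions, by dominated
    convergence. *)
Lemma prob_time_change : fine (P [set w | S (H w) w = n]) = \int[P]_w g (H w).
Proof.
have [_ h1] : P.-integrable setT (EFin \o (\1_[set w | S (H w) w = n] : T -> R)) /\
    \int[P]_w \1_[set w | S (Hm m w) w = n] w @[m --> \oo] -->
    \int[P]_w (\1_[set w | S (H w) w = n] w : R).
  apply: (@Rintegral_dominated_cvg _ _ _ P setT measurableT _ _ (cst 1)) => //.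
  - by move=> m; apply: measurable_indic; exact: mA.
  - by apply: measurable_indic; exact: measurable_time_change.
  - move=> w _; apply: cvg_near_cst; near=> m; rewrite !indicE.
    have e : S (Hm m w) w = S (H w) w by near: m; exact: SHm_near.
    congr (_%:R); congr nat_of_bool; apply/idP/idP; rewrite !inE/=; congruence.
  - by move=> m w _; rewrite indicE; case: (_ \in _); rewrite ?normr1 ?normr0.
have [_ h2] : P.-integrable setT (EFin \o (fun w => g (H w))) /\
    \int[P]_w g (Hm m w) @[m --> \oo] --> \int[P]_w g (H w).
  apply: (@Rintegral_dominated_cvg _ _ _ P setT measurableT _ _ (cst 1)) => //.
  - by apply: measurableT_comp mH; exact: continuous_measurable_fun.
  - by move=> w _; apply: continuous_cvg; [exact: cg|exact: Hm_cvg].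
have indE A : measurable A -> \int[P]_w (\1_A w : R) = fine (P A).
  by move=> mA'; rewrite /Rintegral integral_indic// setIT.
rewrite -indE; last exact: measurable_time_change.
have e m : \int[P]_w (\1_[set w | S (Hm m w) w = n] w : R) = \int[P]_w g (Hm m w).
  by rewrite indE; [rewrite prob_discretised|exact: mA].
move: h1; under eq_fun do rewrite e.
by move=> h1; exact: (cvg_unique _ h1 h2).
Unshelve. all: by end_near. Qed.
End time_change.

(** * The time-fractional equation *)

Section integral_generator.
Context {R : realType} {d : measure_display} {T : measurableType d}.
Variable m : {measure set T -> \bar R}.

Lemma Rintegral_sum (I : Type) (r : seq I) (f : I -> T -> R) :
  (forall i, m.-integrable setT (EFin \o f i)) ->
  m.-integrable setT (EFin \o (fun w => \sum_(i <- r) f i w)) /\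
  \int[m]_w (\sum_(i <- r) f i w) = \sum_(i <- r) \int[m]_w f i w.
Proof.
move=> fi; elim: r => [|i r [ih1 ih2]].
  rewrite (_ : (fun w => _) = cst 0); last by apply/funext => w; rewrite big_nil.
  by split; [exact: integrable0|rewrite Rintegral_cst// mul0r big_nil].
rewrite (_ : (fun w => _) = (fun w => f i w + \sum_(i <- r) f i w)); last first.
  by apply/funext => w; rewrite big_cons.
split; last by rewrite RintegralD// ih2 big_cons.
have := integrableD measurableT (fi i) ih1.
by apply: eq_integrable => // w _; rewrite /= EFinD.
Qed.

Lemma Rintegral_generator k l1 l2 (f : int -> T -> R) n :
  (forall j, m.-integrable setT (EFin \o f j)) ->
  \int[m]_w generator k l1 l2 (f^~ w) n = generator k l1 l2 (fun j => \int[m]_w f j w) n.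
Proof.
move=> fi; rewrite /generator.
have [i1 e1] := Rintegral_sum (index_iota 1 k.+1) (fun j : nat => fi (n - j%:Z)).
have [i2 e2] := Rintegral_sum (index_iota 1 k.+1) (fun j : nat => fi (n + j%:Z)).
have Z c (h : T -> R) : m.-integrable setT (EFin \o h) ->
    m.-integrable setT (EFin \o (fun w => c * h w)).
  by move=> ih; have := integrableZl measurableT c ih; apply: eq_integrable => // w _; rewrite /= EFinM.
have i12 : m.-integrable setT (EFin \o (fun w => l1 * \sum_(1 <= j < k.+1) f (n - j%:Z) w +
    l2 * \sum_(1 <= j < k.+1) f (n + j%:Z) w)).
  have := integrableD measurableT (Z l1 _ i1) (Z l2 _ i2).
  by apply: eq_integrable => // w _; rewrite /= EFinD.
rewrite RintegralB//; last exact: Z.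
rewrite RintegralD//; [|exact: Z|exact: Z].
by rewrite !RintegralZl// e1 e2.
Qed.

End integral_generator.

Theorem proposition4p2 (R : realType) (d : measure_display)
  (T : measurableType d) (P : probability T R)
  (k : nat) (lambda1 lambda2 delta gamma : R)
  (S : R -> T -> int) (Y : R -> T -> R)
  (k_ge1 : (1 <= k)%N)
  (lambda1_gt0 : 0 < lambda1) (lambda2_gt0 : 0 < lambda2)
  (delta_gt0 : 0 < delta) (gamma_gt0 : 0 < gamma)
  (hS : is_SPoK P k lambda1 lambda2 S)
  (hY : is_IG_subordinator P delta gamma Y)
  (indep : independent_processes P
     nonneg_times (first_hitting_time Y) nonneg_times S) :
  let p (n : int) (t : R) := state_prob P (S t) n in
  let pbar (n : int) (t : R) :=
    state_prob P (fun w => S (first_hitting_time Y t w) w) n in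
  forall (n : int) (t : R), 0 < t ->
    has_caputo_half (exp_tilt gamma (pbar n)) t /\
    delta * IG_operator gamma (pbar n) t =
      (delta * gamma - k%:R * (lambda1 + lambda2)) * pbar n t
      + lambda1 * \sum_(1 <= j < k.+1) pbar (n - j%:Z) t
      + lambda2 * \sum_(1 <= j < k.+1) pbar (n + j%:Z) t
      - delta * gamma * erfc (gamma * Num.sqrt t / Num.sqrt 2) * p n 0.
Proof.
move=> p pbar n t t0.
have l10 := ltW lambda1_gt0; have l20 := ltW lambda2_gt0.
(* The forward operator applied at each time: [L pt] and [L (L pt)] are the first
   two time derivatives of [pt]. *)
pose L (f : int -> R -> R) m x := generator k lambda1 lambda2 (f^~ x) m.
pose K := generator_norm k lambda1 lambda2.
have dq := has_derivative_SPoK_truncation lambda1 lambda2 k_ge1.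
have q01 M m s : 0 <= s -> 0 <= SPoK_truncation k lambda1 lambda2 M m s <= 1.
  by move=> s0; have [_ + _] := SPoK_law k_ge1 hS m s0.
have qp m s : 0 <= s -> SPoK_truncation k lambda1 lambda2 M m s @[M --> \oo] --> p m s.
  by move=> s0; have [_ _] := SPoK_law k_ge1 hS m s0.
pose pt := clamp p.
have cpt m : continuous (pt m) := continuous_clamp l10 l20 dq q01 qp (n:=m).
have dpt m x : 0 < x -> has_derivative (pt m) x (L pt m x).
  by move=> x0; exact: (has_derivative_clamp l10 l20 dq q01 qp _ x0).
have npt m x : `|pt m x| <= 1 := clamp_norm q01 qp m x.
have cL f : (forall m, continuous (f m)) -> forall m, continuous (L f m).
  by move=> cf m; exact: continuous_generator.
have dL m x : 0 < x -> has_derivative (L pt m) x (L (L pt) m x).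
  by move=> x0; apply: has_derivative_generator => j; exact: dpt.
have nL f C : (forall m x, `|f m x| <= C) -> forall m x, `|L f m x| <= K * C.
  by move=> fC m x; apply: generator_bound => // j.
have nL1 := nL _ _ npt; have nL2 := nL _ _ nL1.
have pbarE m s : 0 < s ->
    P.-integrable setT (EFin \o (fun w => pt m (first_hitting_time Y s w))) /\
    pbar m s = \int[P]_w pt m (first_hitting_time Y s w).
  move=> s0; split.
    exact: (mean_first_hitting_time delta_gt0 gamma_gt0 hY s0 (cpt m) (cL _ cpt m) (dpt m)
      (fun x _ => nL1 m x)).1.
  apply: prob_time_change.
  - exact: measurable_first_hitting_time hY _.
  - by move=> w; exact: first_hitting_time_ge0.
  - by move=> r r0; have [] := SPoK_law k_ge1 hS m r0.
  - by move=> w r r0; exact: (SPoK_right_constant hS w r0).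
  - move=> B r mB r0; apply: indep.
      apply: sub_gen_smallest; exists s; first exact: ltW.
      by exists B => //; rewrite setTI.
    apply: sub_gen_smallest; exists r => //.
    by exists [set m] => //; rewrite setTI.
  - exact: cpt.
  - move=> r r0; have [mr _ _] := SPoK_law k_ge1 hS m r0.
    by rewrite /pt clampE// fineK//; exact: fin_prob.
  - exact: npt.
have pbar_cdf m s : 0 < s -> pbar m s = mean_cdf gamma delta (pt m) (L pt m) s.
  move=> s0; rewrite (pbarE m s s0).2.
  exact: (mean_first_hitting_time delta_gt0 gamma_gt0 hY s0 (cpt m) (cL _ cpt m) (dpt m)
    (fun x _ => nL1 m x)).2.
have mean_L : mean_cdf gamma delta (L pt n) (L (L pt) n) t = generator k lambda1 lambda2 (pbar^~ t) n.
  rewrite -(mean_first_hitting_time delta_gt0 gamma_gt0 hY t0 (cL _ cpt n) (cL _ (cL _ cpt) n)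
    (dL n) (fun x _ => nL2 n x)).2.
  rewrite /L (Rintegral_generator _ _ _ _ (f := fun m w => pt m (first_hitting_time Y t w))).
    rewrite /generator; congr (_ * _ + _ * _ - _ * _).
    + by apply: eq_bigr => j _; rewrite (pbarE _ t t0).2.
    + by apply: eq_bigr => j _; rewrite (pbarE _ t t0).2.
    + by rewrite (pbarE _ t t0).2.
  by move=> j; exact: (pbarE j t t0).1.
pose M := Num.max 1 (Num.max (K * 1) (K * (K * 1))).
have [M1 M2 M3] : [/\ 1 <= M, K * 1 <= M & K * (K * 1) <= M].
  by split; rewrite !le_max lexx ?orbT.
have [h1 h2] := caputo_mean_cdf gamma_gt0 delta_gt0 (cpt n) (cL _ cpt n) (cL _ (cL _ cpt) n)
  (dpt n) (dL n) (fun x _ => le_trans (nL1 n x) M2) (fun x _ => le_trans (nL2 n x) M3)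
  (fun x _ => le_trans (npt n x) M1) t0 (fun s s0 => pbar_cdf n s s0).
split; first exact: h1.
by rewrite h2 mean_L /pt clampE// /generator; ring.
Qed.
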